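(* For any integer-valued function $r=r(N)\le \frac12\frac{\log N}{\log\log N}$, there exists an $(O(N^{1/r}),O(N^{1-1/r}))$-implementation of resizable arrays that supports access and modify operations in $O(1)$ worst-case time and grow and shrink operations in $O(r)$ amortized time.
   Context: A resizable array stores a sequence $a_0,\dots,a_{N-1}$ ($N$ is its current size) and supports: creating an empty array, returning its length, reading or overwriting (modifying) the $i$-th item ($0\le i<N$), Grow$(a)$ which appends a new last item, and Shrink() which removes the last item. An implementation keeps its data in dynamically allocated fixed-length contiguous blocks of memory words; allocating or deallocating a block takes constant time; each item occupies one word and each pointer one word; every block other than a single main index block must be pointed to from some block. The space used at any moment is the total length of all currently allocated blocks. For non-decreasing functions $s,t$, an $(s(N),t(N))$-implementation uses at most $N+s(N)$ space to store an array of size $N$, and at most $N+t(N)$ space at any moment during a grow or shrink operation on an array of size $N$. The machine is a word RAM in which the index of the most significant set bit of a word can be computed in $O(1)$ time. Logarithms are base 2.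
   Formalization: Assumes r(N) ≥ 2 for large N (r = 1 is impossible) and that N^{1/r} and N^{1-1/r} are, up to constants, non-decreasing functions (else the claim fails, e.g. r alternating 2 and 3); the word RAM evaluates r in one step, and O-constants may depend on r. *)

(* Defs.v *)
From Stdlib Require Import Reals Arith List.
Import ListNotations.

(** * Asymptotics *)

Definition log2 (x : R) : R := (ln x / ln 2)%R.

Definition nondecreasing (f : nat -> R) : Prop :=
  forall M N, M <= N -> (f M <= f N)%R.

Definition bigO (f g : nat -> R) : Prop :=
  exists (C : R) (N0 : nat),
    forall N, N0 <= N -> (Rabs (f N) <= C * Rabs (g N))%R.

Definition bigTheta (f g : nat -> R) : Prop := bigO f g /\ bigO g f.

(** * The word RAM *)

(** Words are the naturals below [2 ^ word_size].  A block is named by a word,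
    its address; address 0 is never allocated. *)
Definition block := list nat.
Definition memory := nat -> option block.

(** [alloc_addr time m len] and [alloc_init time m len] are the address and the
    initial contents of the block handed out for a request of [len] words.  They
    are left to an adversary who sees the memory and the clock, so that a program
    can rely on neither.  [param] is the function [r] of the theorem; as [r] is
    arbitrary, evaluating it is a primitive instruction. *)
Record machine := Machine {
  word_size : nat;
  param : nat -> nat;
  alloc_addr : nat -> memory -> nat -> nat;
  alloc_init : nat -> memory -> nat -> block
}.

Definition word_bound (A : machine) : nat := 2 ^ word_size A.

Definition valid_machine (A : machine) : Prop :=
  forall time m len,
    length (alloc_init A time m len) = len /\
    Forall (fun v => v < word_bound A) (alloc_init A time m len) /\
    ((exists p, 0 < p < word_bound A /\ m p = None) ->
     0 < alloc_addr A time m len < word_bound A /\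
     m (alloc_addr A time m len) = None).

Definition reg := nat.

Inductive binop :=
  Add | Sub | Mul | Div | Mod | And | Or | Xor | Shl | Shr | Eq | Lt.

Inductive cmd :=
| Skip
| Const (x : reg) (n : nat)             (* x := n *)
| Bin (x : reg) (o : binop) (y z : reg) (* x := y o z *)
| Msb (x y : reg)                       (* x := index of the top set bit of y *)
| Param (x y : reg)                     (* x := r(y) *)
| Fetch (x p i : reg)                   (* x := p[i] *)
| Store (p i x : reg)                   (* p[i] := x *)
| Alloc (x n : reg)                     (* x := new block of n words *)
| Free (p : reg)
| Seq (c1 c2 : cmd)
| If (x : reg) (c1 c2 : cmd)            (* tests x <> 0 *)
| While (x : reg) (c : cmd).            (* tests x <> 0 *)

(** All results are truncated to a word; in particular [Sub] wraps around. *)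
Definition eval_binop (A : machine) (o : binop) (y z : nat) : nat :=
  match o with
  | Add => y + z
  | Sub => y + word_bound A - z
  | Mul => y * z
  | Div => y / z
  | Mod => y mod z
  | And => Nat.land y z
  | Or => Nat.lor y z
  | Xor => Nat.lxor y z
  | Shl => Nat.shiftl y z
  | Shr => Nat.shiftr y z
  | Eq => if y =? z then 1 else 0
  | Lt => if y <? z then 1 else 0
  end mod word_bound A.

Definition update {T : Type} (f : nat -> T) (k : nat) (v : T) : nat -> T :=
  fun j => if j =? k then v else f j.

Definition set_nth (b : block) (i v : nat) : block :=
  firstn i b ++ v :: skipn (S i) b.

(** [code] is the stack of commands still to be executed; it is empty when the
    program has halted. *)
Record config := Config {
  code : list cmd;
  regs : reg -> nat;
  mem : memory;
  clock : nat
}.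

(** One unit of time.  [None]: the program has halted, or has made an illegal
    memory access or an allocation request that cannot be served. *)
Definition step (A : machine) (c : config) : option config :=
  let 'Config k e m t := c in
  let next k' e' m' := Some (Config k' e' m' (S t)) in
  match k with
  | [] => None
  | Skip :: k => next k e m
  | Const x n :: k => next k (update e x (n mod word_bound A)) m
  | Bin x o y z :: k => next k (update e x (eval_binop A o (e y) (e z))) m
  | Msb x y :: k => next k (update e x (Nat.log2 (e y) mod word_bound A)) m
  | Param x y :: k => next k (update e x (param A (e y) mod word_bound A)) m
  | Fetch x p i :: k =>
      match m (e p) with
      | Some b =>
          match nth_error b (e i) with
          | Some v => next k (update e x v) m
          | None => None
          end
      | None => None
      end
  | Store p i x :: k =>
      match m (e p) with
      | Some b =>
          if e i <? length b
          then next k e (update m (e p) (Some (set_nth b (e i) (e x))))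
          else None
      | None => None
      end
  | Alloc x n :: k =>
      let p := alloc_addr A t m (e n) in
      match m p with
      | Some _ => None
      | None =>
          next k (update e x p) (update m p (Some (alloc_init A t m (e n))))
      end
  | Free p :: k =>
      match m (e p) with
      | Some _ => next k e (update m (e p) None)
      | None => None
      end
  | Seq c1 c2 :: k => next (c1 :: c2 :: k) e m
  | If x c1 c2 :: k => next ((if e x =? 0 then c2 else c1) :: k) e m
  | While x c' :: k =>
      next (if e x =? 0 then k else c' :: While x c' :: k) e m
  end.

Fixpoint steps (A : machine) (n : nat) (c : config) : option config :=
  match n with
  | 0 => Some c
  | S n => match step A c with Some c' => steps A n c' | None => None end
  end.

(** Total length of the allocated blocks. *)
Definition space (A : machine) (m : memory) : nat :=
  list_sum (map (fun p => match m p with Some b => length b | None => 0 end)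
                (seq 0 (word_bound A))).

(** * Resizable arrays *)

Inductive operation :=
| Length
| Get (i : nat)
| Modify (i a : nat)
| Grow (a : nat)
| Shrink.

Definition resizes (o : operation) : bool :=
  match o with Grow _ | Shrink => true | _ => false end.

Definition allowed (A : machine) (o : operation) (l : list nat) : Prop :=
  match o with
  | Length => True
  | Get i => i < length l
  | Modify i a => i < length l /\ a < word_bound A
  | Grow a => a < word_bound A
  | Shrink => 0 < length l
  end.

Definition apply (o : operation) (l : list nat) : list nat :=
  match o with
  | Length | Get _ => l
  | Modify i a => set_nth l i a
  | Grow a => l ++ [a]
  | Shrink => removelast l
  end.

Definition answer (o : operation) (l : list nat) : option nat :=
  match o with
  | Length => Some (length l)
  | Get i => nth_error l i
  | _ => None
  end.

Record implementation := Implementation {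
  create_code : cmd;
  length_code : cmd;
  get_code : cmd;
  modify_code : cmd;
  grow_code : cmd;
  shrink_code : cmd
}.

Definition code_of (P : implementation) (o : operation) : cmd :=
  match o with
  | Length => length_code P
  | Get _ => get_code P
  | Modify _ _ => modify_code P
  | Grow _ => grow_code P
  | Shrink => shrink_code P
  end.

(** Only the blocks and the address of the main index block survive from one
    operation to the next.  An operation starts with that address in register 0,
    an index in register 1 and an item in register 2 (0 where not applicable),
    and 0 in all other registers; it ends with the address of the (possibly new)
    main index block in register 0 and its answer, if any, in register 1. *)
Definition entry (main i a : nat) : reg -> nat :=
  fun x => match x with 0 => main | 1 => i | 2 => a | _ => 0 end.

Definition initial (P : implementation) : config :=
  Config [create_code P] (entry 0 0 0) (fun _ => None) 0.

(** [c] is the configuration in which the previous operation ended. *)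
Definition call (P : implementation) (o : operation) (c : config) : config :=
  Config [code_of P o]
    (match o with
     | Length | Shrink => entry (regs c 0) 0 0
     | Get i => entry (regs c 0) i 0
     | Modify i a => entry (regs c 0) i a
     | Grow a => entry (regs c 0) 0 a
     end)
    (mem c) (clock c).

Definition halts_in (A : machine) (c : config) (n : nat) (c' : config) : Prop :=
  steps A n c = Some c' /\ code c' = [].

Definition returns (c : config) (v : option nat) : Prop :=
  match v with Some v => regs c 1 = v | None => True end.

(** The usual assumption that a word has at least [log N + O(1)] bits. *)
Definition fits (A : machine) (kappa N : nat) : Prop :=
  kappa * (N + 1) <= word_bound A.

(** [history A P kappa l c h]: some sequence of operations on an array that is
    initially created empty, with sizes fitting throughout, has produced the
    array [l] and ended in configuration [c]; [h] lists, for every grow and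
    shrink operation performed, the array size before it and its running time. *)
Inductive history (A : machine) (P : implementation) (kappa : nat) :
  list nat -> config -> list (nat * nat) -> Prop :=
| history_create n c :
    fits A kappa 0 -> halts_in A (initial P) n c ->
    history A P kappa [] c []
| history_op l c h o n c' :
    history A P kappa l c h ->
    allowed A o l -> fits A kappa (length (apply o l)) ->
    halts_in A (call P o c) n c' ->
    history A P kappa (apply o l) c'
      (if resizes o then (length l, n) :: h else h).

(** [P] never faults, always terminates and answers correctly. *)
Definition correct (A : machine) (P : implementation) (kappa : nat) : Prop :=
  (fits A kappa 0 -> exists n c, halts_in A (initial P) n c) /\
  (forall l c h o,
     history A P kappa l c h ->
     allowed A o l -> fits A kappa (length (apply o l)) ->
     exists n c', halts_in A (call P o c) n c' /\ returns c' (answer o l)).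

(** Between operations, every block but the main one is pointed to. *)
Definition all_pointed (main : nat) (m : memory) : Prop :=
  (exists b, m main = Some b) /\
  (forall p b, m p = Some b ->
     p = main \/ exists q b', m q = Some b' /\ In p b').

Definition space_within (A : machine) (bound : R) (c : config) : Prop :=
  forall n c', steps A n c = Some c' -> (INR (space A (mem c')) <= bound)%R.

Definition space_bounded (A : machine) (P : implementation) (kappa : nat)
    (s t : nat -> R) : Prop :=
  (fits A kappa 0 -> space_within A (s 0) (initial P)) /\
  (forall l c h,
     history A P kappa l c h ->
     (INR (space A (mem c)) <= INR (length l) + s (length l))%R) /\
  (forall l c h o,
     history A P kappa l c h ->
     allowed A o l -> fits A kappa (length (apply o l)) ->
     space_within A
       (INR (length l) + (if resizes o then t else s) (length l))%R
       (call P o c)).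

(** [(s, t)]-implementation, run on machines whose parameter function is [r]. *)
Definition is_implementation (r : nat -> nat) (P : implementation) (kappa : nat)
    (s t : nat -> R) : Prop :=
  nondecreasing s /\ nondecreasing t /\
  forall A, valid_machine A -> (forall N, param A N = r N) ->
    correct A P kappa /\
    (forall l c h, history A P kappa l c h -> all_pointed (regs c 0) (mem c)) /\
    space_bounded A P kappa s t.

(** Access and modify take at most [C] steps. *)
Definition access_modify_time (r : nat -> nat) (P : implementation)
    (kappa C : nat) : Prop :=
  forall A, valid_machine A -> (forall N, param A N = r N) ->
  forall l c h o n c',
    history A P kappa l c h ->
    match o with Get _ | Modify _ _ => True | _ => False end ->
    allowed A o l -> fits A kappa (length (apply o l)) ->
    halts_in A (call P o c) n c' -> n <= C.

(** A grow or shrink operation on an array of size [N] takes amortized time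
    [T N]. *)
Definition grow_shrink_amortized_time (r : nat -> nat) (P : implementation)
    (kappa : nat) (T : nat -> R) : Prop :=
  forall A, valid_machine A -> (forall N, param A N = r N) ->
  forall l c h,
    history A P kappa l c h ->
    (INR (list_sum (map snd h)) <=
     fold_right Rplus 0 (map (fun p => T (fst p)) h))%R.

(** The functions [N^(1/r(N))] and [N^(1-1/r(N))]. *)
Definition root_r (r : nat -> nat) (N : nat) : R :=
  Rpower (INR N) (1 / INR (r N)).

Definition coroot_r (r : nat -> nat) (N : nat) : R :=
  Rpower (INR N) (1 - 1 / INR (r N)).

(* Main.v *)
(** Take [l] with [N] about [2 ^ l], put [k = l / (2 r)] and [b = 2 ^ k], so that [b ^ 2]
    is about [N ^ (1 / r)].  The items are stored in blocks whose sizes are powers of two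
    with ratio [b], from less than [b ^ 2] up to [2 ^ l / b ^ 2], that is, about
    [N ^ (1 - 1 / r)]; larger blocks come first and only the last block is partial.  There
    are [O(r)] levels of at most [2 b] blocks each, plus [O(b ^ 2)] blocks of the top level,
    and the bound on [r] gives [r = O(b)], so the pointers fit into [O(b ^ 2)] words.

    When a level with [2 b] blocks must receive one more, [b] of them are merged into one
    block of the next level; when an empty level must give one up, a block of the next level
    is split into [b].  Either way the level is left with [b] blocks, so that [b] times its
    block size many operations pay for the next merge or split: [O(1)] per level and
    operation.  The extra space is one block of the top level.

    A level below a nonempty one is never empty (level 0 aside), so the top bit of the
    distance of an item from the end determines its level up to an error of one.

    When the size has doubled or halved, a structure for the new [l] is built by popping all
    items and pushing them to a second array, twice because this reverses the order.  The
    hypotheses make [r] change by at most a constant factor between [N] and [8 N], so this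
    costs [O(r)] amortized as well. *)

Require Import Defs.
From Stdlib Require Import Reals Arith List Lia Lra Permutation Bool.
(* Some of the names in [Defs] are also used by the standard library. *)
Import Defs.
Import ListNotations.

(** With [L = log N], the bound on [r] says [N^(1/r) >= L^2]; so [b], of the order of the square
    root of [N^(1/r)], is at least of the order of [L], which bounds the number of levels.

    The space bound holds at every instant, hence no step may keep a second copy of the items. A
    merge or split duplicates one block, and a rebuild moves single items: the old structure
    releases blocks while the new one acquires them, and both together hold [N] items.

    The allocator is an adversary, so a request must be shown to be servable. The program logic
    therefore carries a space budget [X] smaller than the number of addresses; as blocks are
    nonempty, some address is always free.

    Time is accounted for by two reserves: a potential that pays for merges and splits, and a
    credit, proportional to the distance of [N] from [2 ^ l], that pays for rebuilding.

    [N^(1/r(N))] and [N^(1-1/r(N))] need not be monotone, whereas the claimed bounds must be. They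
    are replaced by the monotone functions of the hypotheses, evaluated at a point that exceeds the
    capacity of the current structure and is still linear in [N]. *)

(** * Heaps and updates of single words *)

Definition heap := list (nat * block).

Definition heap_size (H : heap) : nat :=
  list_sum (map (fun q => length (snd q)) H).

Lemma heap_size_app H1 H2 : heap_size (H1 ++ H2) = heap_size H1 + heap_size H2.
Proof. unfold heap_size. now rewrite map_app, list_sum_app. Qed.

Lemma heap_size_cons p b H : heap_size ((p, b) :: H) = length b + heap_size H.
Proof. reflexivity. Qed.

Lemma list_sum_perm l1 l2 : Permutation l1 l2 -> list_sum l1 = list_sum l2.
Proof. induction 1; simpl; lia. Qed.

Lemma heap_size_perm H1 H2 : Permutation H1 H2 -> heap_size H1 = heap_size H2.
Proof. intros HP. apply list_sum_perm. now apply Permutation_map. Qed.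

Lemma set_nth_length b i v : i < length b -> length (set_nth b i v) = length b.
Proof.
  intros Hi. unfold set_nth. rewrite length_app, firstn_length_le by lia.
  cbn [length]. rewrite length_skipn. lia.
Qed.

Lemma nth_error_set_nth b i v j :
  i < length b ->
  nth_error (set_nth b i v) j = if j =? i then Some v else nth_error b j.
Proof.
  intros Hi. unfold set_nth.
  assert (Hf : length (firstn i b) = i) by (apply firstn_length_le; lia).
  destruct (Nat.eqb_spec j i) as [->|Hne].
  - rewrite nth_error_app2 by lia. rewrite Hf, Nat.sub_diag. reflexivity.
  - destruct (Nat.lt_ge_cases j i).
    + rewrite nth_error_app1 by lia. rewrite nth_error_firstn.
      destruct (Nat.ltb_spec j i); [reflexivity|lia].
    + rewrite nth_error_app2 by lia. rewrite Hf.
      replace (j - i) with (S (j - S i)) by lia. cbn [nth_error].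
      rewrite nth_error_skipn. f_equal. lia.
Qed.

Lemma Forall_set_nth (P : nat -> Prop) b i v :
  Forall P b -> P v -> Forall P (set_nth b i v).
Proof.
  intros Hb Hv. unfold set_nth. apply Forall_app. split.
  - rewrite <- (firstn_skipn i b), Forall_app in Hb. apply Hb.
  - constructor; [assumption|].
    rewrite <- (firstn_skipn (S i) b), Forall_app in Hb. apply Hb.
Qed.

Lemma set_nth_app u x w v : set_nth (u ++ x :: w) (length u) v = u ++ v :: w.
Proof.
  unfold set_nth. rewrite firstn_app, skipn_app, Nat.sub_diag, firstn_all.
  rewrite (skipn_all2 u) by lia.
  replace (S (length u) - length u) with 1 by lia.
  cbn [firstn skipn app]. now rewrite app_nil_r.
Qed.

Lemma update_at {T} (f : nat -> T) j v : update f j v j = v.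
Proof. unfold update. now rewrite Nat.eqb_refl. Qed.

Lemma update_other {T} (f : nat -> T) j v i : i <> j -> update f j v i = f i.
Proof. intros H1. unfold update. destruct (Nat.eqb_spec i j); [lia|reflexivity]. Qed.

(** * Programs with compound expressions *)

(** Registers from [temps] on hold intermediate values of expressions; programs
    do not mention them otherwise, and the logic below does not see them. *)
Definition temps : reg := 100.

Inductive expr :=
| V (x : reg)
| K (n : nat)
| B (o : binop) (e1 e2 : expr)
| G (e1 e2 : expr)
| M (e : expr)
| Q (e : expr).

(** Evaluation follows a stack discipline: code with target [d] writes only registers from [d] on,
    so the first operand survives in [d] while the second is computed in [S d]. [Or x x] serves as a
    register move. *)
Fixpoint comp (E : expr) (d : reg) : cmd :=
  match E with
  | V x => Bin d Or x x
  | K n => Const d n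
  | B o e1 e2 => Seq (comp e1 d) (Seq (comp e2 (S d)) (Bin d o d (S d)))
  | G e1 e2 => Seq (comp e1 d) (Seq (comp e2 (S d)) (Fetch d d (S d)))
  | M e => Seq (comp e d) (Msb d d)
  | Q e => Seq (comp e d) (Param d d)
  end.

Fixpoint cost (E : expr) : nat :=
  match E with
  | V _ | K _ => 1
  | B _ e1 e2 | G e1 e2 => cost e1 + cost e2 + 3
  | M e | Q e => cost e + 2
  end.

Definition assign (x : reg) (E : expr) : cmd :=
  Seq (comp E temps) (Bin x Or temps temps).
Definition put (e1 e2 e3 : expr) : cmd :=
  Seq (comp e1 temps) (Seq (comp e2 (S temps)) (Seq (comp e3 (S (S temps)))
    (Store temps (S temps) (S (S temps))))).
Definition new (x : reg) (E : expr) : cmd := Seq (comp E temps) (Alloc x temps).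
Definition free (E : expr) : cmd := Seq (comp E temps) (Free temps).
Definition cond (E : expr) (c1 c2 : cmd) : cmd := Seq (comp E temps) (If temps c1 c2).
(** [While] tests a register, so the test is compiled in front of the loop and once more at the end
    of the body. *)
Definition loop (E : expr) (c : cmd) : cmd :=
  Seq (comp E temps) (While temps (Seq c (comp E temps))).

(** * A program logic with time and space *)

Section Memory.

Variable A : machine.
Local Notation W := (word_bound A).

Definition agree (e1 e2 : reg -> nat) : Prop := forall x, x < temps -> e1 x = e2 x.

(** A list of blocks can be taken apart with [++] and rearranged up to permutation. Blocks are
    required to be nonempty so that the total length bounds the number of addresses in use. *)
Record represents (m : memory) (H : heap) : Prop := Represents {
  rep_nodup : NoDup (map fst H);
  rep_range : forall p, In p (map fst H) -> 0 < p < W;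
  rep_iff : forall p b, m p = Some b <-> In (p, b) H;
  rep_words : forall p b, In (p, b) H -> b <> [] /\ Forall (fun v => v < W) b
}.

Lemma represents_perm m H H' :
  Permutation H H' -> represents m H -> represents m H'.
Proof.
  intros HP [H1 H2 H3 H4].
  assert (HPf := Permutation_map fst HP).
  split.
  - eapply Permutation_NoDup; eassumption.
  - intros p Hp. apply H2. eapply Permutation_in; [symmetry|]; eassumption.
  - intros p b. rewrite H3. split; intros Hp.
    + eapply Permutation_in; eassumption.
    + eapply Permutation_in; [symmetry|]; eassumption.
  - intros p b Hp. apply (H4 p b). eapply Permutation_in; [symmetry|]; eassumption.
Qed.

Lemma represents_free m p b H :
  represents m ((p, b) :: H) -> represents (update m p None) H.
Proof.
  intros [H1 H2 H3 H4]. simpl in H1. inversion H1 as [|? ? Hn Hd]; subst.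
  split; auto.
  - intros q Hq. apply H2. now right.
  - intros q c. unfold update. destruct (Nat.eqb_spec q p) as [->|Hne].
    + split; [discriminate|]. intros Hq. exfalso. apply Hn.
      now apply (in_map fst) in Hq.
    + rewrite H3. simpl. split; [intros [E|]|]; auto. congruence.
  - intros q c Hq. apply (H4 q c). now right.
Qed.

Lemma represents_alloc m p b H :
  represents m H -> m p = None -> 0 < p < W -> b <> [] ->
  Forall (fun v => v < W) b ->
  represents (update m p (Some b)) ((p, b) :: H).
Proof.
  intros [H1 H2 H3 H4] Hm Hp Hb Hw.
  assert (Hn : ~ In p (map fst H)).
  { intros Hi. apply in_map_iff in Hi. destruct Hi as [[q c] [Hq Hi]].
    simpl in Hq. subst q. apply H3 in Hi. congruence. }
  split.
  - simpl. now constructor.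
  - intros q [<-|Hq]; auto.
  - intros q c. unfold update. destruct (Nat.eqb_spec q p) as [->|Hne].
    + split.
      * intros [= ->]. now left.
      * intros [[= ->]|Hi]; [reflexivity|].
        exfalso. apply Hn. now apply (in_map fst) in Hi.
    + rewrite H3. simpl. split; [now right|]. intros [E|]; auto. congruence.
  - intros q c [[= <- <-]|Hi]; [now split|]. eauto.
Qed.

Lemma update_update (m : memory) p u v : forall q,
  update (update m p u) p v q = update m p v q.
Proof. intros q. unfold update. now destruct (q =? p). Qed.

Lemma represents_ext m m' H :
  (forall q, m q = m' q) -> represents m H -> represents m' H.
Proof. intros He [H1 H2 H3 H4]. split; auto. intros p b. now rewrite <- He. Qed.

Lemma represents_store m p b b' H :
  represents m ((p, b) :: H) -> b' <> [] -> Forall (fun v => v < W) b' ->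
  represents (update m p (Some b')) ((p, b') :: H).
Proof.
  intros HR Hb Hw.
  apply (represents_ext (update (update m p None) p (Some b'))).
  { apply update_update. }
  apply represents_alloc; auto.
  - eapply represents_free; eassumption.
  - unfold update. now rewrite Nat.eqb_refl.
  - apply (rep_range _ _ HR). now left.
Qed.

Lemma list_sum_update (f : nat -> nat) p v l :
  NoDup l -> In p l -> f p = 0 ->
  list_sum (map (fun q => if q =? p then v else f q) l)
  = v + list_sum (map f l).
Proof.
  intros Hd Hp Hf. induction Hd as [|q l Hq Hd IH]; [contradiction|].
  simpl. destruct Hp as [->|Hp].
  - rewrite Nat.eqb_refl, Hf.
    replace (map (fun q => if q =? p then v else f q) l) with (map f l); [lia|].
    apply map_ext_in. intros a Ha. destruct (Nat.eqb_spec a p); congruence.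
  - destruct (Nat.eqb_spec q p); [congruence|]. rewrite IH by assumption. lia.
Qed.

Lemma represents_space m H : represents m H -> space A m = heap_size H.
Proof.
  revert m. induction H as [|[p b] H IH]; intros m HR.
  - unfold space. replace (map _ _) with (map (fun _ : nat => 0) (seq 0 W)).
    + induction (seq 0 W); simpl; auto.
    + apply map_ext. intros p. destruct (m p) eqn:E; [|reflexivity].
      apply (rep_iff _ _ HR) in E. contradiction.
  - rewrite heap_size_cons.
    assert (HR' := represents_free _ _ _ _ HR).
    rewrite <- (IH _ HR'). unfold space.
    rewrite <- (list_sum_update _ p (length b)).
    + f_equal. apply map_ext. intros q. unfold update.
      destruct (Nat.eqb_spec q p) as [->|]; [|reflexivity].
      replace (m p) with (Some b); [reflexivity|].
      symmetry. apply (rep_iff _ _ HR). now left.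
    + apply seq_NoDup.
    + apply in_seq. pose proof (rep_range _ _ HR p). simpl in *. lia.
    + unfold update. now rewrite Nat.eqb_refl.
Qed.

Lemma represents_length m H : represents m H -> length H <= heap_size H.
Proof.
  intros HR. pose proof (rep_words _ _ HR) as Hw. clear HR.
  induction H as [|[p b] H IH]; [reflexivity|].
  rewrite heap_size_cons. simpl length.
  destruct (Hw p b) as [Hb _]; [now left|].
  destruct b; [congruence|]. simpl.
  assert (length H <= heap_size H); [|lia].
  apply IH. intros q c Hq. apply (Hw q c). now right.
Qed.

End Memory.

(** * Rules of the logic *)

Section Logic.

Variables (A : machine) (X : nat).
Hypothesis valid_A : valid_machine A.
Hypothesis X_lt : X + 1 < word_bound A.
Local Notation W := (word_bound A).
Local Notation represents := (represents A).

(** Pigeonhole: nonempty blocks of total length at most [X] use at most [X < W - 1] of the [W - 1]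
    nonzero addresses. Thus every allocation within the budget succeeds. *)
Lemma represents_room m H :
  represents m H -> heap_size H <= X -> exists p, 0 < p < W /\ m p = None.
Proof.
  intros HR HX. pose proof (represents_length _ _ _ HR) as HL.
  destruct (Exists_dec (fun p => m p = None) (seq 1 (W - 1))) as [He|He].
  - intros p. destruct (m p); [right|left]; congruence.
  - apply Exists_exists in He. destruct He as [p [Hp E]].
    apply in_seq in Hp. exists p. split; [lia|assumption].
  - exfalso.
    assert (Hi : incl (seq 1 (W - 1)) (map fst H)).
    { intros p Hp. destruct (m p) as [b|] eqn:E.
      - apply (rep_iff _ _ _ HR) in E. now apply (in_map fst) in E.
      - exfalso. apply He. apply Exists_exists. eauto. }
    apply NoDup_incl_length in Hi; [|apply seq_NoDup].
    rewrite length_seq, length_map in Hi. lia.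
Qed.

Definition fits_word (e : reg -> nat) : Prop := forall x, e x < W.

Lemma fits_word_update e x v : fits_word e -> v < W -> fits_word (update e x v).
Proof. intros He Hv y. unfold update. destruct (y =? x); auto. Qed.

Definition runs (n : nat) (c c' : config) : Prop :=
  steps A n c = Some c' /\
  forall i c'', i <= n -> steps A i c = Some c'' -> space A (mem c'') <= X.

Lemma steps_add n m c :
  steps A (n + m) c =
  match steps A n c with Some c' => steps A m c' | None => None end.
Proof.
  revert c. induction n as [|n IH]; intros c; simpl; [reflexivity|].
  destruct (step A c); auto.
Qed.

Lemma runs_trans n m c c' c'' :
  runs n c c' -> runs m c' c'' -> runs (n + m) c c''.
Proof.
  intros [H1 H2] [H3 H4]. split.
  - now rewrite steps_add, H1.
  - intros i d Hi Hd. destruct (Nat.le_gt_cases i n) as [Hle|Hgt].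
    + eauto.
    + replace i with (n + (i - n)) in Hd by lia.
      rewrite steps_add, H1 in Hd. apply (H4 (i - n)); [lia|assumption].
Qed.

Lemma runs_step c c' m H m' H' :
  step A c = Some c' -> mem c = m -> mem c' = m' ->
  represents m H -> heap_size H <= X ->
  represents m' H' -> heap_size H' <= X -> runs 1 c c'.
Proof.
  intros Hs <- <- R1 S1 R2 S2. split.
  - simpl. now rewrite Hs.
  - intros i c'' Hi Hc. destruct i as [|[|i]]; [| |lia]; simpl in Hc.
    + injection Hc as <-. now rewrite (represents_space _ _ _ R1).
    + rewrite Hs in Hc. injection Hc as <-. now rewrite (represents_space _ _ _ R2).
Qed.

Lemma runs_step_same k e m t k' e' t' H :
  represents m H -> heap_size H <= X ->
  step A (Config k e m t) = Some (Config k' e' m t') ->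
  runs 1 (Config k e m t) (Config k' e' m t').
Proof. intros. eapply runs_step; eauto; reflexivity. Qed.

Ltac tick :=
  match goal with
  | HR : represents ?m ?H, HX : heap_size ?H <= X
    |- runs _ (Config _ _ ?m _) _ =>
      eapply (runs_step_same _ _ _ _ _ _ _ _ HR HX); cbn [step]
  end.

Definition holds (H : heap) (p i v : nat) : Prop :=
  exists b, In (p, b) H /\ nth_error b i = Some v.

(** [u o v] is [w], with no overflow or underflow. *)
Definition exact_binop (o : binop) (u v w : nat) : Prop :=
  match o with
  | Add => u + v < W /\ w = u + v
  | Sub => v <= u /\ w = u - v
  | Mul => u * v < W /\ w = u * v
  | Div => w = u / v
  | Mod => w = u mod v
  | Shl => u * 2 ^ v < W /\ w = u * 2 ^ v
  | Shr => w = u / 2 ^ v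
  | Eq => w = if u =? v then 1 else 0
  | Lt => w = if u <? v then 1 else 0
  | _ => False
  end.

Inductive evals : expr -> (reg -> nat) -> heap -> nat -> Prop :=
| evals_V x (e : reg -> nat) H v : (x <? temps) = true -> e x = v -> evals (V x) e H v
| evals_K n e H : n < W -> evals (K n) e H n
| evals_B o e1 e2 e H u v w :
    evals e1 e H u -> evals e2 e H v -> exact_binop o u v w -> evals (B o e1 e2) e H w
| evals_G e1 e2 e H p i v :
    evals e1 e H p -> evals e2 e H i -> holds H p i v -> evals (G e1 e2) e H v
| evals_M E e H u : evals E e H u -> evals (M E) e H (Nat.log2 u)
| evals_Q E e H u : evals E e H u -> param A u < W -> evals (Q E) e H (param A u).

Lemma eval_binop_ok o u v w :
  u < W -> v < W -> exact_binop o u v w -> eval_binop A o u v = w /\ w < W.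
Proof.
  intros Hu Hv Hw.
  assert (Hd : forall q, q <> 0 -> u / q <= u).
  { intros q Hq. apply Nat.Div0.div_le_upper_bound. nia. }
  destruct o; simpl in Hw; unfold eval_binop; try contradiction.
  - destruct Hw as [Hw ->]. now rewrite Nat.mod_small.
  - destruct Hw as [Hle ->].
    replace (u + W - v) with (u - v + 1 * W) by lia.
    rewrite Nat.Div0.mod_add, Nat.mod_small; lia.
  - destruct Hw as [Hw ->]. now rewrite Nat.mod_small.
  - assert (u / v < W) by (destruct v; [simpl; lia|specialize (Hd (S v)); lia]).
    subst w. now rewrite Nat.mod_small.
  - pose proof (Nat.Div0.mod_le u v). subst w. rewrite Nat.mod_small; lia.
  - destruct Hw as [Hw ->]. rewrite Nat.shiftl_mul_pow2. now rewrite Nat.mod_small.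
  - rewrite Nat.shiftr_div_pow2. specialize (Hd (2 ^ v) (Nat.pow_nonzero 2 v ltac:(lia))).
    subst w. rewrite Nat.mod_small; lia.
  - subst w. destruct (u =? v); rewrite Nat.mod_small; lia.
  - subst w. destruct (u <? v); rewrite Nat.mod_small; lia.
Qed.

Lemma represents_word m H p b i v :
  represents m H -> In (p, b) H -> nth_error b i = Some v -> v < W.
Proof.
  intros HR Hi Hv. destruct (rep_words _ _ _ HR _ _ Hi) as [_ Hw].
  rewrite Forall_forall in Hw. apply Hw. eapply nth_error_In; eassumption.
Qed.

(** The ghost registers [e] speak only of registers below [temps]. The induction needs that all
    registers below the target are kept, since an earlier operand may be waiting there. *)
Lemma comp_ok E : forall d e0 e m H t k v,
  temps <= d -> agree e0 e -> fits_word e0 ->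
  represents m H -> heap_size H <= X -> evals E e H v ->
  exists e1, runs (cost E) (Config (comp E d :: k) e0 m t)
                  (Config k e1 m (t + cost E)) /\
    (forall x, x < d -> e1 x = e0 x) /\ fits_word e1 /\ e1 d = v.
Proof.
  induction E; intros d e0 e m H t k v Hd Ha Hb HR HX HE; inversion HE; subst; clear HE;
    cbn [comp cost].
  - exists (update e0 d (e0 x)). split; [|split; [|split]].
    + tick. simpl. unfold eval_binop.
      rewrite Nat.lor_diag, Nat.mod_small, Nat.add_1_r by apply Hb. reflexivity.
    + intros y Hy. apply update_other. lia.
    + apply fits_word_update; [assumption|apply Hb].
    + rewrite update_at. apply Ha. now apply Nat.ltb_lt.
  - exists (update e0 d v). split; [|split; [|split]].
    + tick. simpl.
      rewrite Nat.mod_small, Nat.add_1_r by assumption. reflexivity.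
    + intros y Hy. apply update_other. lia.
    + now apply fits_word_update.
    + apply update_at.
  - edestruct (IHE1 d) as (e1 & R1 & A1 & B1 & P1); [eassumption..|].
    edestruct (IHE2 (S d) e1) as (e2 & R2 & A2 & B2 & P2);
      [lia|intros x Hx; rewrite A1 by lia; now apply Ha|eassumption..|].
    rewrite <- (A2 d) in P1 by lia. subst u v0.
    edestruct (eval_binop_ok o (e2 d) (e2 (S d))) as [P3 B3];
      [apply B2|apply B2|eassumption|].
    exists (update e2 d v). split; [|split; [|split]].
    + replace (cost E1 + cost E2 + 3) with (1 + (cost E1 + (1 + (cost E2 + 1)))) by lia.
      eapply runs_trans; [tick; reflexivity|]. eapply runs_trans; [exact R1|].
      eapply runs_trans; [tick; reflexivity|]. eapply runs_trans; [exact R2|].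
      tick. rewrite P3. do 2 f_equal. lia.
    + intros y Hy. rewrite update_other, A2, A1 by lia. reflexivity.
    + now apply fits_word_update.
    + apply update_at.
  - edestruct (IHE1 d) as (e1 & R1 & A1 & B1 & P1); [eassumption..|].
    edestruct (IHE2 (S d) e1) as (e2 & R2 & A2 & B2 & P2);
      [lia|intros x Hx; rewrite A1 by lia; now apply Ha|eassumption..|].
    rewrite <- (A2 d) in P1 by lia. subst p i.
    match goal with Hh : holds _ _ _ _ |- _ => destruct Hh as (b & Hi & Hv) end.
    exists (update e2 d v). split; [|split; [|split]].
    + replace (cost E1 + cost E2 + 3) with (1 + (cost E1 + (1 + (cost E2 + 1)))) by lia.
      eapply runs_trans; [tick; reflexivity|]. eapply runs_trans; [exact R1|].
      eapply runs_trans; [tick; reflexivity|]. eapply runs_trans; [exact R2|].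
      tick. apply (rep_iff _ _ _ HR) in Hi. rewrite Hi, Hv. do 2 f_equal. lia.
    + intros y Hy. rewrite update_other, A2, A1 by lia. reflexivity.
    + apply fits_word_update; [assumption|]. eapply represents_word; eassumption.
    + apply update_at.
  - edestruct (IHE d) as (e1 & R1 & A1 & B1 & P1); [eassumption..|]. subst u.
    assert (Hl : Nat.log2 (e1 d) < W).
    { eapply Nat.le_lt_trans; [apply Nat.log2_le_lin; lia|apply B1]. }
    exists (update e1 d (Nat.log2 (e1 d))). split; [|split; [|split]].
    + replace (cost E + 2) with (1 + (cost E + 1)) by lia.
      eapply runs_trans; [tick; reflexivity|]. eapply runs_trans; [exact R1|].
      tick. rewrite Nat.mod_small by assumption. do 2 f_equal. lia.
    + intros y Hy. rewrite update_other by lia. auto.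
    + now apply fits_word_update.
    + apply update_at.
  - edestruct (IHE d) as (e1 & R1 & A1 & B1 & P1); [eassumption..|]. subst u.
    exists (update e1 d (param A (e1 d))). split; [|split; [|split]].
    + replace (cost E + 2) with (1 + (cost E + 1)) by lia.
      eapply runs_trans; [tick; reflexivity|]. eapply runs_trans; [exact R1|].
      tick. rewrite Nat.mod_small by assumption. do 2 f_equal. lia.
    + intros y Hy. rewrite update_other by lia. auto.
    + now apply fits_word_update.
    + apply update_at.
Qed.

Lemma seq_comp_ok E d e0 e m H t c k v :
  temps <= d -> agree e0 e -> fits_word e0 ->
  represents m H -> heap_size H <= X -> evals E e H v ->
  exists e1, runs (cost E + 1) (Config (Seq (comp E d) c :: k) e0 m t)
                  (Config (c :: k) e1 m (t + (cost E + 1))) /\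
    (forall x, x < d -> e1 x = e0 x) /\ agree e1 e /\ fits_word e1 /\ e1 d = v.
Proof.
  intros Hd Ha Hb HR HX HE.
  destruct (comp_ok E d e0 e m H (S t) (c :: k) v Hd Ha Hb HR HX HE)
    as (e1 & R1 & A1 & B1 & P1).
  exists e1. split; [|split; [assumption|split; [|now split]]].
  - rewrite Nat.add_comm. eapply runs_trans; [tick; reflexivity|].
    replace (t + (1 + cost E)) with (S t + cost E) by lia. exact R1.
  - intros x Hx. rewrite A1 by lia. now apply Ha.
Qed.

(** [a] is the time spent so far. *)
Definition post := (reg -> nat) -> heap -> nat -> Prop.

(** Total correctness for every continuation [k], every machine state matching the ghost state [e],
    [H], and every clock value, on which the allocator may depend. The budget [X] is enforced at
    each intermediate step through [runs]. *)
Definition wp (c : cmd) (P : post) (e : reg -> nat) (H : heap) (a : nat) : Prop :=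
  forall e0 m t k, agree e0 e -> fits_word e0 -> represents m H -> heap_size H <= X ->
  exists n e1 m1 e2 H2,
    runs n (Config (c :: k) e0 m t) (Config k e1 m1 (t + n)) /\
    agree e1 e2 /\ fits_word e1 /\ represents m1 H2 /\ heap_size H2 <= X /\
    P e2 H2 (a + n).

Ltac conjs := split; [|split; [|split; [|split; [|split]]]]; try assumption.

Lemma wp_seq c1 c2 P e H a :
  wp c1 (wp c2 P) e H (S a) -> wp (Seq c1 c2) P e H a.
Proof.
  intros Hw e0 m t k H1 H2 H3 H4.
  destruct (Hw e0 m (S t) (c2 :: k) H1 H2 H3 H4)
    as (n & e1 & m1 & e2 & H' & R1 & A1 & B1 & M1 & S1 & Hw2).
  destruct (Hw2 e1 m1 (S t + n) k A1 B1 M1 S1)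
    as (n2 & e3 & m3 & e4 & H3' & R2 & A2 & B2 & M2 & S2 & HP).
  exists (1 + (n + n2)), e3, m3, e4, H3'. conjs.
  - eapply runs_trans; [tick; reflexivity|].
    eapply runs_trans; [exact R1|].
    replace (t + (1 + (n + n2))) with (S t + n + n2) by lia. exact R2.
  - replace (a + (1 + (n + n2))) with (S a + n + n2) by lia. exact HP.
Qed.

Lemma wp_skip (P : post) e H a : P e H (S a) -> wp Skip P e H a.
Proof.
  intros HP e0 m t k H1 H2 H3 H4.
  exists 1, e0, m, e, H. conjs.
  - tick. simpl. now rewrite Nat.add_1_r.
  - now rewrite Nat.add_1_r.
Qed.

Lemma agree_update e0 e x v : agree e0 e -> agree (update e0 x v) (update e x v).
Proof. intros Ha y Hy. unfold update. destruct (y =? x); auto. Qed.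

Lemma wp_assign x E v (P : post) e H a :
  evals E e H v -> P (update e x v) H (a + (cost E + 2)) -> wp (assign x E) P e H a.
Proof.
  intros HE HP e0 m t k H1 H2 H3 H4.
  edestruct (seq_comp_ok E temps e0) as (e1 & R1 & _ & A1 & B1 & P0);
    [lia|eassumption..|]. subst v.
  exists (cost E + 1 + 1), (update e1 x (e1 temps)), m, (update e x (e1 temps)), H. conjs.
  - eapply runs_trans; [exact R1|]. tick.
    unfold eval_binop. rewrite Nat.lor_diag, Nat.mod_small by apply B1.
    do 2 f_equal. lia.
  - now apply agree_update.
  - apply fits_word_update; auto.
  - now replace (cost E + 1 + 1) with (cost E + 2) by lia.
Qed.

Lemma wp_cond E v c1 c2 (P : post) e H a :
  evals E e H v ->
  (v <> 0 -> wp c1 P e H (a + (cost E + 2))) ->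
  (v = 0 -> wp c2 P e H (a + (cost E + 2))) ->
  wp (cond E c1 c2) P e H a.
Proof.
  intros HE P1 P2 e0 m t k H1 H2 H3 H4.
  edestruct (seq_comp_ok E temps e0) as (e1 & R1 & _ & A1 & B1 & P0);
    [lia|eassumption..|]. subst v.
  assert (Hw : wp (if e1 temps =? 0 then c2 else c1) P e H (a + (cost E + 2))).
  { destruct (Nat.eqb_spec (e1 temps) 0); auto. }
  destruct (Hw e1 m (S (t + (cost E + 1))) k A1 B1 H3 H4)
    as (n2 & e3 & m3 & e4 & H3' & R2 & A2 & B2 & M2 & S2 & HP).
  exists (cost E + 1 + (1 + n2)), e3, m3, e4, H3'. conjs.
  - eapply runs_trans; [exact R1|]. eapply runs_trans; [tick; reflexivity|].
    replace (t + (cost E + 1 + (1 + n2))) with (S (t + (cost E + 1)) + n2) by lia.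
    exact R2.
  - now replace (a + (cost E + 1 + (1 + n2))) with (a + (cost E + 2) + n2) by lia.
Qed.

(** The rest of a loop, from the evaluation of its test on; proofs about loops unfold
    one iteration and go by induction on a quantity that the iteration decreases. *)
Definition wp_iter E c (P : post) (e : reg -> nat) (H : heap) (a : nat) : Prop :=
  forall e0 m t k, agree e0 e -> fits_word e0 -> represents m H -> heap_size H <= X ->
  exists n e1 m1 e2 H2,
    runs n (Config (comp E temps :: While temps (Seq c (comp E temps)) :: k) e0 m t)
           (Config k e1 m1 (t + n)) /\
    agree e1 e2 /\ fits_word e1 /\ represents m1 H2 /\ heap_size H2 <= X /\
    P e2 H2 (a + n).

Lemma wp_loop E c P e H a : wp_iter E c P e H (S a) -> wp (loop E c) P e H a.
Proof.
  intros Hw e0 m t k H1 H2 H3 H4.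
  destruct (Hw e0 m (S t) k H1 H2 H3 H4)
    as (n & e1 & m1 & e2 & H' & R1 & A1 & B1 & M1 & S1 & HP).
  exists (1 + n), e1, m1, e2, H'. conjs.
  - eapply runs_trans; [tick; reflexivity|].
    replace (t + (1 + n)) with (S t + n) by lia. exact R1.
  - replace (a + (1 + n)) with (S a + n) by lia. assumption.
Qed.

Lemma wp_iter_false E c (P : post) e H a :
  evals E e H 0 -> P e H (a + (cost E + 1)) -> wp_iter E c P e H a.
Proof.
  intros HE HP e0 m t k H1 H2 H3 H4.
  edestruct (comp_ok E temps e0) as (e1 & R1 & A1 & B1 & E0); [lia|eassumption..|].
  exists (cost E + 1), e1, m, e, H. conjs.
  - eapply runs_trans; [exact R1|]. tick. rewrite E0. simpl. do 2 f_equal. lia.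
  - intros x Hx. rewrite A1 by assumption. now apply H1.
Qed.

Lemma wp_iter_true E v c (P : post) e H a :
  evals E e H v -> v <> 0 ->
  wp c (wp_iter E c P) e H (a + (cost E + 2)) -> wp_iter E c P e H a.
Proof.
  intros HE Hv Hw e0 m t k H1 H2 H3 H4.
  edestruct (comp_ok E temps e0) as (e1 & R1 & A1 & B1 & P0); [lia|eassumption..|].
  subst v.
  assert (A1' : agree e1 e) by (intros x Hx; rewrite A1 by assumption; now apply H1).
  destruct (Hw e1 m (S (S (t + cost E)))
     (comp E temps :: While temps (Seq c (comp E temps)) :: k) A1' B1 H3 H4)
    as (n2 & e3 & m3 & e4 & H3' & R2 & A2 & B2 & M2 & S2 & HP).
  destruct (HP e3 m3 (S (S (t + cost E)) + n2) k A2 B2 M2 S2)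
    as (n3 & e5 & m5 & e6 & H5 & R3 & A3 & B3 & M3 & S3 & HP3).
  exists (cost E + (1 + (1 + (n2 + n3)))), e5, m5, e6, H5. conjs.
  - eapply runs_trans; [exact R1|].
    eapply runs_trans.
    { tick. destruct (Nat.eqb_spec (e1 temps) 0); [contradiction|reflexivity]. }
    eapply runs_trans; [tick; reflexivity|].
    eapply runs_trans; [exact R2|].
    replace (t + (cost E + (1 + (1 + (n2 + n3)))))
      with (S (S (t + cost E)) + n2 + n3) by lia. exact R3.
  - replace (a + _) with (a + (cost E + 2) + n2 + n3) by lia. assumption.
Qed.

Lemma wp_iter_perm E c P e H H' a :
  Permutation H H' -> wp_iter E c P e H' a -> wp_iter E c P e H a.
Proof.
  intros HP Hw e0 m t k H1 H2 H3 H4.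
  rewrite (heap_size_perm _ _ HP) in H4.
  apply (represents_perm _ _ _ _ HP) in H3. eauto.
Qed.

Lemma wp_put e1 e2 e3 p i v b F (P : post) e H a :
  evals e1 e H p -> evals e2 e H i -> evals e3 e H v ->
  Permutation H ((p, b) :: F) -> i < length b ->
  P e ((p, set_nth b i v) :: F) (a + (cost e1 + cost e2 + cost e3 + 4)) ->
  wp (put e1 e2 e3) P e H a.
Proof.
  intros HE1 HE2 HE3 Hp Hi HP e0 m t k H1 H2 H3 H4. unfold put.
  edestruct (seq_comp_ok e1 temps e0) as (e4 & R1 & _ & A1 & B1 & P1); [lia|eassumption..|].
  edestruct (seq_comp_ok e2 (S temps) e4) as (e5 & R2 & C2 & A2 & B2 & P2);
    [lia|eassumption..|].
  edestruct (seq_comp_ok e3 (S (S temps)) e5) as (e6 & R3 & C3 & A3 & B3 & P3);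
    [lia|eassumption..|].
  rewrite <- (C2 temps), <- (C3 temps) in P1 by lia. rewrite <- (C3 (S temps)) in P2 by lia.
  assert (R4 := represents_perm _ _ _ _ Hp H3).
  assert (Hb : m p = Some b) by (apply (rep_iff _ _ _ R4); now left).
  set (b' := set_nth b i v) in *.
  assert (Hl : length b' = length b) by now apply set_nth_length.
  assert (R5 : represents (update m p (Some b')) ((p, b') :: F)).
  { eapply represents_store; [exact R4| |].
    - intros E0. rewrite E0 in Hl. simpl in Hl. lia.
    - apply Forall_set_nth; [|rewrite <- P3; apply B3].
      apply (rep_words _ _ _ R4 p b). now left. }
  assert (S5 : heap_size ((p, b') :: F) <= X).
  { rewrite (heap_size_perm _ _ Hp) in H4. rewrite heap_size_cons in *. lia. }
  exists (cost e1 + 1 + (cost e2 + 1 + (cost e3 + 1 + 1))), e6,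
    (update m p (Some b')), e, ((p, b') :: F). conjs.
  - eapply runs_trans; [exact R1|]. eapply runs_trans; [exact R2|].
    eapply runs_trans; [exact R3|].
    eapply runs_step; [|reflexivity|reflexivity|exact H3|exact H4|exact R5|exact S5].
    cbn [step]. rewrite P1, P2, P3, Hb. destruct (Nat.ltb_spec i (length b)); [|lia].
    do 2 f_equal. lia.
  - replace (a + _) with (a + (cost e1 + cost e2 + cost e3 + 4)) by lia. assumption.
Qed.

Lemma wp_free E p b F (P : post) e H a :
  evals E e H p -> Permutation H ((p, b) :: F) -> P e F (a + (cost E + 2)) ->
  wp (free E) P e H a.
Proof.
  intros HE Hp HP e0 m t k H1 H2 H3 H4.
  edestruct (seq_comp_ok E temps e0) as (e4 & R1 & _ & A1 & B1 & P1); [lia|eassumption..|].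
  assert (R4 := represents_perm _ _ _ _ Hp H3).
  assert (Hb : m p = Some b) by (apply (rep_iff _ _ _ R4); now left).
  assert (R5 := represents_free _ _ _ _ _ R4).
  assert (S5 : heap_size F <= X).
  { rewrite (heap_size_perm _ _ Hp) in H4. rewrite heap_size_cons in H4. lia. }
  exists (cost E + 1 + 1), e4, (update m p None), e, F. conjs.
  - eapply runs_trans; [exact R1|].
    eapply runs_step; [|reflexivity|reflexivity|exact H3|exact H4|exact R5|exact S5].
    cbn [step]. rewrite P1, Hb. do 2 f_equal. lia.
  - now replace (cost E + 1 + 1) with (cost E + 2) by lia.
Qed.

(** The postcondition ranges over all addresses and all contents of the right length, as the
    adversary chooses both; freshness of the address is recorded by [represents] for the extended
    heap. *)
Lemma wp_new x E n (P : post) e H a :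
  evals E e H n -> 0 < n -> heap_size H + n <= X ->
  (forall p b, length b = n -> P (update e x p) ((p, b) :: H) (a + (cost E + 2))) ->
  wp (new x E) P e H a.
Proof.
  intros HE Hn Hs HP e0 m t k H1 H2 H3 H4.
  edestruct (seq_comp_ok E temps e0) as (e4 & R1 & _ & A1 & B1 & P1); [lia|eassumption..|].
  destruct (valid_A (t + (cost E + 1)) m n) as (V1 & V2 & V3).
  destruct (V3 (represents_room _ _ H3 H4)) as [V4 V5].
  set (p := alloc_addr A (t + (cost E + 1)) m n) in *.
  set (b := alloc_init A (t + (cost E + 1)) m n) in *.
  assert (R5 : represents (update m p (Some b)) ((p, b) :: H)).
  { apply represents_alloc; auto. intros E0. rewrite E0 in V1. simpl in V1. lia. }
  assert (S5 : heap_size ((p, b) :: H) <= X) by (rewrite heap_size_cons; lia).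
  exists (cost E + 1 + 1), (update e4 x p), (update m p (Some b)), (update e x p),
    ((p, b) :: H). conjs.
  - eapply runs_trans; [exact R1|].
    eapply runs_step; [|reflexivity|reflexivity|exact H3|exact H4|exact R5|exact S5].
    cbn [step]. rewrite P1. fold p b. rewrite V5. do 2 f_equal. lia.
  - now apply agree_update.
  - apply fits_word_update; [assumption|lia].
  - replace (cost E + 1 + 1) with (cost E + 2) by lia. auto.
Qed.

Lemma evals_eq E e H v v' : evals E e H v -> v = v' -> evals E e H v'.
Proof. now intros HE <-. Qed.

Lemma holds_in H p b i v :
  In (p, b) H -> nth_error b i = Some v -> holds H p i v.
Proof. intros H1 H2. now exists b. Qed.

Lemma holds_perm H H' p i v : Permutation H H' -> holds H' p i v -> holds H p i v.
Proof.
  intros HP (b & H1 & H2). exists b. split; [|assumption].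
  eapply Permutation_in; [symmetry|]; eassumption.
Qed.

End Logic.

(** * Deciding permutations by cancelling common pieces *)

Lemma perm_front_here {T} (a r : list T) : Permutation (a ++ r) (a ++ r).
Proof. reflexivity. Qed.

Lemma perm_front_next {T} (a b r r' : list T) :
  Permutation r (a ++ r') -> Permutation (b ++ r) (a ++ b ++ r').
Proof. intros ->. apply Permutation_app_swap_app. Qed.

Lemma perm_front_next_cons {T} (a r r' : list T) x :
  Permutation r (a ++ r') -> Permutation (x :: r) (a ++ x :: r').
Proof. intros ->. apply Permutation_middle. Qed.

Lemma perm_cancel {T} (a l r r' : list T) :
  Permutation r (a ++ r') -> Permutation l r' -> Permutation (a ++ l) r.
Proof. intros -> ->. reflexivity. Qed.

Lemma perm_front_cons_here {T} (x : T) r : Permutation (x :: r) (x :: r).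
Proof. reflexivity. Qed.

Lemma perm_front_cons_next {T} (b r r' : list T) x :
  Permutation r (x :: r') -> Permutation (b ++ r) (x :: b ++ r').
Proof. intros ->. symmetry. apply Permutation_middle. Qed.

Lemma perm_front_cons_next_cons {T} (r r' : list T) x y :
  Permutation r (x :: r') -> Permutation (y :: r) (x :: y :: r').
Proof. intros ->. apply perm_swap. Qed.

Lemma perm_cancel_cons {T} (x : T) l r r' :
  Permutation r (x :: r') -> Permutation l r' -> Permutation (x :: l) r.
Proof. intros -> ->. reflexivity. Qed.

Lemma perm_pad {T} (l r : list T) :
  Permutation (l ++ []) (r ++ []) -> Permutation l r.
Proof. now rewrite !app_nil_r. Qed.

Ltac perm_find :=
  first [ apply perm_front_here | apply perm_front_cons_here
        | apply perm_front_next; perm_find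
        | apply perm_front_next_cons; perm_find
        | apply perm_front_cons_next; perm_find
        | apply perm_front_cons_next_cons; perm_find ].
Ltac perm_loop :=
  first [ apply perm_nil
        | eapply perm_cancel; [perm_find|]; perm_loop
        | eapply perm_cancel_cons; [perm_find|]; perm_loop ].
(** Permutations of concatenations of the same pieces. *)
Ltac perm := apply perm_pad; repeat (rewrite <- app_assoc || cbn [app]); perm_loop.

(** Moves one block to the front. *)
Ltac pull := repeat (rewrite <- app_assoc || cbn [app]); perm_find.

(** * Block sizes and the layout of the index block *)

(** An array of about [2 ^ l] items uses levels [0 .. top]; a block of level [j]
    has [size j] words, which is [2 ^ k] times [size] of the level below, and
    [size top = 2 ^ (l - 2 * k)].  Here [2 ^ k] is about the square root of
    [N ^ (1 / r)]. *)
Definition admissible (k l : nat) : Prop := 3 <= k /\ 4 * k <= l /\ l <= 2 * 2 ^ k.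

(** The remainder of [l] modulo [k] goes into the lowest exponent, so that consecutive sizes have
    ratio exactly [2 ^ k] and the top exponent is exactly [l - 2 * k]. The 3 in [top] accounts for
    these [2 * k] and for the summand [k] here. *)
Definition low (k l : nat) : nat := k + l mod k.
Definition top (k l : nat) : nat := l / k - 3.
Definition size (k l j : nat) : nat := 2 ^ (low k l + k * j).
(** In front of the pointers there are four header words and the [top + 2] starts of the levels
    [0 .. top + 1]; each level below the top has [2 * 2 ^ k] pointers. *)
Definition slot (k l j : nat) : nat := top k l + 6 + j * 2 ^ (k + 1).
Definition index_size (k l : nat) : nat := slot k l (top k l) + 2 * 2 ^ (2 * k).

Section Sizes.

Variables k l : nat.
Hypothesis adm : admissible k l.

Lemma quotient_ge : 4 <= l / k.
Proof.
  destruct adm as (H3 & H4 & _).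
  apply Nat.div_le_lower_bound; lia.
Qed.

Lemma low_top : low k l + k * top k l = l - 2 * k.
Proof.
  destruct adm as (H3 & H4 & _). unfold low, top. pose proof quotient_ge as Hq.
  pose proof (Nat.div_mod_eq l k) as Hd. nia.
Qed.

Lemma top_pos : 1 <= top k l.
Proof. unfold top. pose proof quotient_ge. lia. Qed.

Lemma top_le : top k l <= l.
Proof.
  destruct adm as (H3 & _ & _). unfold top.
  assert (l / k <= l) by (apply Nat.Div0.div_le_upper_bound; nia). lia.
Qed.

Lemma low_lt : low k l < 2 * k.
Proof.
  destruct adm as (H3 & _ & _). unfold low.
  pose proof (Nat.mod_upper_bound l k). lia.
Qed.

Lemma size_S j : size k l (S j) = 2 ^ k * size k l j.
Proof. unfold size. rewrite <- Nat.pow_add_r. f_equal. lia. Qed.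

Lemma size_pos j : 0 < size k l j.
Proof. unfold size. apply Nat.neq_0_lt_0, Nat.pow_nonzero. lia. Qed.

Lemma size_mono i j : i <= j -> size k l i <= size k l j.
Proof. intros Hij. unfold size. apply Nat.pow_le_mono_r; nia. Qed.

Lemma size_top : size k l (top k l) = 2 ^ (l - 2 * k).
Proof. unfold size. now rewrite low_top. Qed.

(** Explains the number of pointers reserved for the top level: it alone can hold the maximal number
    of items. *)
Lemma size_top_max : 2 * 2 ^ (2 * k) * size k l (top k l) = 2 ^ S l.
Proof.
  rewrite size_top, <- Nat.mul_assoc, <- Nat.pow_add_r, Nat.pow_succ_r'.
  destruct adm. do 2 f_equal. lia.
Qed.

Lemma branching_ge : 8 <= 2 ^ k.
Proof.
  destruct adm as (H3 & _ & _). change 8 with (2 ^ 3).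
  apply Nat.pow_le_mono_r; lia.
Qed.

Lemma size_zero_le : size k l 0 <= 2 ^ (2 * k).
Proof. unfold size. apply Nat.pow_le_mono_r; [lia|]. pose proof low_lt. lia. Qed.

Lemma double_branching : 2 ^ (k + 1) = 2 * 2 ^ k.
Proof. now rewrite Nat.add_1_r, Nat.pow_succ_r'. Qed.

Lemma square_branching : 2 ^ (2 * k) = 2 ^ k * 2 ^ k.
Proof. rewrite <- Nat.pow_add_r. f_equal. lia. Qed.

(** Here the bound on [r] takes effect: [l <= 2 * 2 ^ k] limits the number of levels, so the
    pointers of the lower levels need at most [4 * 2 ^ (2 * k)] words, beside [2 * 2 ^ (2 * k)] for
    the top level. *)
Lemma index_size_le : index_size k l <= 8 * 2 ^ (2 * k).
Proof.
  unfold index_size, slot. rewrite double_branching, square_branching.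
  pose proof branching_ge as Hb. pose proof top_le as Ht. destruct adm as (_ & _ & H5).
  set (b := 2 ^ k) in *. set (t := top k l) in *.
  assert (t * (2 * b) <= (2 * b) * (2 * b)) by (apply Nat.mul_le_mono_r; lia).
  assert (8 * b <= b * b) by (apply Nat.mul_le_mono_r; lia).
  lia.
Qed.

Lemma square_le_top : 2 ^ (2 * k) <= size k l (top k l).
Proof. rewrite size_top. destruct adm. apply Nat.pow_le_mono_r; lia. Qed.

Lemma index_size_le_max : index_size k l <= 2 ^ S l.
Proof.
  eapply Nat.le_trans; [apply index_size_le|].
  rewrite <- size_top_max. pose proof square_le_top. pose proof branching_ge.
  pose proof square_branching. nia.
Qed.

Lemma slot_S j : slot k l (S j) = slot k l j + 2 * 2 ^ k.
Proof. unfold slot. rewrite <- double_branching. lia. Qed.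

Lemma slot_mono i j : i <= j -> slot k l i <= slot k l j.
Proof. unfold slot. nia. Qed.

End Sizes.

(** * Contents of the data blocks *)

Definition slice (D : nat -> nat) (s n : nat) : block := map D (seq s n).

Lemma slice_length D s n : length (slice D s n) = n.
Proof. unfold slice. now rewrite length_map, length_seq. Qed.

Lemma slice_app D s n n' : slice D s (n + n') = slice D s n ++ slice D (s + n) n'.
Proof. unfold slice. now rewrite seq_app, map_app. Qed.

Lemma slice_ext D D' s n :
  (forall i, s <= i < s + n -> D i = D' i) -> slice D s n = slice D' s n.
Proof. intros HD. apply map_ext_in. intros i Hi. apply in_seq in Hi. auto. Qed.

Lemma nth_error_slice D s n i :
  i < n -> nth_error (slice D s n) i = Some (D (s + i)).
Proof.
  intros Hi. unfold slice. rewrite nth_error_map, nth_error_nth' with (d := 0).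
  - simpl. now rewrite seq_nth.
  - now rewrite length_seq.
Qed.

Lemma slice_of_block D s (b : block) :
  slice (fun i => if i <? s then D i else nth (i - s) b 0) s (length b) = b.
Proof.
  apply nth_ext with 0 0.
  - apply slice_length.
  - intros i Hi. rewrite slice_length in Hi.
    apply nth_error_nth. rewrite nth_error_slice by assumption.
    destruct (Nat.ltb_spec (s + i) s); [lia|]. do 2 f_equal. lia.
Qed.

Fixpoint blocks (D : nat -> nat) (s z : nat) (ps : list nat) : heap :=
  match ps with
  | [] => []
  | p :: ps => (p, slice D s z) :: blocks D (s + z) z ps
  end.

Lemma blocks_app D s z ps qs :
  blocks D s z (ps ++ qs) = blocks D s z ps ++ blocks D (s + z * length ps) z qs.
Proof.
  revert s. induction ps as [|p ps IH]; intros s; simpl.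
  - now rewrite Nat.mul_0_r, Nat.add_0_r.
  - rewrite IH. do 3 f_equal. lia.
Qed.

Lemma blocks_size D s z ps : heap_size (blocks D s z ps) = z * length ps.
Proof.
  revert s. induction ps as [|p ps IH]; intros s; simpl blocks.
  - now rewrite Nat.mul_0_r.
  - rewrite heap_size_cons, IH, slice_length. simpl. lia.
Qed.

Lemma blocks_ext D D' s z ps :
  (forall i, s <= i < s + z * length ps -> D i = D' i) ->
  blocks D s z ps = blocks D' s z ps.
Proof.
  revert s. induction ps as [|p ps IH]; intros s HD; simpl in *; [reflexivity|].
  f_equal.
  - f_equal. apply slice_ext. intros i Hi. apply HD. nia.
  - apply IH. intros i Hi. apply HD. nia.
Qed.

Lemma blocks_fst D s z ps : map fst (blocks D s z ps) = ps.
Proof.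
  revert s. induction ps as [|p ps IH]; intros s; simpl; [reflexivity|].
  now rewrite IH.
Qed.

(** * Arrays *)

(** [lv j] lists the addresses of the blocks of level [j]; [Vs j] is the total
    capacity of the levels from [j] on, hence the index of the first item of
    level [j - 1]. *)
Section Arrays.

Variables k l : nat.
Hypothesis adm : admissible k l.
Local Notation J := (top k l).
Local Notation sz := (size k l).

(** [core_lo] makes all blocks above level 0 full; [core_hi] and [core_gap] make the last block of
    level 0 the only partial one and forbid that it is empty. *)
Record core (lv : nat -> list nat) (Vs : nat -> nat) (N : nat) : Prop := Core {
  core_top : Vs (S J) = 0;
  core_eq : forall j, j <= J -> Vs j = Vs (S j) + sz j * length (lv j);
  core_lo : Vs 1 <= N;
  core_hi : N <= Vs 0;
  core_gap : Vs 0 < N + sz 0;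
  core_max : N <= 2 ^ S l
}.

(** Level [cf] may be full and level [cn] empty below a nonempty level; this is
    no exception for level [0]. *)
Record shape (cf cn : nat) (lv : nat -> list nat) (Vs : nat -> nat) (N : nat) : Prop :=
Shape {
  shape_core : core lv Vs N;
  shape_le : forall j, j < J -> length (lv j) <= 2 * 2 ^ k;
  shape_lt : forall j, 1 <= j < J -> j <> cf -> length (lv j) < 2 * 2 ^ k;
  shape_ne : forall j, 1 <= j <= J -> j <> cn -> 0 < Vs (S j) -> 0 < length (lv j)
}.

(** Entry 0 stores the length in place of [Vs 0]: the latter is [N] rounded up to the end of the
    last block, from which the length could not be recovered. *)
Definition start (Vs : nat -> nat) (N j : nat) : nat :=
  match j with 0 => N | S _ => Vs j end.

Record table (lv : nat -> list nat) (Vs : nat -> nat) (N : nat) (b : block) : Prop :=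
Table {
  table_length : length b = index_size k l;
  table_k : nth_error b 0 = Some k;
  table_l : nth_error b 1 = Some l;
  table_low : nth_error b 2 = Some (low k l);
  table_top : nth_error b 3 = Some J;
  table_start : forall j, j <= S J -> nth_error b (4 + j) = Some (start Vs N j);
  table_slot : forall j x, j <= J -> x < length (lv j) ->
    nth_error b (slot k l j + x) = nth_error (lv j) x
}.

Definition level (lv : nat -> list nat) (Vs : nat -> nat) (D : nat -> nat) (j : nat) : heap :=
  blocks D (Vs (S j)) (sz j) (lv j).

Definition levels lv Vs D : heap := flat_map (level lv Vs D) (seq 0 (S J)).

Lemma core_mono lv Vs N i j :
  core lv Vs N -> i <= j -> j <= S J -> Vs j <= Vs i.
Proof.
  intros HC Hij. induction Hij as [|j Hij IH]; [lia|]. intros Hj.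
  rewrite (core_eq _ _ _ HC j) in IH by lia. lia.
Qed.

Lemma levels_size_from lv Vs D N j n :
  core lv Vs N -> j + n = S J ->
  heap_size (flat_map (level lv Vs D) (seq j n)) = Vs j.
Proof.
  intros HC. revert j. induction n as [|n IH]; intros j Hj; simpl.
  - replace j with (S J) by lia. now rewrite (core_top _ _ _ HC).
  - unfold level at 1. rewrite heap_size_app, blocks_size, IH by lia.
    rewrite (core_eq _ _ _ HC j); lia.
Qed.

Lemma levels_size lv Vs D N : core lv Vs N -> heap_size (levels lv Vs D) = Vs 0.
Proof. intros HC. now apply levels_size_from with N. Qed.

Lemma levels_zero lv Vs D :
  levels lv Vs D = level lv Vs D 0 ++ flat_map (level lv Vs D) (seq 1 J).
Proof. reflexivity. Qed.

Definition others lv Vs D j : heap :=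
  flat_map (level lv Vs D) (seq 0 j) ++
  flat_map (level lv Vs D) (seq (S (S j)) (J - S j)).

Lemma levels_split lv Vs D j :
  j < J ->
  Permutation (levels lv Vs D)
              (level lv Vs D j ++ level lv Vs D (S j) ++ others lv Vs D j).
Proof.
  intros Hj. unfold levels, others.
  replace (S J) with (j + S (S (J - S j))) by lia.
  rewrite seq_app, flat_map_app. simpl. perm.
Qed.

Definition set_levels (lv : nat -> list nat) (j : nat) (ps qs : list nat) :=
  update (update lv j ps) (S j) qs.

Lemma set_levels_at lv j ps qs : set_levels lv j ps qs j = ps.
Proof.
  unfold set_levels, update. rewrite Nat.eqb_refl.
  destruct (Nat.eqb_spec j (S j)); [lia|reflexivity].
Qed.

Lemma set_levels_next lv j ps qs : set_levels lv j ps qs (S j) = qs.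
Proof. unfold set_levels, update. now rewrite Nat.eqb_refl. Qed.

Lemma set_levels_other lv j ps qs i :
  i <> j -> i <> S j -> set_levels lv j ps qs i = lv i.
Proof.
  intros H1 H2. unfold set_levels, update.
  destruct (Nat.eqb_spec i (S j)); [lia|]. destruct (Nat.eqb_spec i j); [lia|reflexivity].
Qed.

Lemma others_set_levels lv Vs D j ps qs v :
  others (set_levels lv j ps qs) (update Vs (S j) v) D j = others lv Vs D j.
Proof.
  unfold others, level. f_equal.
  - rewrite !flat_map_concat_map. f_equal. apply map_ext_in.
    intros i Hi. apply in_seq in Hi.
    rewrite set_levels_other, update_other by lia. reflexivity.
  - rewrite !flat_map_concat_map. f_equal. apply map_ext_in.
    intros i Hi. apply in_seq in Hi.
    rewrite set_levels_other, update_other by lia. reflexivity.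
Qed.

Lemma core_set_levels lv Vs N j ps qs v :
  core lv Vs N -> j < J -> v <= N ->
  v = Vs (S (S j)) + sz (S j) * length qs ->
  Vs j = v + sz j * length ps ->
  core (set_levels lv j ps qs) (update Vs (S j) v) N.
Proof.
  intros HC Hj Hv E1 E2. destruct HC as [H1 H2 H3 H4 H5 H6]. split; auto.
  - rewrite update_other by lia. assumption.
  - intros i Hi.
    destruct (Nat.eq_dec i (S j)) as [->|Hn1].
    { rewrite update_at, update_other, set_levels_next by lia. assumption. }
    rewrite update_other by lia.
    destruct (Nat.eq_dec i j) as [->|Hn2].
    { rewrite update_at, set_levels_at by lia. assumption. }
    rewrite update_other, set_levels_other by lia. auto.
  - destruct (Nat.eq_dec 1 (S j)) as [->|]; [now rewrite update_at|].
    now rewrite update_other by lia.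
Qed.

Lemma length_top lv Vs N : core lv Vs N -> length (lv J) <= 2 * 2 ^ (2 * k).
Proof.
  intros HC. pose proof (top_pos k l adm) as HJ.
  pose proof (core_mono _ _ _ 1 J HC HJ (Nat.le_succ_diag_r _)) as Hm.
  rewrite (core_eq _ _ _ HC J), (core_top _ _ _ HC) in Hm by lia.
  pose proof (core_lo _ _ _ HC). pose proof (core_max _ _ _ HC).
  pose proof (size_top_max k l adm). pose proof (size_pos k l J). nia.
Qed.

(** * The potential *)

(** The levels up to [j] hold [N - Vs (S j)] items.  Level [j] is emptied into a
    block of level [j + 1] when this number has grown to [2 * size (j + 1)], and
    refilled from one when it has dropped to almost [0]; either way about
    [size (j + 1)] remain. *)
Definition phi (Vs : nat -> nat) (N j : nat) : nat :=
  (2 * (N - Vs (S j)) - 3 * sz (S j)) +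
  (if Vs (S j) =? 0 then 0 else 2 * (sz (S j) - (N - Vs (S j)))).

Definition potential (Vs : nat -> nat) (N : nat) : nat :=
  list_sum (map (phi Vs N) (seq 0 J)).

Lemma list_sum_le (f g : nat -> nat) c xs :
  (forall x, f x <= g x + c) ->
  list_sum (map f xs) <= list_sum (map g xs) + c * length xs.
Proof.
  intros Hfg. induction xs as [|x xs IH]; simpl; [lia|]. specialize (Hfg x). lia.
Qed.

Lemma potential_grow Vs N : potential Vs (S N) <= potential Vs N + 2 * J.
Proof.
  pose proof (list_sum_le (phi Vs (S N)) (phi Vs N) 2 (seq 0 J)) as HL.
  rewrite length_seq in HL. apply HL.
  intros j. unfold phi. destruct (Vs (S j) =? 0); lia.
Qed.

Lemma potential_shrink Vs N : potential Vs N <= potential Vs (S N) + 2 * J.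
Proof.
  pose proof (list_sum_le (phi Vs N) (phi Vs (S N)) 2 (seq 0 J)) as HL.
  rewrite length_seq in HL. apply HL.
  intros j. unfold phi. destruct (Vs (S j) =? 0); lia.
Qed.

(** Only the summand of level [j] reads [Vs (S j)], so a merge or split between [j] and [S j]
    affects no other summand. *)
Lemma potential_update Vs N j v z :
  j < J -> phi (update Vs (S j) v) N j + z <= phi Vs N j ->
  potential (update Vs (S j) v) N + z <= potential Vs N.
Proof.
  intros Hj Hz. unfold potential.
  replace J with (j + S (J - S j)) by lia.
  rewrite seq_app, !map_app, !list_sum_app. simpl seq. simpl map.
  assert (Hsame : forall s n, (forall i : nat, s <= i < s + n -> i <> j) ->
    map (phi (update Vs (S j) v) N) (seq s n) = map (phi Vs N) (seq s n)).
  { intros s n Hn. apply map_ext_in. intros i Hi. apply in_seq in Hi.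
    unfold phi. rewrite update_other; [reflexivity|]. specialize (Hn i). lia. }
  rewrite (Hsame 0), (Hsame (S j)) by lia. simpl. lia.
Qed.

End Arrays.

(** * The programs *)

Declare Scope expr_scope.
Delimit Scope expr_scope with expr.
Bind Scope expr_scope with expr.
Infix "+" := (B Add) : expr_scope.
Infix "-" := (B Sub) : expr_scope.
Infix "*" := (B Mul) : expr_scope.
Infix "/" := (B Div) : expr_scope.
Infix "mod" := (B Mod) : expr_scope.
Infix "<" := (B Lt) : expr_scope.
Infix "==" := (B Eq) (at level 70, no associativity) : expr_scope.
Infix "<<" := (B Shl) (at level 35, no associativity) : expr_scope.
Infix ">>" := (B Shr) (at level 35, no associativity) : expr_scope.
Infix ";;" := Seq (at level 61, right associativity).

(** Register 0 holds the address of the index block throughout. *)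
Definition word (i : nat) : expr := G (V 0) (K i).
Definition start_of (E : expr) : expr := G (V 0) (K 4 + E).

Definition copy : cmd :=
  assign 5 (K 0);;
  loop (V 5 < V 10)
    (put (V 6) (V 8 + V 5) (G (V 7) (V 9 + V 5));; assign 5 (V 5 + K 1)).

Definition merge_test : expr := V 4 < (K 1 << V 11).
(** The first [2 ^ k] blocks of the level are merged: they hold its smallest indices and thus adjoin
    the next level. Pointer [x + 2 ^ k] replaces pointer [x], which moves the remaining half to the
    front. *)
Definition merge_body : cmd :=
  assign 7 (G (V 0) (V 18 + V 4));;
  assign 8 (V 4 << V 17);;
  copy;;
  free (V 7);;
  put (V 0) (V 18 + V 4) (G (V 0) (V 18 + V 4 + (K 1 << V 11)));;
  assign 4 (V 4 + K 1).

Definition split_body : cmd :=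
  new 6 (V 10);;
  put (V 0) (V 18 + V 4) (V 6);;
  assign 9 (V 4 << V 17);;
  copy;;
  assign 4 (V 4 + K 1).

(** Sets up registers 10, 17, 18 for level [V 3]: the size of its blocks, the
    binary logarithm of this size, and the position of its first pointer. *)
Definition select_level : cmd :=
  assign 17 (V 13 + V 11 * V 3);;
  assign 10 (K 1 << V 17);;
  assign 18 (V 14 + K 6 + (V 3 << (V 11 + K 1)));;
  assign 4 (K 0).

Definition next_slot : expr :=
  V 18 + (K 2 << V 11) +
  ((start_of (V 3 + K 1) - start_of (V 3 + K 2)) >> (V 17 + V 11)).

(** The product acts as a conjunction whose factors are both evaluated; this is why the table has an
    entry for the level after the top one. Full means [2 * size (j + 1)] items, that is, [2 * 2 ^ k]
    blocks. *)
Definition carry_test : expr :=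
  (V 3 < V 14) *
  ((start_of (V 3) - start_of (V 3 + K 1)) == (K 2 << (V 13 + V 11 * (V 3 + K 1)))).
Definition carry_body : cmd :=
  select_level;;
  assign 9 (K 0);;
  new 6 (K 1 << (V 17 + V 11));;
  loop merge_test merge_body;;
  put (V 0) next_slot (V 6);;
  put (V 0) (K 4 + (V 3 + K 1)) (start_of (V 3 + K 1) + (K 1 << (V 17 + V 11)));;
  assign 3 (V 3 + K 1).

(** At the top level the second factor is 0, as the entry after it is 0; so the loop stops there
    without comparing levels. *)
Definition borrow_test : expr :=
  (start_of (V 3) == start_of (V 3 + K 1)) * (K 0 < start_of (V 3 + K 1)).
Definition borrow_body : cmd :=
  select_level;;
  assign 8 (K 0);;
  assign 7 (G (V 0) (next_slot - K 1));;
  loop merge_test split_body;;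
  free (V 7);;
  put (V 0) (K 4 + (V 3 + K 1)) (start_of (V 3 + K 1) - (K 1 << (V 17 + V 11)));;
  assign 3 (V 3 + K 1).

Definition read_header : cmd :=
  assign 11 (word 0);; assign 13 (word 2);; assign 14 (word 3).

Definition offset : expr := start_of (K 0) - start_of (K 1).
Definition last_slot (E : expr) : expr := V 14 + K 6 + (E >> V 13).

(** Appends the item in register 2. *)
Definition push : cmd :=
  read_header;;
  cond (offset mod (K 1 << V 13)) Skip
    (assign 3 (K 0);; loop carry_test carry_body;;
     new 6 (K 1 << V 13);;
     put (V 0) (last_slot offset) (V 6));;
  put (G (V 0) (last_slot offset)) (offset mod (K 1 << V 13)) (V 2);;
  put (V 0) (K 4) (start_of (K 0) + K 1).

(** Moves the last item to register 2. *)
Definition pop : cmd :=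
  read_header;;
  assign 3 (K 0);; loop borrow_test borrow_body;;
  put (V 0) (K 4) (start_of (K 0) - K 1);;
  assign 7 (G (V 0) (last_slot offset));;
  assign 2 (G (V 7) (offset mod (K 1 << V 13)));;
  cond (offset mod (K 1 << V 13)) Skip (free (V 7)).

(** * Symbolic execution *)

(** A boolean membership test, so that for concrete registers the side condition holds by
    computation. *)
Definition same (R : list reg) (e' e : reg -> nat) : Prop :=
  forall x, existsb (Nat.eqb x) R = false -> e' x = e x.

Ltac rd :=
  lazymatch goal with
  | |- update _ ?x _ ?x = _ => apply update_at
  | |- update _ _ _ _ = _ => eapply eq_trans; [apply update_other; discriminate|]; rd
  | |- ?e _ = _ =>
      first [ eassumption
            | match goal with
              | Hs : same _ e _ |- _ =>
                  eapply eq_trans; [apply Hs; reflexivity|]; rd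
              end ]
  end.

Ltac kept :=
  let x := fresh "x" in let Hx := fresh "Hx" in
  intros x Hx; cbn [existsb seq] in Hx;
  repeat (apply orb_false_iff in Hx; destruct Hx as [? Hx]);
  let rec go :=
    lazymatch goal with
    | |- update _ _ _ _ = _ =>
        eapply eq_trans; [apply update_other; apply Nat.eqb_neq; assumption|]; go
    | |- ?e _ = ?e _ => reflexivity
    | |- ?e _ = _ =>
        match goal with
        | Hs : same _ e _ |- _ =>
            eapply eq_trans;
              [apply Hs; cbn [existsb seq];
               repeat (apply orb_false_iff; split); solve [assumption | reflexivity]
              |]; go
        end
    end in go.

(** Follows the syntax of the expression. Only the operations that may leave the range of a word
    pass a bound to [side]; for the others the value is fixed by reflexivity. *)
Ltac calc side :=
  cbv beta delta [word start_of offset last_slot next_slot merge_test carry_test borrow_test];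
  lazymatch goal with
  | |- evals _ (V _) _ _ _ => apply evals_V; [reflexivity | rd]
  | |- evals _ (K _) _ _ _ => apply evals_K; side
  | |- evals _ (B Add _ _) _ _ _ => calc_exact side
  | |- evals _ (B Sub _ _) _ _ _ => calc_exact side
  | |- evals _ (B Mul _ _) _ _ _ => calc_exact side
  | |- evals _ (B Shl _ _) _ _ _ => calc_exact side
  | |- evals _ (B _ _ _) _ _ _ => eapply evals_B; [calc side | calc side | reflexivity]
  | |- evals _ (G _ _) _ _ _ => eapply evals_G; [calc side | calc side | side]
  | |- evals _ (M _) _ _ _ => eapply evals_M; calc side
  | |- evals _ (Q _) _ _ _ => eapply evals_Q; [calc side | side]
  end
with calc_exact side :=
  eapply evals_B; [calc side | calc side | split; [cbn [start]; side | reflexivity]].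

Ltac then_ := apply wp_seq; [assumption|].
Ltac set_ n := apply wp_assign with (v := n); [assumption | | ].

(** * Copying, merging and splitting blocks *)

Section Loops.

Variables (A : machine) (X : nat).
Hypothesis valid_A : valid_machine A.
Hypothesis X_lt : X + 1 < word_bound A.
Hypothesis W_gt : 100 < word_bound A.
Local Notation W := (word_bound A).
Local Notation wp := (wp A X).
Local Notation wp_iter := (wp_iter A X).

Lemma nth_error_at (u w : block) x i : i = length u -> nth_error (u ++ x :: w) i = Some x.
Proof. intros ->. rewrite nth_error_app2, Nat.sub_diag by lia. reflexivity. Qed.

(** Loop invariant: [u] has been copied, [w'] is still to come, and [w] are the words of the
    destination that it will overwrite. *)
Lemma copy_iter p s p' s' dst src F (P : post) : forall w' w u e H a,
  length w = length w' -> e 5 = length u ->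
  e 6 = dst -> e 7 = src -> e 8 = length p -> e 9 = length p' ->
  e 10 = length u + length w' ->
  length p + length u + length w < W -> length p' + length u + length w < W ->
  Permutation H ((dst, p ++ u ++ w ++ s) :: (src, p' ++ (u ++ w') ++ s') :: F) ->
  (forall e' a', same [5] e' e -> a' <= a + 40 * length w' + 10 ->
     P e' ((dst, p ++ (u ++ w') ++ s) :: (src, p' ++ (u ++ w') ++ s') :: F) a') ->
  wp_iter (V 5 < V 10)
    (put (V 6) (V 8 + V 5) (G (V 7) (V 9 + V 5));; assign 5 (V 5 + K 1)) P e H a.
Proof.
  induction w' as [|y w' IH]; intros w u e H a Hw E5 E6 E7 E8 E9 E10 B1 B2 HP Hpost.
  - destruct w; [|discriminate]. simpl length in *.
    apply wp_iter_perm with (1 := HP).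
    apply wp_iter_false; [assumption| |].
    + eapply evals_eq; [calc lia|].
      destruct (Nat.ltb_spec (length u) (length u + 0)); [lia|reflexivity].
    + cbn [cost]. rewrite app_nil_r in Hpost. simpl app. rewrite app_nil_r.
      apply Hpost; [intros x Hx; reflexivity|lia].
  - destruct w as [|x w]; [discriminate|]. simpl length in *.
    eapply wp_iter_true with (v := 1); [assumption| |discriminate|].
    { eapply evals_eq; [calc lia|].
      destruct (Nat.ltb_spec (length u) (length u + S (length w'))); [reflexivity|lia]. }
    then_. eapply wp_put with (v := y) (i := length p + length u).
    { assumption. }
    { calc lia. }
    { calc lia. }
    { calc ltac:(first [lia | eapply holds_perm; [exact HP|];
        eapply holds_in; [right; left; reflexivity|];
        rewrite <- app_assoc, app_assoc; apply nth_error_at; rewrite length_app; lia]). }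
    { exact HP. }
    { rewrite !length_app. simpl. lia. }
    set_ (length u + 1); [calc lia|].
    replace (set_nth (p ++ u ++ (x :: w) ++ s) (length p + length u) y)
      with (p ++ (u ++ [y]) ++ w ++ s).
    2:{ rewrite (app_assoc p u ((x :: w) ++ s)), <- length_app. cbn [app].
        rewrite set_nth_app. now rewrite <- !app_assoc. }
    eapply IH with (u := u ++ [y]) (w := w); try rd; rewrite ?length_app; simpl length; try lia.
    + rd.
    + eapply eq_trans; [rd|]. lia.
    + apply perm_skip. rewrite <- !app_assoc. reflexivity.
    + intros e' a' Hs Ha.
      rewrite <- (app_assoc u [y] w'). apply Hpost.
      * kept.
      * revert Ha. cbn [cost]. lia.
Qed.

Lemma copy_ok p m s p' m' s' dst src F (P : post) e H a :
  length m = length m' ->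
  e 6 = dst -> e 7 = src -> e 8 = length p -> e 9 = length p' -> e 10 = length m' ->
  length p + length m < W -> length p' + length m < W ->
  Permutation H ((dst, p ++ m ++ s) :: (src, p' ++ m' ++ s') :: F) ->
  (forall e' a', same [5] e' e -> a' <= a + 40 * length m' + 20 ->
     P e' ((dst, p ++ m' ++ s) :: (src, p' ++ m' ++ s') :: F) a') ->
  wp copy P e H a.
Proof.
  intros Hm E6 E7 E8 E9 E10 B1 B2 HP Hpost. unfold copy. then_.
  set_ 0; [calc lia|]. apply wp_loop; [assumption|].
  eapply copy_iter with (u := []) (w := m) (w' := m'); try rd; simpl length; try lia.
  - exact HP.
  - intros e' a' Hs Ha. apply Hpost; [kept|]. revert Ha. cbn [cost]. lia.
Qed.

(** Loop invariant: [x] blocks have been merged into [u] and freed, [rest] are the addresses still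
    to merge, and [w] is the unwritten part of the new block. The pointers read for the shift lie at
    [2 ^ kk] and beyond, where no iteration writes. *)
Lemma merge_iter q main D z ex kk sl (P : post) : forall rest x s u w bx F e H a,
  e 0 = main -> e 4 = x -> e 6 = q -> e 9 = 0 -> e 10 = z -> e 11 = kk ->
  e 17 = ex -> e 18 = sl ->
  z = 2 ^ ex -> x + length rest = 2 ^ kk ->
  length u = x * z -> length w = z * length rest ->
  2 ^ kk * z < W -> sl + 2 * 2 ^ kk <= length bx -> length bx < W ->
  Permutation H ((q, u ++ w) :: (main, bx) :: blocks D s z rest ++ F) ->
  (forall i, i < length rest -> nth_error bx (sl + x + i) = nth_error rest i) ->
  (forall e' b' a',
     same [4; 5; 7; 8] e' e -> length b' = length bx ->
     (forall i, sl + x <= i < sl + 2 ^ kk ->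
        nth_error b' i = nth_error bx (i + 2 ^ kk)) ->
     (forall i, i < sl + x \/ sl + 2 ^ kk <= i -> nth_error b' i = nth_error bx i) ->
     a' <= a + (40 * z + 100) * length rest + 20 ->
     P e' ((q, u ++ slice D s (z * length rest)) :: (main, b') :: F) a') ->
  wp_iter merge_test merge_body P e H a.
Proof.
  induction rest as [|p rest IH];
    intros x s u w bx F e H a E0 E4 E6 E9 E10 E11 E17 E18 Hz Hx Hu Hw B1 B2 B3 HP Hb Hpost;
    simpl length in *.
  - assert (w = []) as -> by (destruct w; [reflexivity|]; simpl in Hw; lia).
    apply wp_iter_perm with (1 := HP). apply wp_iter_false; [assumption| |].
    + eapply evals_eq; [calc lia|].
      destruct (Nat.ltb_spec x (1 * 2 ^ kk)); [lia|reflexivity].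
    + replace (slice D s (z * 0)) with (@nil nat) in Hpost
        by (rewrite Nat.mul_0_r; reflexivity).
      apply Hpost; auto.
      * intros y _. reflexivity.
      * intros i Hi. lia.
      * cbn. lia.
  - assert (Hz1 : 1 <= z) by (pose proof (Nat.pow_nonzero 2 ex); lia).
    assert (HxW : x * z + z <= 2 ^ kk * z) by nia.
    assert (Hp : nth_error bx (sl + x) = Some p).
    { rewrite <- (Nat.add_0_r (sl + x)). apply Hb. lia. }
    destruct (nth_error bx (sl + x + 2 ^ kk)) as [v|] eqn:Hv.
    2:{ apply nth_error_None in Hv. lia. }
    rewrite <- (firstn_skipn z w) in HP.
    assert (Hw1 : length (firstn z w) = z) by (rewrite firstn_length_le; nia).
    assert (Hw2 : length (skipn z w) = z * length rest) by (rewrite length_skipn; nia).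
    set (w1 := firstn z w) in *. set (w2 := skipn z w) in *. clearbody w1 w2.
    apply wp_iter_perm with (1 := HP). clear HP.
    eapply wp_iter_true with (v := 1); [assumption| |discriminate|].
    { eapply evals_eq; [calc lia|].
      destruct (Nat.ltb_spec x (1 * 2 ^ kk)); [reflexivity|lia]. }
    then_. set_ p.
    { calc ltac:(first [lia | eapply holds_in; [right; left; reflexivity|exact Hp]]). }
    then_. set_ (x * z). { eapply evals_eq; [calc lia|]. now rewrite Hz. }
    then_. eapply copy_ok with (p := u) (m := w1) (s := w2) (p' := []) (m' := slice D s z)
      (s' := []) (dst := q) (src := p)
      (F := (main, bx) :: blocks D (s + z) z rest ++ F); try rd.
    { now rewrite slice_length. }
    { eapply eq_trans; [rd|]. lia. }
    { rewrite slice_length. rd. }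
    { lia. }
    { simpl. lia. }
    { rewrite app_nil_r. cbn [blocks app]. perm. }
    intros e' a' Hs Ha. rewrite slice_length in Ha.
    then_. eapply wp_free with (p := p); [assumption|calc lia|apply perm_swap|].
    then_. eapply wp_put with (p := main) (i := sl + x) (v := v).
    { assumption. }
    { calc lia. }
    { calc lia. }
    { calc ltac:(first [lia |
        eapply holds_in; [right; left; reflexivity|rewrite <- Hv; f_equal; lia]]). }
    { apply perm_swap. }
    { lia. }
    set_ (x + 1); [calc lia|].
    eapply IH with (x := x + 1) (s := s + z) (u := u ++ slice D s z) (w := w2)
      (bx := set_nth bx (sl + x) v) (F := F); try rd; try lia.
    + rewrite length_app, slice_length. lia.
    + rewrite set_nth_length; lia.
    + rewrite set_nth_length; lia.
    + rewrite <- app_assoc. perm.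
    + intros i Hi. rewrite nth_error_set_nth by lia.
      destruct (Nat.eqb_spec (sl + (x + 1) + i) (sl + x)); [lia|].
      specialize (Hb (S i)). replace (sl + (x + 1) + i) with (sl + x + S i) by lia.
      apply Hb. lia.
    + intros e2 b' a2 Hs2 Hl Hin Hout Ha2. rewrite <- app_assoc, <- slice_app.
      replace (z + z * length rest) with (z * S (length rest)) by lia.
      apply Hpost.
      * kept.
      * rewrite Hl, set_nth_length; lia.
      * intros i Hi. destruct (Nat.eq_dec i (sl + x)) as [->|Hn].
        -- rewrite Hout by lia. rewrite nth_error_set_nth, Nat.eqb_refl by lia.
           now rewrite Hv.
        -- rewrite Hin by lia. rewrite nth_error_set_nth by lia.
           destruct (Nat.eqb_spec (i + 2 ^ kk) (sl + x)); [lia|reflexivity].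
      * intros i Hi. rewrite Hout by lia. rewrite nth_error_set_nth by lia.
        destruct (Nat.eqb_spec i (sl + x)); [lia|reflexivity].
      * revert Ha Ha2. cbn [cost merge_test]. lia.
Qed.

(** The source block stays allocated until all parts are copied, so the budget must have room for
    the [z * n] words still to be allocated. *)
Lemma split_iter p main D z ex kk sl s0 (P : post) : forall n x bx F e H a,
  e 0 = main -> e 4 = x -> e 7 = p -> e 8 = 0 -> e 10 = z -> e 11 = kk ->
  e 17 = ex -> e 18 = sl ->
  z = 2 ^ ex -> x + n = 2 ^ kk ->
  2 ^ kk * z < W -> sl + 2 ^ kk <= length bx -> length bx < W ->
  Permutation H ((p, slice D s0 (2 ^ kk * z)) :: (main, bx) :: F) ->
  heap_size H + z * n <= X ->
  (forall e' b' a' qs H',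
     same [4; 5; 6; 9] e' e -> length b' = length bx -> length qs = n ->
     (forall i, i < n -> nth_error b' (sl + x + i) = nth_error qs i) ->
     (forall i, i < sl + x \/ sl + 2 ^ kk <= i -> nth_error b' i = nth_error bx i) ->
     a' <= a + (40 * z + 100) * n + 20 ->
     Permutation H' ((p, slice D s0 (2 ^ kk * z)) :: (main, b') ::
           blocks D (s0 + x * z) z qs ++ F) ->
     P e' H' a') ->
  wp_iter merge_test split_body P e H a.
Proof.
  induction n as [|n IH];
    intros x bx F e H a E0 E4 E7 E8 E10 E11 E17 E18 Hz Hx B1 B2 B3 HP HX Hpost.
  - apply wp_iter_perm with (1 := HP). apply wp_iter_false; [assumption| |].
    + eapply evals_eq; [calc lia|].
      destruct (Nat.ltb_spec x (1 * 2 ^ kk)); [lia|reflexivity].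
    + apply (Hpost e bx _ []); auto.
      * intros y _. reflexivity.
      * intros i Hi. lia.
      * cbn. lia.
  - assert (Hz1 : 1 <= z) by (pose proof (Nat.pow_nonzero 2 ex); lia).
    assert (HxW : x * z + z <= 2 ^ kk * z) by nia.
    rewrite (heap_size_perm _ _ HP) in HX.
    apply wp_iter_perm with (1 := HP). clear HP.
    eapply wp_iter_true with (v := 1); [assumption| |discriminate|].
    { eapply evals_eq; [calc lia|].
      destruct (Nat.ltb_spec x (1 * 2 ^ kk)); [reflexivity|lia]. }
    then_. eapply wp_new; [assumption|assumption|calc lia|lia|lia|].
    intros q c Hc.
    then_. eapply wp_put with (p := main) (i := sl + x) (v := q).
    { assumption. }
    { calc lia. }
    { calc lia. }
    { calc lia. }
    { pull. }
    { lia. }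
    then_. set_ (x * z). { eapply evals_eq; [calc lia|]. now rewrite Hz. }
    replace (2 ^ kk * z) with (x * z + (z + z * n)) by nia.
    rewrite !slice_app.
    then_. eapply copy_ok with (p := []) (m := c) (s := [])
      (p' := slice D s0 (x * z)) (m' := slice D (s0 + x * z) z) (dst := q) (src := p)
      (F := (main, set_nth bx (sl + x) q) :: F);
      rewrite ?slice_length; try rd; try lia.
    { simpl. lia. }
    { rewrite app_nil_r. cbn [app]. perm. }
    rewrite <- !slice_app, app_nil_r. cbn [app].
    replace (x * z + (z + z * n)) with (2 ^ kk * z) in * by nia.
    intros e' a' Hs Ha.
    set_ (x + 1); [calc lia|].
    eapply IH with (x := x + 1) (bx := set_nth bx (sl + x) q)
      (F := (q, slice D (s0 + x * z) z) :: F); try rd; try lia.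
    + rewrite set_nth_length; lia.
    + rewrite set_nth_length; lia.
    + perm.
    + rewrite !heap_size_cons, !slice_length in *. rewrite set_nth_length; lia.
    + intros e2 b' a2 qs H' Hs2 Hl Hq Hin Hout Ha2 HP'.
      rewrite set_nth_length in Hl by lia.
      apply (Hpost e2 b' a2 (q :: qs)); [kept|lia|simpl; lia| | | |].
      * intros [|i] Hi; cbn [nth_error].
        -- rewrite Hout, nth_error_set_nth by lia.
           now replace (sl + x + 0 =? sl + x) with true by (symmetry; apply Nat.eqb_eq; lia).
        -- rewrite <- Hin by lia. f_equal. lia.
      * intros i Hi. rewrite Hout, nth_error_set_nth by lia.
        destruct (Nat.eqb_spec i (sl + x)); [lia|reflexivity].
      * revert Ha Ha2. cbn [cost merge_test]. lia.
      * etransitivity; [exact HP'|]. cbn [blocks app].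
        replace (s0 + x * z + z) with (s0 + (x + 1) * z) by lia. perm.
Qed.

End Loops.

(** * Bounds on sizes and positions; updates of the index block *)

Section Layout.

Variables k l : nat.
Hypothesis adm : admissible k l.
Local Notation J := (top k l).
Local Notation sz := (size k l).
Local Notation shape := (shape k l).
Local Notation table := (table k l).
Local Notation levels := (levels k l).

Lemma size_le_max j : j <= J -> sz j <= 2 ^ S l.
Proof.
  intros Hj. eapply Nat.le_trans; [apply size_mono; eassumption|].
  rewrite size_top by assumption. apply Nat.pow_le_mono_r; lia.
Qed.

Lemma exponent_le j : j <= S J -> low k l + k * j <= l.
Proof. intros Hj. pose proof (low_top k l adm). destruct adm. nia. Qed.

Lemma l_lt_max : l < 2 ^ S l.
Proof. eapply Nat.lt_trans; [|apply Nat.pow_gt_lin_r]; lia. Qed.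

Lemma slot_le_max j : j <= J -> slot k l j + 2 * 2 ^ k <= index_size k l.
Proof.
  intros Hj. unfold index_size. pose proof (slot_mono k l j J Hj).
  pose proof (square_branching k). pose proof (branching_ge k l adm). nia.
Qed.

Lemma branching_le_max : 2 * 2 ^ k <= 2 ^ S l.
Proof.
  pose proof (slot_le_max 0 (Nat.le_0_l _)). pose proof (index_size_le_max k l adm). lia.
Qed.

Lemma size_S_ge j : 8 * sz j <= sz (S j).
Proof.
  rewrite size_S. apply Nat.mul_le_mono_r, (branching_ge k l adm).
Qed.

Lemma head_lt_slot j : J + 6 <= slot k l j.
Proof. unfold slot. lia. Qed.

Lemma start_top Vs N j : N = Vs 0 -> start Vs N j = Vs j.
Proof. intros ->. now destruct j. Qed.

Lemma holds_start lv Vs N b main H F j v :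
  table lv Vs N b -> Permutation H ((main, b) :: F) -> j <= S J ->
  v = start Vs N j -> holds H main (4 + j) v.
Proof.
  intros HT HP Hj ->. eapply holds_perm; [exact HP|].
  eapply holds_in; [now left|]. now apply (table_start _ _ _ _ _ _ HT).
Qed.

Lemma holds_slot lv Vs N b main H F j x i v :
  table lv Vs N b -> Permutation H ((main, b) :: F) -> j <= J ->
  nth_error (lv j) x = Some v -> i = slot k l j + x -> holds H main i v.
Proof.
  intros HT HP Hj Hx ->. eapply holds_perm; [exact HP|].
  eapply holds_in; [now left|]. rewrite (table_slot _ _ _ _ _ _ HT); auto.
  apply nth_error_Some. congruence.
Qed.

Lemma slot_lt_next cf cn lv Vs N i x :
  shape cf cn lv Vs N -> x < length (lv i) -> i < J -> slot k l i + x < slot k l (S i).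
Proof.
  intros HS Hx Hi. rewrite slot_S. pose proof (shape_le _ _ _ _ _ _ _ HS i Hi). lia.
Qed.

(** Serves merges and splits alike: level [j] ends up neither empty nor full, hence regular, and an
    exception at [j] may move on to [S j]. *)
Lemma shape_set_levels cf cn cf' cn' lv Vs N j ps qs v :
  shape cf cn lv Vs N -> core k l (set_levels lv j ps qs) (update Vs (S j) v) N ->
  cf = j \/ cf = cf' -> cn = j \/ cn = cn' -> 0 < length ps < 2 * 2 ^ k ->
  (S j < J -> length qs <= 2 * 2 ^ k) ->
  (S j < J -> S j <> cf' -> length qs < 2 * 2 ^ k) ->
  (S j <> cn' -> 0 < length qs) ->
  shape cf' cn' (set_levels lv j ps qs) (update Vs (S j) v) N.
Proof.
  intros HS HC Hcf Hcn Hps H1 H2 H3.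
  split; [exact HC|intros i Hi|intros i Hi Hi1|intros i Hi Hi1 HV];
    (destruct (Nat.eq_dec i (S j)) as [->|Hi2]; [rewrite set_levels_next; auto; lia|]);
    (destruct (Nat.eq_dec i j) as [->|Hi3]; [rewrite set_levels_at; lia|]);
    rewrite set_levels_other by assumption.
  - now apply (shape_le _ _ _ _ _ _ _ HS).
  - apply (shape_lt _ _ _ _ _ _ _ HS); lia.
  - apply (shape_ne _ _ _ _ _ _ _ HS); try lia.
    now rewrite update_other in HV by lia.
Qed.

(** The guard [S j < J] is there because the top level has more than [2 * 2 ^ k] pointers, so that
    [slot] of the level after it lies among them. *)
Lemma table_set_levels cf cn lv Vs N b b' j ps qs v :
  shape cf cn lv Vs N -> table lv Vs N b -> j < J -> length b' = length b ->
  nth_error b' (4 + S j) = Some v ->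
  (forall x, x < length ps -> nth_error b' (slot k l j + x) = nth_error ps x) ->
  (forall x, x < length qs -> nth_error b' (slot k l (S j) + x) = nth_error qs x) ->
  (forall i, i <> 4 + S j -> i < slot k l j \/ S j < J /\ slot k l (S (S j)) <= i ->
     nth_error b' i = nth_error b i) ->
  table (set_levels lv j ps qs) (update Vs (S j) v) N b'.
Proof.
  intros HS HT Hj Hl Hv Hps Hqs Hout. pose proof (head_lt_slot j).
  split; try (rewrite Hout by lia; apply HT).
  - rewrite Hl. apply HT.
  - intros i Hi. destruct (Nat.eq_dec i (S j)) as [->|Hi1].
    + simpl start. now rewrite update_at.
    + rewrite Hout, (table_start _ _ _ _ _ _ HT) by lia.
      destruct i; [reflexivity|]. simpl. now rewrite update_other.
  - intros i x Hi Hx.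
    destruct (Nat.eq_dec i (S j)) as [->|Hi1]; [rewrite set_levels_next in *; auto|].
    destruct (Nat.eq_dec i j) as [->|Hi2]; [rewrite set_levels_at in *; auto|].
    rewrite set_levels_other in * by assumption. pose proof (head_lt_slot i).
    rewrite Hout; [now apply (table_slot _ _ _ _ _ _ HT)|lia|].
    destruct (Nat.lt_ge_cases i j).
    + left. pose proof (slot_lt_next _ _ _ _ _ i x HS Hx ltac:(lia)).
      pose proof (slot_mono k l (S i) j ltac:(lia)). lia.
    + right. pose proof (slot_mono k l (S (S j)) i ltac:(lia)). lia.
Qed.

Lemma array_size main D F cf cn lv Vs N b H :
  shape cf cn lv Vs N -> table lv Vs N b ->
  Permutation H ((main, b) :: levels lv Vs D ++ F) ->
  heap_size H = index_size k l + Vs 0 + heap_size F.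
Proof.
  intros HS HT HP. rewrite (heap_size_perm _ _ HP), heap_size_cons, heap_size_app.
  rewrite (levels_size k l lv Vs D N (shape_core _ _ _ _ _ _ _ HS)).
  rewrite (table_length _ _ _ _ _ _ HT). lia.
Qed.

(** [Vs] is exposed because the potential depends on it, unlike the addresses [lv] and the index
    block [b]. [F] is a frame that stays as it is. *)
Definition array (main : nat) (D : nat -> nat) (N : nat) (Vs : nat -> nat)
    (F H : heap) : Prop :=
  exists lv b, shape 0 0 lv Vs N /\ table lv Vs N b /\
    Permutation H ((main, b) :: levels lv Vs D ++ F).

Lemma size_zero : 2 ^ low k l = sz 0.
Proof. unfold size. now rewrite Nat.mul_0_r, Nat.add_0_r. Qed.

Lemma div_last n v z m :
  v + z * m <= n -> n < v + z * m + z ->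
  (n - v) / z = m /\ (n - v) mod z = n - (v + z * m).
Proof.
  intros H1 H2. split; symmetry.
  - apply Nat.div_unique with (n - (v + z * m)); lia.
  - apply Nat.mod_unique with m; lia.
Qed.

(** The potential never reads [Vs 0], so adding or freeing a block of level 0 leaves it alone. *)
Lemma potential_ext Vs Vs' N :
  (forall j, Vs (S j) = Vs' (S j)) -> potential k l Vs N = potential k l Vs' N.
Proof.
  intros HV. unfold potential. f_equal. apply map_ext. intros j.
  unfold phi. now rewrite HV.
Qed.

Lemma upper_ext lv Vs N D D' :
  core k l lv Vs N -> (forall i, i < Vs 1 -> D i = D' i) ->
  flat_map (level k l lv Vs D) (seq 1 J) = flat_map (level k l lv Vs D') (seq 1 J).
Proof.
  intros HC HD. rewrite !flat_map_concat_map. f_equal. apply map_ext_in.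
  intros j Hj. apply in_seq in Hj. apply blocks_ext. intros i Hi. apply HD.
  rewrite <- (core_eq _ _ _ _ _ HC j) in Hi by lia.
  pose proof (core_mono _ _ _ _ _ 1 j HC ltac:(lia) ltac:(lia)). lia.
Qed.

Lemma upper_ext_shape lv lv' Vs Vs' D :
  (forall j, Vs (S j) = Vs' (S j)) -> (forall j, lv (S j) = lv' (S j)) ->
  flat_map (level k l lv Vs D) (seq 1 J) = flat_map (level k l lv' Vs' D) (seq 1 J).
Proof.
  intros HV HL. rewrite !flat_map_concat_map. f_equal. apply map_ext_in.
  intros [|j] Hj; apply in_seq in Hj; [lia|]. unfold level. now rewrite HV, HL.
Qed.

Lemma set_nth_slice D s n i v :
  i < n -> set_nth (slice D s n) i v = slice (update D (s + i) v) s n.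
Proof.
  intros Hi. replace n with (i + (1 + (n - i - 1))) by lia.
  rewrite !slice_app.
  pose proof (set_nth_app (slice D s i) (D (s + i)) (slice D (s + i + 1) (n - i - 1)) v)
    as E.
  rewrite slice_length in E.
  change (slice D (s + i) 1) with [D (s + i)].
  change (slice (update D (s + i) v) (s + i) 1) with [update D (s + i) v (s + i)].
  cbn [app]. rewrite E, update_at.
  f_equal; [|f_equal]; apply slice_ext; intros x Hx; now rewrite update_other by lia.
Qed.

End Layout.

(** * A single merge or split *)

Section Steps.

Variables (A : machine) (X : nat).
Hypothesis valid_A : valid_machine A.
Hypothesis X_lt : X + 1 < word_bound A.
Local Notation W := (word_bound A).
Local Notation wp := (wp A X).
Local Notation wp_iter := (wp_iter A X).

Variables k l : nat.
Hypothesis adm : admissible k l.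
Hypothesis W_ge : 128 + 8 * 2 ^ S l <= word_bound A.
Local Notation J := (top k l).
Local Notation sz := (size k l).
Local Notation shape := (shape k l).
Local Notation table := (table k l).
Local Notation levels := (levels k l).
Local Notation potential := (potential k l).

Lemma select_level_ok j (P : post) e H a :
  j <= J -> e 3 = j -> e 11 = k -> e 13 = low k l -> e 14 = J ->
  (forall e' a', same [4; 10; 17; 18] e' e -> e' 17 = low k l + k * j ->
     e' 10 = sz j -> e' 18 = slot k l j -> e' 4 = 0 -> a' <= a + 100 ->
     P e' H a') ->
  wp select_level P e H a.
Proof.
  intros Hj E3 E11 E13 E14 Hpost. unfold select_level.
  pose proof (exponent_le k l adm j ltac:(lia)). pose proof (l_lt_max l).
  pose proof (size_le_max k l adm j Hj) as Hs. pose proof (slot_le_max k l adm j Hj) as Hsl.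
  pose proof (index_size_le_max k l adm). unfold size in Hs. unfold slot in Hsl.
  assert (k <= l) by (destruct adm; lia).
  assert (J <= l) by (apply top_le; assumption).
  then_. set_ (low k l + k * j); [calc lia|].
  then_. set_ (sz j). { eapply evals_eq; [calc lia|]. unfold size. lia. }
  then_. set_ (slot k l j). { eapply evals_eq; [calc lia|]. reflexivity. }
  set_ 0; [calc lia|].
  apply Hpost; try rd; [kept|]. cbn [cost]. lia.
Qed.

Lemma next_start_ok e H main j Vs :
  j < J -> e 0 = main -> e 3 = j ->
  (forall i, i <= S J -> holds H main (4 + i) (Vs i)) ->
  evals A (start_of (V 3 + K 1)) e H (Vs (S j)).
Proof.
  intros Hj E0 E3 Hh. pose proof (l_lt_max l). pose proof (top_le k l adm).
  eapply evals_eq; [calc ltac:(first [lia | apply Hh; lia])|]. f_equal. lia.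
Qed.

Lemma next_size_ok e H j :
  j < J -> e 11 = k -> e 17 = low k l + k * j ->
  evals A (K 1 << (V 17 + V 11)) e H (sz (S j)).
Proof.
  intros Hj E11 E17. pose proof (exponent_le k l adm (S j) ltac:(lia)). pose proof (l_lt_max l).
  assert (Hpow : 2 ^ (low k l + k * j + k) = sz (S j)).
  { unfold size. f_equal. lia. }
  pose proof (size_le_max k l adm (S j) Hj).
  eapply evals_eq; [calc lia|]. lia.
Qed.

Lemma next_slot_ok e H main j Vs n :
  j < J -> e 0 = main -> e 3 = j -> e 11 = k -> e 17 = low k l + k * j ->
  e 18 = slot k l j ->
  (forall i, i <= S J -> holds H main (4 + i) (Vs i)) ->
  Vs (S j) = Vs (S (S j)) + sz (S j) * n -> slot k l (S j) + n < W ->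
  evals A next_slot e H (slot k l (S j) + n).
Proof.
  intros Hj E0 E3 E11 E17 E18 Hh HV HW.
  assert (Hdiv : (Vs (j + 1) - Vs (j + 2)) / 2 ^ (low k l + k * j + k) = n).
  { replace (2 ^ (low k l + k * j + k)) with (sz (S j)) by (unfold size; f_equal; lia).
    rewrite Nat.add_1_r, (Nat.add_comm j 2). cbn [Nat.add].
    rewrite HV, (Nat.add_comm (Vs _)), Nat.add_sub, Nat.mul_comm.
    apply Nat.div_mul. pose proof (size_pos k l (S j)). lia. }
  assert (HV' : Vs (j + 2) <= Vs (j + 1)).
  { rewrite Nat.add_1_r, (Nat.add_comm j 2). cbn [Nat.add]. lia. }
  pose proof (l_lt_max l). pose proof (top_le k l adm). pose proof (branching_le_max k l adm).
  pose proof (slot_S k l j) as Hsl. pose proof (exponent_le k l adm (S j) ltac:(lia)).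
  eapply evals_eq; [calc ltac:(first [lia | apply Hh; lia])|].
  rewrite Hdiv. lia.
Qed.

Section Carry.

Variables (main N : nat) (D : nat -> nat) (F : heap).
Hypothesis X_ge : index_size k l + N + sz J + heap_size F <= X.

(** The merged block is allocated before its parts are freed, hence one block of top size in the
    budget. The drop of the potential pays for the whole body, and the surplus of 100 for the test
    that follows. *)
Lemma carry_step j lv Vs b (P : post) e H a :
  shape j 0 lv Vs N -> table lv Vs N b ->
  Permutation H ((main, b) :: levels lv Vs D ++ F) ->
  N = Vs 0 -> j < J -> length (lv j) = 2 * 2 ^ k -> N - Vs j <= 2 * sz j ->
  (1 <= j -> length (lv 0) < 2 * 2 ^ k) ->
  e 0 = main -> e 3 = j -> e 11 = k -> e 13 = low k l -> e 14 = J ->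
  (forall e' lv' Vs' b' H' a',
     same [3; 4; 5; 6; 7; 8; 9; 10; 17; 18] e' e -> e' 3 = S j ->
     shape (S j) 0 lv' Vs' N -> table lv' Vs' N b' ->
     Permutation H' ((main, b') :: levels lv' Vs' D ++ F) ->
     N = Vs' 0 -> N - Vs' (S j) <= 2 * sz (S j) -> length (lv' 0) < 2 * 2 ^ k ->
     a' + 100 + 600 * potential Vs' N <= a + 600 * potential Vs N ->
     P e' H' a') ->
  wp carry_body P e H a.
Proof.
  intros HS HT HP HN Hj Hlen HR H0 E0 E3 E11 E13 E14 Hpost.
  pose proof (array_size k l main D F _ _ _ _ _ _ _ HS HT HP) as HHs.
  assert (HC := shape_core _ _ _ _ _ _ _ HS).
  unfold carry_body. then_. eapply select_level_ok; [|eassumption..|]; [lia|].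
  intros e1 a1 Hs1 E17 E10 E18 E4 Ha1.
  pose proof (size_S k l j) as HZ.
  pose proof (size_le_max k l adm (S j) Hj) as HZmax.
  pose proof (slot_le_max k l adm j ltac:(lia)) as Hsl.
  pose proof (slot_le_max k l adm (S j) ltac:(lia)) as Hsl'.
  pose proof (slot_S k l j) as HslS.
  pose proof (head_lt_slot k l j) as Hhd.
  pose proof (index_size_le_max k l adm) as Himax.
  pose proof (size_pos k l j) as Hz0.
  pose proof (size_S_ge k l adm j) as Hz8.
  pose proof (exponent_le k l adm (S j) ltac:(lia)) as Hexp.
  pose proof (l_lt_max l) as Hl. pose proof (branching_le_max k l adm) as Hbm.
  pose proof (table_length _ _ _ _ _ _ HT) as Hlb.
  pose proof (core_eq _ _ _ _ _ HC j ltac:(lia)) as HVj.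
  pose proof (core_eq _ _ _ _ _ HC (S j) ltac:(lia)) as HVSj.
  assert (Hpow : 2 ^ (low k l + k * j + k) = sz (S j)).
  { unfold size. f_equal. lia. }
  assert (HVN : Vs j <= N).
  { rewrite HN. eapply core_mono; [eassumption|lia|lia]. }
  assert (HVb : Vs (S j) <= 2 ^ S l).
  { pose proof (core_max _ _ _ _ _ HC). lia. }
  rewrite Hlen in HVj.
  assert (HVj' : Vs j = Vs (S j) + 2 * sz (S j)) by (rewrite HVj, HZ; ring). clear HVj.
  (* A free pointer position exists: the top level has enough for [2 ^ S l] items, and a lower level
     [S j] is not the exceptional one, hence not full. *)
  assert (Hn : slot k l (S j) + length (lv (S j)) < index_size k l).
  { destruct (Nat.eq_dec (S j) J) as [E|E].
    - unfold index_size. rewrite <- E.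
      pose proof (size_top_max k l adm) as Hmax. rewrite <- E in Hmax.
      pose proof (core_max _ _ _ _ _ HC) as HM.
      assert (length (lv (S j)) < 2 * 2 ^ (2 * k)); [|lia].
      apply (Nat.mul_lt_mono_pos_r (sz (S j))); [lia|].
      rewrite Hmax, (Nat.mul_comm (length _)). lia.
    - pose proof (shape_lt _ _ _ _ _ _ _ HS (S j) ltac:(lia) ltac:(lia)). lia. }
  set (ps1 := firstn (2 ^ k) (lv j)). set (ps2 := skipn (2 ^ k) (lv j)).
  assert (Hps : lv j = ps1 ++ ps2) by (symmetry; apply firstn_skipn).
  assert (Hps1 : length ps1 = 2 ^ k) by (apply firstn_length_le; lia).
  assert (Hps2 : length ps2 = 2 ^ k) by (unfold ps2; rewrite length_skipn; lia).
  clearbody ps1 ps2.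
  then_. set_ 0; [calc lia|].
  then_. eapply wp_new with (n := sz (S j)); [assumption|assumption| | | |].
  { eapply evals_eq; [calc lia|]. lia. }
  { lia. }
  { pose proof (size_mono k l (S j) J Hj). lia. }
  intros q c Hc.
  then_. apply wp_loop; [assumption|].
  set (R := blocks D (Vs (S j) + sz j * 2 ^ k) (sz j) ps2 ++ level k l lv Vs D (S j) ++
            others k l lv Vs D j ++ F).
  eapply merge_iter with (q := q) (main := main) (D := D) (z := sz j)
    (ex := low k l + k * j) (kk := k) (sl := slot k l j) (rest := ps1) (x := 0)
    (s := Vs (S j)) (u := []) (w := c) (bx := b) (F := R);
    try assumption; try rd.
  { lia. }
  { reflexivity. }
  { reflexivity. }
  { rewrite Hps1, Hc, HZ. ring. }
  { rewrite <- HZ. lia. }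
  { lia. }
  { lia. }
  { etransitivity; [apply perm_skip; exact HP|].
    etransitivity.
    { do 2 apply perm_skip. apply Permutation_app_tail. apply levels_split. exact Hj. }
    unfold R, level at 1. rewrite Hps, blocks_app, Hps1. cbn [app]. perm. }
  { intros i Hi. rewrite Nat.add_0_r.
    rewrite (table_slot _ _ _ _ _ _ HT) by lia. rewrite Hps.
    apply nth_error_app1. assumption. }
  intros e2 b1 a2 Hs2 Hl1 Hin Hout Ha2. cbn [app].
  rewrite Nat.add_0_r in *.
  replace (sz j * length ps1) with (sz (S j)) by (rewrite Hps1, HZ; ring).
  assert (Hst : forall i, i <= S J -> nth_error b1 (4 + i) = Some (Vs i)).
  { intros i Hi. rewrite Hout by lia.
    rewrite (table_start _ _ _ _ _ _ HT) by assumption. f_equal.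
    now apply start_top. }
  then_. eapply wp_put with (p := main) (v := q) (i := slot k l (S j) + length (lv (S j))).
  { assumption. }
  { calc lia. }
  { apply next_slot_ok with (main := main) (Vs := Vs); try rd; try lia.
    intros i Hi. eapply holds_in; [right; left; reflexivity|]. now apply Hst. }
  { calc lia. }
  { apply perm_swap. }
  { lia. }
  then_. eapply wp_put with (p := main) (v := Vs (S j) + sz (S j)) (i := 4 + (j + 1)).
  { assumption. }
  { calc lia. }
  { calc lia. }
  { eapply evals_B; [| |split; [|reflexivity]].
    - apply next_start_ok with (main := main); try rd; [lia|].
      intros i Hi. eapply holds_in; [left; reflexivity|].
      rewrite nth_error_set_nth by lia.
      destruct (Nat.eqb_spec (4 + i) (slot k l (S j) + length (lv (S j)))); [lia|].
      now apply Hst.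
    - apply next_size_ok; try rd. lia.
    - lia. }
  { reflexivity. }
  { rewrite set_nth_length; lia. }
  set_ (S j). { eapply evals_eq; [calc lia|]. lia. }
  set (lv' := set_levels lv j ps2 (lv (S j) ++ [q])).
  set (Vs' := update Vs (S j) (Vs (S j) + sz (S j))).
  assert (HC' : core k l lv' Vs' N).
  { apply core_set_levels; auto; [lia| |].
    - rewrite length_app. simpl. lia.
    - lia. }
  set (b3 := set_nth (set_nth b1 (slot k l (S j) + length (lv (S j))) q)
                   (4 + (j + 1)) (Vs (S j) + sz (S j))).
  eapply Hpost with (lv' := lv') (Vs' := Vs') (b' := b3).
  - kept.
  - rd.
  - apply shape_set_levels with (1 := HS); auto; rewrite ?length_app; simpl length;
      try lia.
    intros HjJ. pose proof (shape_lt _ _ _ _ _ _ _ HS (S j) ltac:(lia) ltac:(lia)). lia.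
  - assert (Hb3 : forall i,
      nth_error b3 i =
      if i =? 4 + (j + 1) then Some (Vs (S j) + sz (S j))
      else if i =? slot k l (S j) + length (lv (S j)) then Some q
      else nth_error b1 i).
    { intros i. unfold b3. rewrite nth_error_set_nth by (rewrite set_nth_length; lia).
      now rewrite nth_error_set_nth by lia. }
    assert (Hb3' : forall i, i <> 4 + (j + 1) -> i <> slot k l (S j) + length (lv (S j)) ->
      nth_error b3 i = nth_error b1 i).
    { intros i Hi1 Hi2. rewrite Hb3. apply Nat.eqb_neq in Hi1, Hi2. now rewrite Hi1, Hi2. }
    apply table_set_levels with (1 := HS) (2 := HT); [exact Hj| | | | |].
    + unfold b3. rewrite !set_nth_length; rewrite ?set_nth_length; lia.
    + now rewrite Hb3, Nat.add_1_r, Nat.eqb_refl.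
    + intros x Hx. rewrite Hb3', Hin, <- Nat.add_assoc by lia.
      rewrite (table_slot _ _ _ _ _ _ HT) by lia.
      rewrite Hps, nth_error_app2 by lia. f_equal. lia.
    + intros x Hx. rewrite length_app in Hx. simpl in Hx.
      destruct (Nat.eq_dec x (length (lv (S j)))) as [->|Hne].
      * rewrite nth_error_app2, Nat.sub_diag, Hb3, Nat.eqb_refl by lia.
        destruct (Nat.eqb_spec (slot k l (S j) + length (lv (S j))) (4 + (j + 1))); [lia|].
        reflexivity.
      * rewrite Hb3', Hout, nth_error_app1 by lia. apply (table_slot _ _ _ _ _ _ HT); lia.
    + intros i Hi1 Hi2. pose proof (slot_S k l (S j)).
      assert (i <> slot k l (S j) + length (lv (S j))).
      { destruct Hi2 as [|[HjJ ?]]; [lia|].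
        pose proof (shape_lt _ _ _ _ _ _ _ HS (S j) ltac:(lia) ltac:(lia)). lia. }
      rewrite Hb3' by lia. apply Hout. lia.
  - apply perm_skip. unfold R.
    etransitivity; [|apply Permutation_app_tail; symmetry; apply levels_split; exact Hj].
    unfold lv', Vs'. rewrite others_set_levels. unfold level.
    rewrite set_levels_at, set_levels_next, update_at, update_other by lia.
    rewrite blocks_app. cbn [blocks app].
    replace (Vs (S (S j)) + sz (S j) * length (lv (S j))) with (Vs (S j)) by lia.
    replace (sz j * 2 ^ k) with (sz (S j)) by (rewrite HZ; ring).
    perm.
  - unfold Vs'. rewrite update_other by lia. assumption.
  - unfold Vs'. rewrite update_at. lia.
  - unfold lv'. destruct j as [|j'].
    + rewrite set_levels_at. pose proof (branching_ge k l adm). lia.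
    + rewrite set_levels_other by lia. apply H0. lia.
  (* With [Z = sz (S j)], the number of items up to level [j] falls from at least [2 Z], where the
     summand is at least [Z], to a value between [Z] and [5/4 Z], where it vanishes; the latter uses
     [8 * sz j <= Z]. *)
  - assert (Hpot : potential Vs' N + sz (S j) <= potential Vs N).
    { unfold Vs'. apply potential_update; [exact Hj|].
      unfold phi. rewrite update_at.
      destruct (Nat.eqb_spec (Vs (S j) + sz (S j)) 0); [lia|].
      destruct (Vs (S j) =? 0); lia. }
    assert (Hz1 : 1 <= sz (S j)) by lia.
    revert Ha2. cbn [cost next_slot start_of]. rewrite Hps1.
    assert (2 ^ k <= sz (S j)) by (rewrite HZ; apply Nat.le_mul_r; lia).
    replace ((40 * sz j + 100) * 2 ^ k) with (40 * sz (S j) + 100 * 2 ^ k)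
      by (rewrite HZ; ring).
    lia.
Qed.

End Carry.

Section Borrow.

Variables (main N : nat) (D : nat -> nat) (F : heap).
Hypothesis X_ge : index_size k l + N + sz J + heap_size F <= X.

Lemma borrow_step j lv Vs b (P : post) e H a :
  shape 0 j lv Vs N -> table lv Vs N b ->
  Permutation H ((main, b) :: levels lv Vs D ++ F) ->
  N = Vs 0 -> j < J -> lv j = [] -> 0 < Vs (S j) -> N - Vs j <= 2 * sz j ->
  (1 <= j -> Vs 1 < N) ->
  e 0 = main -> e 3 = j -> e 11 = k -> e 13 = low k l -> e 14 = J ->
  (forall e' lv' Vs' b' H' a',
     same [3; 4; 5; 6; 7; 8; 9; 10; 17; 18] e' e -> e' 3 = S j ->
     shape 0 (S j) lv' Vs' N -> table lv' Vs' N b' ->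
     Permutation H' ((main, b') :: levels lv' Vs' D ++ F) ->
     N = Vs' 0 -> N - Vs' (S j) <= 2 * sz (S j) -> Vs' 1 < N ->
     a' + 100 + 600 * potential Vs' N <= a + 600 * potential Vs N ->
     P e' H' a') ->
  wp borrow_body P e H a.
Proof.
  intros HS HT HP HN Hj Hlen HV0 HR H0 E0 E3 E11 E13 E14 Hpost.
  pose proof (array_size k l main D F _ _ _ _ _ _ _ HS HT HP) as HHs.
  assert (HC := shape_core _ _ _ _ _ _ _ HS).
  assert (Hst0 : forall i, i <= S J -> nth_error b (4 + i) = Some (Vs i)).
  { intros i Hi. rewrite (table_start _ _ _ _ _ _ HT) by assumption. f_equal.
    now apply start_top. }
  unfold borrow_body. then_. eapply select_level_ok with (j := j); try eassumption; [lia|].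
  intros e1 a1 Hs1 E17 E10 E18 E4 Ha1.
  pose proof (size_S k l j) as HZ.
  pose proof (size_le_max k l adm (S j) Hj) as HZmax.
  pose proof (slot_le_max k l adm j ltac:(lia)) as Hsl.
  pose proof (slot_le_max k l adm (S j) ltac:(lia)) as Hsl'.
  pose proof (slot_S k l j) as HslS.
  pose proof (head_lt_slot k l j) as Hhd.
  pose proof (index_size_le_max k l adm) as Himax.
  pose proof (size_pos k l j) as Hz0.
  pose proof (size_S_ge k l adm j) as Hz8.
  pose proof (exponent_le k l adm (S j) ltac:(lia)) as Hexp.
  pose proof (l_lt_max l) as Hl. pose proof (branching_le_max k l adm) as Hbm.
  pose proof (branching_ge k l adm) as Hb8.
  pose proof (table_length _ _ _ _ _ _ HT) as Hlb.
  pose proof (core_eq _ _ _ _ _ HC j ltac:(lia)) as HVj.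
  pose proof (core_eq _ _ _ _ _ HC (S j) ltac:(lia)) as HVSj.
  rewrite Hlen in HVj. cbn [length] in HVj. rewrite Nat.mul_0_r, Nat.add_0_r in HVj.
  assert (HVN : Vs j <= N).
  { rewrite HN. eapply core_mono; [eassumption|lia|lia]. }
  assert (HVb : Vs (S j) <= 2 ^ S l).
  { pose proof (core_max _ _ _ _ _ HC). lia. }
  (* If level [S j] were empty, [Vs (S (S j))] would equal [Vs (S j) > 0], and an empty level below
     a nonempty one is allowed only at [j]. *)
  assert (Hne : 0 < length (lv (S j))).
  { destruct (Nat.eq_dec (length (lv (S j))) 0) as [E|]; [|lia].
    apply (shape_ne _ _ _ _ _ _ _ HS); [lia|lia|]. rewrite E in HVSj. lia. }
  destruct (exists_last (l := lv (S j))) as [ps [p Hps]].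
  { intros E. rewrite E in Hne. simpl in Hne. lia. }
  assert (Hlps : length (lv (S j)) = length ps + 1).
  { now rewrite Hps, length_app. }
  rewrite Hlps, Nat.mul_add_distr_l, Nat.mul_1_r in HVSj.
  assert (Hn : slot k l (S j) + length (lv (S j)) <= index_size k l).
  { destruct (Nat.eq_dec (S j) J) as [E|E].
    - unfold index_size. rewrite <- E.
      pose proof (length_top k l adm _ _ _ HC) as Hlt. rewrite <- E in Hlt. lia.
    - pose proof (shape_lt _ _ _ _ _ _ _ HS (S j) ltac:(lia) ltac:(lia)). lia. }
  then_. set_ 0; [calc lia|].
  then_. set_ p.
  { eapply evals_G; [calc lia| |].
    - eapply evals_B; [|calc lia|split; [|reflexivity]].
      + eapply next_slot_ok with (main := main) (Vs := Vs)
          (n := length (lv (S j))); try eassumption; try rd; try lia.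
        intros i Hi. eapply holds_perm; [exact HP|].
        eapply holds_in; [now left|]. now apply Hst0.
      + lia.
    - eapply holds_slot with (j := S j) (x := length ps); try eassumption; try lia.
      rewrite Hps, nth_error_app2, Nat.sub_diag by lia. reflexivity. }
  set (s0 := Vs (S (S j)) + sz (S j) * length ps) in *.
  set (R := blocks D (Vs (S (S j))) (sz (S j)) ps ++ others k l lv Vs D j ++ F).
  then_. apply wp_loop; [assumption|].
  eapply split_iter with (p := p) (main := main) (D := D) (z := sz j)
    (ex := low k l + k * j) (kk := k) (sl := slot k l j) (s0 := s0) (n := 2 ^ k) (x := 0)
    (bx := b) (F := R);
    try assumption; try rd.
  { lia. }
  { reflexivity. }
  { reflexivity. }
  { rewrite <- HZ. lia. }
  { lia. }
  { lia. }
  { etransitivity; [exact HP|].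
    etransitivity.
    { apply perm_skip. apply Permutation_app_tail. apply levels_split. exact Hj. }
    unfold R, level. rewrite Hlen, Hps, blocks_app, <- HZ. cbn [blocks app].
    fold s0. perm. }
  { rewrite Nat.mul_comm, <- HZ. pose proof (size_mono k l (S j) J Hj). lia. }
  intros e2 b1 a2 qs H2 Hs2 Hl1 Hqs Hin Hout Ha2 HP2.
  rewrite Nat.add_0_r in *. rewrite <- HZ in HP2.
  apply Permutation_sym in HP2.
  assert (Hst : forall i, i <= S J -> nth_error b1 (4 + i) = Some (Vs i)).
  { intros i Hi. rewrite Hout by lia. now apply Hst0. }
  then_. eapply wp_free with (p := p);
    [assumption|calc lia|symmetry; exact HP2|].
  then_. eapply wp_put with (p := main) (v := s0) (i := 4 + (j + 1)).
  { assumption. }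
  { calc lia. }
  { calc lia. }
  { eapply evals_eq.
    - eapply evals_B; [| |split; [|reflexivity]].
      + eapply next_start_ok with (j := j) (main := main) (Vs := Vs); try eassumption; try rd.
        intros i Hi. eapply holds_in; [left; reflexivity|]. now apply Hst.
      + eapply next_size_ok with (j := j); try eassumption; rd.
      + lia.
    - lia. }
  { reflexivity. }
  { lia. }
  set_ (S j). { eapply evals_eq; [calc lia|]. lia. }
  set (lv' := set_levels lv j qs ps).
  set (Vs' := update Vs (S j) s0).
  assert (HC' : core k l lv' Vs' N).
  { apply core_set_levels; auto; [unfold s0; lia|].
    rewrite Hqs, HVj, HVSj, (Nat.mul_comm (sz j)), <- HZ. unfold s0. lia. }
  set (b3 := set_nth b1 (4 + (j + 1)) s0).
  eapply Hpost with (lv' := lv') (Vs' := Vs') (b' := b3).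
  - kept.
  - rd.
  - apply shape_set_levels with (1 := HS); auto; try lia;
      intros HjJ; pose proof (shape_lt _ _ _ _ _ _ _ HS (S j)); lia.
  - assert (Hb3 : forall i, i <> 4 + (j + 1) -> nth_error b3 i = nth_error b1 i).
    { intros i Hi. unfold b3. rewrite nth_error_set_nth by lia.
      apply Nat.eqb_neq in Hi. now rewrite Hi. }
    apply table_set_levels with (1 := HS) (2 := HT); [exact Hj| | | | |].
    + unfold b3. rewrite set_nth_length; lia.
    + unfold b3. now rewrite nth_error_set_nth, Nat.add_1_r, Nat.eqb_refl by lia.
    + intros x Hx. rewrite Hb3 by lia. apply Hin. lia.
    + intros x Hx. rewrite Hb3, Hout, (table_slot _ _ _ _ _ _ HT), Hps by lia.
      now apply nth_error_app1.
    + intros i Hi1 Hi2. pose proof (slot_S k l (S j)).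
      rewrite Hb3 by lia. apply Hout. lia.
  - apply perm_skip. unfold R.
    etransitivity; [|apply Permutation_app_tail; symmetry; apply levels_split; exact Hj].
    unfold lv', Vs'. rewrite others_set_levels. unfold level.
    rewrite set_levels_at, set_levels_next, update_at, update_other by lia.
    perm.
  - unfold Vs'. rewrite update_other by lia. assumption.
  - unfold Vs'. rewrite update_at. lia.
  - unfold Vs'. destruct j as [|j'].
    + rewrite update_at. lia.
    + rewrite update_other by lia. apply H0. lia.
  (* Before the split at most [2 * sz j], a quarter of [sz (S j)], items are left up to level [j],
     so the second term of [phi] is at least [3/2 * sz (S j)]; afterwards both terms vanish. *)
  - assert (Hpot : potential Vs' N + sz (S j) <= potential Vs N).
    { unfold Vs'. apply potential_update; [exact Hj|].
      unfold phi. rewrite update_at.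
      destruct (Nat.eqb_spec (Vs (S j)) 0); [lia|].
      destruct (s0 =? 0); lia. }
    revert Ha2. cbn [cost next_slot start_of].
    assert (2 ^ k <= sz (S j)) by (rewrite HZ; apply Nat.le_mul_r; lia).
    replace ((40 * sz j + 100) * 2 ^ k) with (40 * sz (S j) + 100 * 2 ^ k)
      by (rewrite HZ; ring).
    lia.
Qed.

End Borrow.

(** * Cascades of merges and splits *)

Section Loops.

Variables (main : nat) (D : nat -> nat) (F : heap).

(** Invariant: only level [j] may be full, and the levels below it hold at most [2 * sz j] items.
    The second part is what makes the next merge release potential. *)
Lemma carry_loop N j lv Vs b (P : post) e H a :
  index_size k l + N + sz J + heap_size F <= X ->
  shape j 0 lv Vs N -> table lv Vs N b ->
  Permutation H ((main, b) :: levels lv Vs D ++ F) ->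
  N = Vs 0 -> j <= J -> N - Vs j <= 2 * sz j ->
  (1 <= j -> length (lv 0) < 2 * 2 ^ k) ->
  e 0 = main -> e 3 = j -> e 11 = k -> e 13 = low k l -> e 14 = J ->
  (forall e' lv' Vs' b' H' a',
     same [3; 4; 5; 6; 7; 8; 9; 10; 17; 18] e' e ->
     shape 0 0 lv' Vs' N -> table lv' Vs' N b' ->
     Permutation H' ((main, b') :: levels lv' Vs' D ++ F) ->
     N = Vs' 0 -> length (lv' 0) < 2 * 2 ^ k ->
     a' + 600 * potential Vs' N <= a + 600 * potential Vs N + 100 ->
     P e' H' a') ->
  wp_iter carry_test carry_body P e H a.
Proof.
  intros HX. remember (J - j) as d eqn:Hd. revert j lv Vs b e H a Hd.
  induction d as [d IH] using lt_wf_ind.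
  intros j lv Vs b e H a Hd HS HT HP HN Hj HR H0 E0 E3 E11 E13 E14 Hpost.
  assert (HC := shape_core _ _ _ _ _ _ _ HS).
  pose proof (exponent_le k l adm (S j) ltac:(lia)) as Hexp.
  pose proof (l_lt_max l) as Hl. pose proof (top_le k l adm) as HJl.
  pose proof (top_pos k l adm) as HJ1.
  assert (Hk : k <= l) by (destruct adm; lia).
  assert (Hpow : 2 ^ (low k l + k * (j + 1)) = sz (S j)).
  { unfold size. do 2 f_equal. lia. }
  assert (Hexp' : k * (j + 1) <= l) by (replace (j + 1) with (S j) by lia; lia).
  assert (Hbig : 2 * sz (S j) <= 2 ^ S l).
  { rewrite Nat.pow_succ_r'. apply Nat.mul_le_mono_l. unfold size.
    apply Nat.pow_le_mono_r; lia. }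
  assert (Hmono : Vs (j + 1) <= Vs j).
  { eapply core_mono; [eassumption|lia|lia]. }
  assert (Htest : evals A carry_test e H
    ((if j <? J then 1 else 0) *
     (if Vs j - Vs (S j) =? 2 * sz (S j) then 1 else 0))).
  { eapply evals_eq.
    - calc ltac:(first [lia
        | eapply holds_start with (j := j); [eassumption..|lia|]; symmetry;
          apply start_top; assumption
        | eapply holds_start with (j := j + 1); [eassumption..|lia|]; symmetry;
          apply start_top; assumption
        | idtac]).
      destruct (j <? J), (_ =? _); lia.
    - rewrite Hpow. now replace (j + 1) with (S j) by lia. }
  destruct (Nat.ltb_spec j J) as [Hlt|Hge];
    [destruct (Nat.eqb_spec (Vs j - Vs (S j)) (2 * sz (S j))) as [Heq|Hne]|].
  - pose proof (core_eq _ _ _ _ _ HC j Hj) as HVj.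
    assert (Hlen : length (lv j) = 2 * 2 ^ k).
    { apply (Nat.mul_cancel_l _ _ (sz j)); [pose proof (size_pos k l j); lia|].
      pose proof (size_S k l j). nia. }
    eapply wp_iter_true; [assumption|exact Htest|discriminate|].
    eapply carry_step with (main := main) (N := N) (D := D) (F := F);
      try eassumption.
    intros e' lv' Vs' b' H' a' Hs E3' HS' HT' HP' HN' HR' H0' Ha'.
    eapply (IH (J - S j)); try eassumption; try rd; try lia.
    intros e2 lv2 Vs2 b2 H2 a2 Hs2 HS2 HT2 HP2 HN2 HL2 Ha2.
    eapply Hpost; try eassumption; [kept|].
    revert Ha' Ha2. cbn [cost carry_test start_of]. lia.
  - apply wp_iter_false; [assumption|exact Htest|].
    pose proof (core_eq _ _ _ _ _ HC j Hj) as HVj.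
    assert (Hlen : length (lv j) < 2 * 2 ^ k).
    { pose proof (shape_le _ _ _ _ _ _ _ HS j Hlt) as Hle.
      destruct (Nat.eq_dec (length (lv j)) (2 * 2 ^ k)) as [E|]; [|lia].
      exfalso. apply Hne. rewrite HVj, E, size_S. lia. }
    eapply Hpost; try eassumption.
    + intros x Hx. reflexivity.
    + destruct HS as [S1 S2 S3 S4]. split; auto.
      intros i Hi _. destruct (Nat.eq_dec i j) as [->|]; auto.
    + destruct j; [assumption|apply H0; lia].
    + cbn [cost carry_test start_of]. lia.
  - apply wp_iter_false; [assumption|exact Htest|].
    eapply Hpost; try eassumption.
    + intros x Hx. reflexivity.
    + destruct HS as [S1 S2 S3 S4]. split; auto.
      intros i Hi _. apply S3; lia.
    + apply H0. lia.
    + cbn [cost carry_test start_of]. lia.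
Qed.

(** [N = Vs 0] is asked for only after the first split: initially the last block may be partial, and
    the test at level 0 finds out. *)
Lemma borrow_loop N j lv Vs b (P : post) e H a :
  index_size k l + N + sz J + heap_size F <= X ->
  shape 0 j lv Vs N -> table lv Vs N b ->
  Permutation H ((main, b) :: levels lv Vs D ++ F) ->
  (1 <= j -> N = Vs 0) -> j <= J -> start Vs N 0 - start Vs N j <= 2 * sz j ->
  (1 <= j -> Vs 1 < N) -> 0 < N ->
  e 0 = main -> e 3 = j -> e 11 = k -> e 13 = low k l -> e 14 = J ->
  (forall e' lv' Vs' b' H' a',
     same [3; 4; 5; 6; 7; 8; 9; 10; 17; 18] e' e ->
     shape 0 0 lv' Vs' N -> table lv' Vs' N b' ->
     Permutation H' ((main, b') :: levels lv' Vs' D ++ F) ->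
     Vs' 1 < N ->
     a' + 600 * potential Vs' N <= a + 600 * potential Vs N + 100 ->
     P e' H' a') ->
  wp_iter borrow_test borrow_body P e H a.
Proof.
  intros HX. remember (J - j) as d eqn:Hd. revert j lv Vs b e H a Hd.
  induction d as [d IH] using lt_wf_ind.
  intros j lv Vs b e H a Hd HS HT HP HN Hj HR H0 HN0 E0 E3 E11 E13 E14 Hpost.
  assert (HC := shape_core _ _ _ _ _ _ _ HS).
  pose proof (l_lt_max l) as Hl. pose proof (top_le k l adm) as HJl.
  pose proof (top_pos k l adm) as HJ1.
  assert (Htest : evals A borrow_test e H
    ((if start Vs N j =? Vs (S j) then 1 else 0) *
     (if 0 <? Vs (S j) then 1 else 0))).
  { eapply evals_eq.
    - calc ltac:(first [lia
        | eapply holds_start with (j := j); [eassumption..|lia|reflexivity]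
        | eapply holds_start with (j := j + 1); [eassumption..|lia|reflexivity]
        | idtac]).
      destruct (_ =? _), (_ <? _); lia.
    - replace (j + 1) with (S j) by lia. reflexivity. }
  destruct (Nat.eqb_spec (start Vs N j) (Vs (S j))) as [Heq|Hne];
    [destruct (Nat.ltb_spec 0 (Vs (S j))) as [Hlt|Hge]|].
  - pose proof (core_eq _ _ _ _ _ HC j Hj) as HVj.
    assert (HjJ : j < J).
    { destruct (Nat.eq_dec j J) as [->|]; [|lia].
      rewrite (core_top _ _ _ _ _ HC) in Hlt. lia. }
    pose proof (size_pos k l j) as Hz.
    (* At level 0 the test compares [N] with [Vs 1]; as [core_gap] forbids an empty block, equality
       leaves no block in level 0. *)
    assert (Hlen : length (lv j) = 0 /\ N = Vs 0).
    { destruct j as [|j].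
      - simpl in Heq. pose proof (core_gap _ _ _ _ _ HC).
        assert (length (lv 0) = 0) by (apply Nat.eq_square_0; nia).
        split; [assumption|]. lia.
      - simpl in Heq. split; [|apply HN; lia]. apply Nat.eq_square_0; nia. }
    destruct Hlen as [Hlen HN'].
    apply length_zero_iff_nil in Hlen.
    assert (HR' : N - Vs j <= 2 * sz j) by (rewrite <- (start_top Vs N j HN'); exact HR).
    eapply wp_iter_true; [assumption|exact Htest|discriminate|].
    eapply borrow_step with (main := main) (N := N) (D := D) (F := F);
      try eassumption.
    intros e' lv' Vs' b' H' a' Hs E3' HS' HT' HP' HN2 HR2 H02 Ha'.
    eapply (IH (J - S j)); try eassumption; try rd; try lia.
    intros e2 lv2 Vs2 b2 H2 a2 Hs2 HS2 HT2 HP2 HL2 Ha2.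
    eapply Hpost; try eassumption; [kept|].
    revert Ha' Ha2. cbn [cost borrow_test start_of]. lia.
  - apply wp_iter_false; [assumption|exact Htest|].
    eapply Hpost; try eassumption.
    + intros x Hx. reflexivity.
    + destruct HS as [S1 S2 S3 S4]. split; auto.
      intros i Hi _ HV. destruct (Nat.eq_dec i j) as [->|]; [lia|auto].
    + destruct j; [lia|]. apply H0. lia.
    + cbn [cost borrow_test start_of]. lia.
  - apply wp_iter_false; [assumption|exact Htest|].
    eapply Hpost; try eassumption.
    + intros x Hx. reflexivity.
    + destruct HS as [S1 S2 S3 S4]. split; auto.
      intros i Hi _ HV. destruct (Nat.eq_dec i j) as [->|]; [|auto].
      destruct j as [|j]; [lia|]. simpl in Hne.
      pose proof (core_eq _ _ _ _ _ HC (S j) ltac:(lia)).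
      destruct (lv (S j)); simpl in *; lia.
    + destruct j; [|apply H0; lia]. simpl in Hne. pose proof (core_lo _ _ _ _ _ HC). lia.
    + cbn [cost borrow_test start_of]. lia.
Qed.

End Loops.

(** * Appending and removing one item *)

Local Notation array := (array k l).

Variables (main : nat).

Lemma read_header_ok lv Vs N b G (P : post) e H a :
  table lv Vs N b -> Permutation H ((main, b) :: G) -> e 0 = main ->
  (forall e' a', same [11; 13; 14] e' e -> e' 11 = k -> e' 13 = low k l -> e' 14 = J ->
     a' <= a + 40 -> P e' H a') ->
  wp read_header P e H a.
Proof.
  intros HT HP E0 Hpost. unfold read_header.
  then_. set_ k. { calc ltac:(first [lia | eapply holds_perm; [exact HP|];
    eapply holds_in; [now left|apply (table_k _ _ _ _ _ _ HT)]]). }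
  then_. set_ (low k l). { calc ltac:(first [lia | eapply holds_perm; [exact HP|];
    eapply holds_in; [now left|apply (table_low _ _ _ _ _ _ HT)]]). }
  set_ (top k l). { calc ltac:(first [lia | eapply holds_perm; [exact HP|];
    eapply holds_in; [now left|apply (table_top _ _ _ _ _ _ HT)]]). }
  apply Hpost; try rd; [kept|]. cbn [cost word]. lia.
Qed.

Lemma offset_ok lv Vs N b G e H :
  table lv Vs N b -> Permutation H ((main, b) :: G) -> Vs 1 <= N -> e 0 = main ->
  evals A offset e H (N - Vs 1).
Proof.
  intros HT HP HV E0.
  calc ltac:(first [lia
    | eapply holds_start with (j := 0); [eassumption..|lia|reflexivity]
    | eapply holds_start with (j := 1); [eassumption..|lia|reflexivity]]).
Qed.

Lemma last_slot_ok E n x e H :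
  evals A E e H n -> n / sz 0 = x -> slot k l 0 + x < W ->
  e 13 = low k l -> e 14 = J -> evals A (last_slot E) e H (slot k l 0 + x).
Proof.
  intros HE Hx HW E13 E14. unfold last_slot.
  pose proof (l_lt_max l). pose proof (top_le k l adm).
  eapply evals_eq.
  - eapply evals_B; [calc lia| |split; [|reflexivity]].
    + eapply evals_B; [exact HE|calc lia|reflexivity].
    + rewrite size_zero, Hx. unfold slot in HW. lia.
  - rewrite size_zero, Hx. unfold slot. lia.
Qed.

Lemma remainder_ok E n e H :
  evals A E e H n -> e 13 = low k l ->
  evals A (E mod (K 1 << V 13)) e H (n mod sz 0).
Proof.
  intros HE E13. pose proof (size_le_max k l adm 0 (Nat.le_0_l _)) as Hs.
  rewrite <- size_zero in *.
  eapply evals_eq.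
  - eapply evals_B; [exact HE|calc lia|reflexivity].
  - now rewrite Nat.mul_1_l.
Qed.

Lemma last_block cf cn lv Vs N :
  shape cf cn lv Vs (S N) -> Vs 1 <= N ->
  exists ps p, lv 0 = ps ++ [p] /\ Vs 1 + sz 0 * length ps <= N /\
    N < Vs 1 + sz 0 * length ps + sz 0 /\ Vs 0 = Vs 1 + sz 0 * length ps + sz 0.
Proof.
  intros HS HV. assert (HC := shape_core _ _ _ _ _ _ _ HS).
  pose proof (core_eq _ _ _ _ _ HC 0 ltac:(lia)) as HV0.
  pose proof (core_hi _ _ _ _ _ HC). pose proof (core_gap _ _ _ _ _ HC).
  destruct (exists_last (l := lv 0)) as [ps [p Hps]].
  { intros E. rewrite E in HV0. simpl in HV0. lia. }
  exists ps, p. rewrite Hps, length_app in HV0. cbn [length] in HV0.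
  rewrite Nat.mul_add_distr_l, Nat.mul_1_r in HV0.
  split; [assumption|]. lia.
Qed.

Lemma slot_zero_lt cf cn lv Vs N x :
  shape cf cn lv Vs N -> x < length (lv 0) ->
  J + 6 <= slot k l 0 + x < index_size k l.
Proof.
  intros HS Hx. pose proof (shape_le _ _ _ _ _ _ _ HS 0) as Hle.
  pose proof (top_pos k l adm). pose proof (slot_le_max k l adm 0 (Nat.le_0_l _)).
  pose proof (head_lt_slot k l 0). lia.
Qed.

(** The shape is already that of [S N] items while the table still says [N]: the state in which both
    branches of [push] meet, with a free word in the last block. *)
Lemma push_tail D F N lv Vs b v (P : post) e H a :
  shape 0 0 lv Vs (S N) -> Vs 1 <= N -> table lv Vs N b ->
  Permutation H ((main, b) :: levels lv Vs D ++ F) ->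
  e 0 = main -> e 2 = v -> e 13 = low k l -> e 14 = J ->
  (forall D' H' a', (forall i, i < N -> D' i = D i) -> D' N = v ->
     array main D' (S N) Vs F H' -> a' <= a + 200 -> P e H' a') ->
  wp (put (G (V 0) (last_slot offset)) (offset mod (K 1 << V 13)) (V 2);;
      put (V 0) (K 4) (start_of (K 0) + K 1)) P e H a.
Proof.
  intros HS HV HT HP E0 E2 E13 E14 Hpost.
  assert (HC := shape_core _ _ _ _ _ _ _ HS).
  destruct (last_block _ _ _ _ _ HS HV) as (ps & p & Hps & HN1 & HN2 & HV0).
  destruct (div_last N (Vs 1) (sz 0) (length ps) HN1 HN2) as [Hdiv Hmod].
  assert (Hslot : J + 6 <= slot k l 0 + length ps < index_size k l).
  { eapply slot_zero_lt; [exact HS|]. rewrite Hps, length_app. simpl. lia. }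
  pose proof (index_size_le_max k l adm). pose proof (core_max _ _ _ _ _ HC).
  pose proof (table_length _ _ _ _ _ _ HT) as Hlb.
  assert (Hoff := offset_ok _ _ _ _ _ e _ HT HP HV E0).
  set (off := N - (Vs 1 + sz 0 * length ps)) in *.
  set (D' := update D N v).
  set (R := blocks D (Vs 1) (sz 0) ps ++ flat_map (level k l lv Vs D) (seq 1 J) ++ F).
  assert (HR : levels lv Vs D ++ F =
    (blocks D (Vs 1) (sz 0) ps ++ [(p, slice D (Vs 1 + sz 0 * length ps) (sz 0))] ++
     flat_map (level k l lv Vs D) (seq 1 J)) ++ F).
  { rewrite levels_zero. unfold level at 1. rewrite Hps, blocks_app. cbn [blocks].
    now rewrite <- !app_assoc. }
  assert (HR' : levels lv Vs D' ++ F =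
    (blocks D (Vs 1) (sz 0) ps ++ [(p, slice D' (Vs 1 + sz 0 * length ps) (sz 0))] ++
     flat_map (level k l lv Vs D) (seq 1 J)) ++ F).
  { rewrite levels_zero. unfold level at 1. rewrite Hps, blocks_app. cbn [blocks].
    rewrite <- (upper_ext k l lv Vs (S N) D D' HC).
    - rewrite (blocks_ext D' D).
      + now rewrite <- !app_assoc.
      + intros i Hi. unfold D'. rewrite update_other; [reflexivity|lia].
    - intros i Hi. unfold D'. rewrite update_other; [reflexivity|lia]. }
  rewrite HR in HP.
  then_. eapply wp_put with (p := p) (i := off) (v := v)
    (b := slice D (Vs 1 + sz 0 * length ps) (sz 0)) (F := (main, b) :: R).
  { assumption. }
  { eapply evals_G; [calc lia| |].
    - eapply last_slot_ok; try eassumption. lia.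
    - eapply holds_slot with (j := 0) (x := length ps); try eassumption; [lia| |reflexivity].
      rewrite Hps, nth_error_app2, Nat.sub_diag by lia. reflexivity. }
  { rewrite <- Hmod. now apply remainder_ok. }
  { calc lia. }
  { etransitivity; [exact HP|]. unfold R. perm. }
  { rewrite slice_length. unfold off. lia. }
  rewrite set_nth_slice by (unfold off; lia).
  replace (Vs 1 + sz 0 * length ps + off) with N by (unfold off; lia). fold D'.
  eapply wp_put with (p := main) (i := 4) (v := N + 1) (b := b).
  { assumption. }
  { calc lia. }
  { calc lia. }
  { calc ltac:(first [lia | eapply holds_start with (j := 0);
      [eassumption|apply perm_swap|lia|reflexivity]]). }
  { apply perm_swap. }
  { lia. }
  apply (Hpost D').
  - intros i Hi. unfold D'. now rewrite update_other by lia.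
  - unfold D'. apply update_at.
  - exists lv, (set_nth b 4 (N + 1)). split; [exact HS|split].
    + assert (Hn : forall i, nth_error (set_nth b 4 (N + 1)) i =
        if i =? 4 then Some (N + 1) else nth_error b i).
      { intros i. apply nth_error_set_nth. lia. }
      destruct HT as [T1 T2 T3 T4 T5 T6 T7].
      split; try (rewrite Hn; assumption).
      * rewrite set_nth_length; lia.
      * intros [|i] Hi; rewrite Hn.
        -- cbn. f_equal. lia.
        -- replace (4 + S i =? 4) with false by (symmetry; apply Nat.eqb_neq; lia).
           now apply T6.
      * intros i x Hi Hx. rewrite Hn. pose proof (head_lt_slot k l i).
        replace (slot k l i + x =? 4) with false by (symmetry; apply Nat.eqb_neq; lia).
        now apply T7.
    + rewrite HR'. unfold R. perm.
  - cbn [cost last_slot offset start_of]. lia.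
Qed.

Lemma push_ok D F N Vs v (P : post) e H a :
  array main D N Vs F H -> N < 2 ^ S l ->
  index_size k l + N + sz J + heap_size F <= X ->
  e 0 = main -> e 2 = v ->
  (forall D' Vs' e' H' a', same (seq 3 16) e' e ->
     (forall i, i < N -> D' i = D i) -> D' N = v -> array main D' (S N) Vs' F H' ->
     a' + 600 * potential Vs' (S N) <= a + 600 * potential Vs N + 1200 * J + 1000 ->
     P e' H' a') ->
  wp push P e H a.
Proof.
  intros (lv & b & HS & HT & HP) HN HX E0 E2 Hpost. unfold push.
  then_. eapply read_header_ok; try eassumption.
  intros e1 a1 Hs1 E11 E13 E14 Ha1.
  assert (HC := shape_core _ _ _ _ _ _ _ HS).
  pose proof (core_lo _ _ _ _ _ HC) as HV. pose proof (core_hi _ _ _ _ _ HC) as HV0.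
  pose proof (core_gap _ _ _ _ _ HC) as Hgap.
  pose proof (core_eq _ _ _ _ _ HC 0 ltac:(lia)) as HVeq.
  pose proof (size_pos k l 0) as Hz.
  pose proof (index_size_le_max k l adm) as Himax.
  assert (E0' : e1 0 = main) by rd.
  assert (Hoff := offset_ok _ _ _ _ _ e1 _ HT HP HV E0').
  then_. eapply wp_cond with (v := (N - Vs 1) mod sz 0); [assumption| | |].
  { now apply remainder_ok. }
  - intros Hm. apply wp_skip; [assumption|].
    assert (HNV : N < Vs 0).
    { destruct (Nat.eq_dec N (Vs 0)) as [E|]; [|lia]. exfalso. apply Hm.
      rewrite E, HVeq, (Nat.add_comm (Vs 1)), Nat.add_sub, Nat.mul_comm.
      apply Nat.Div0.mod_mul. }
    eapply push_tail with (lv := lv) (Vs := Vs) (D := D) (F := F) (v := v);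
      try eassumption; try rd.
    + destruct HS as [[C1 C2 C3 C4 C5 C6] S2 S3 S4].
      split; auto. split; auto; lia.
    + intros D' H' a' HD1 HD2 HA Ha. eapply Hpost; try eassumption; [kept|].
      pose proof (potential_grow k l Vs N). revert Ha. cbn [cost offset start_of]. lia.
  - intros Hm.
    (* [N - Vs 1] and [Vs 0 - Vs 1] are multiples of the block size that differ by less than one
       block. *)
    assert (HNV : N = Vs 0).
    { pose proof (Nat.div_mod_eq (N - Vs 1) (sz 0)) as Hd. rewrite Hm in Hd.
      set (q := (N - Vs 1) / sz 0) in *.
      assert (q = length (lv 0)); [|subst q; rewrite HVeq; lia].
      assert (sz 0 * q <= sz 0 * length (lv 0)) by lia.
      assert (sz 0 * length (lv 0) < sz 0 * (q + 1)) by lia.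
      apply Nat.mul_le_mono_pos_l in H0; [|assumption].
      apply Nat.mul_lt_mono_pos_l in H1; [|assumption]. lia. }
    then_. set_ 0; [calc lia|].
    then_. apply wp_loop; [assumption|].
    eapply carry_loop with (main := main) (D := D) (F := F) (N := N)
      (j := 0) (lv := lv) (Vs := Vs); try eassumption; try rd; try lia.
    intros e2 lv' Vs' b' H' a' Hs2 HS' HT' HP' HN' HL Ha'.
    assert (HC' := shape_core _ _ _ _ _ _ _ HS').
    assert (HHs := array_size k l main D F _ _ _ _ _ _ _ HS' HT' HP').
    pose proof (size_mono k l 0 J (Nat.le_0_l _)) as Hzm.
    pose proof (core_lo _ _ _ _ _ HC') as HVlo'.
    pose proof (core_eq _ _ _ _ _ HC' 0 ltac:(lia)) as HVeq'.
    pose proof (size_le_max k l adm 0 (Nat.le_0_l _)) as Hzmax.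
    then_. eapply wp_new with (n := sz 0); [assumption|assumption| |lia|lia|].
    { rewrite <- size_zero in *. eapply evals_eq; [calc lia|]. lia. }
    intros q c Hc.
    (* The arbitrary contents of the new block become the values of the item function from [N]
       on. *)
    set (D1 := fun i => if i <? N then D i else nth (i - N) c 0).
    assert (HD1 : forall i, i < N -> D i = D1 i).
    { intros i Hi. unfold D1. destruct (Nat.ltb_spec i N); [reflexivity|lia]. }
    set (lv2 := update lv' 0 (lv' 0 ++ [q])).
    set (Vs2 := update Vs' 0 (N + sz 0)).
    assert (HVs2 : forall j, Vs2 (S j) = Vs' (S j)).
    { intros j. unfold Vs2. now rewrite update_other by lia. }
    assert (Hlv2 : forall j, lv2 (S j) = lv' (S j)).
    { intros j. unfold lv2. now rewrite update_other by lia. }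
    assert (Hlv20 : lv2 0 = lv' 0 ++ [q]) by apply update_at.
    assert (HS2 : shape 0 0 lv2 Vs2 (S N)).
    { destruct HS' as [[C1 C2 C3 C4 C5 C6] S2 S3 S4]. split; [split| | |].
      - now rewrite HVs2.
      - intros [|j] Hj; rewrite HVs2.
        + rewrite Hlv20, length_app. cbn [length]. unfold Vs2.
          rewrite update_at. lia.
        + rewrite HVs2, Hlv2. auto.
      - rewrite HVs2. lia.
      - unfold Vs2. rewrite update_at. lia.
      - unfold Vs2. rewrite update_at. lia.
      - lia.
      - intros [|j] Hj.
        + rewrite Hlv20, length_app. simpl. lia.
        + rewrite Hlv2. auto.
      - intros [|j] Hj; [lia|]. rewrite Hlv2. auto.
      - intros [|j] Hj; [lia|]. rewrite Hlv2, HVs2. auto. }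
    assert (Hsl : J + 6 <= slot k l 0 + length (lv' 0) < index_size k l).
    { eapply slot_zero_lt; [exact HS2|]. rewrite Hlv20, length_app. simpl. lia. }
    assert (Hlb' := table_length _ _ _ _ _ _ HT').
    assert (Hn1 : forall i, nth_error (set_nth b' (slot k l 0 + length (lv' 0)) q) i =
        if i =? slot k l 0 + length (lv' 0) then Some q else nth_error b' i).
    { intros i. apply nth_error_set_nth. lia. }
    eapply wp_put with (p := main) (i := slot k l 0 + length (lv' 0)) (v := q) (b := b')
      (F := (q, c) :: levels lv' Vs' D ++ F).
    { assumption. }
    { calc lia. }
    { eapply last_slot_ok; [|shelve|lia|rd|rd].
      eapply offset_ok; [exact HT'| |assumption|rd].
      etransitivity; [apply perm_skip; exact HP'|]. apply perm_swap.
      Unshelve.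
      rewrite HN', HVeq', (Nat.add_comm (Vs' 1)), Nat.add_sub, Nat.mul_comm.
      apply Nat.div_mul. lia. }
    { calc lia. }
    { etransitivity; [apply perm_skip; exact HP'|]. apply perm_swap. }
    { lia. }
    eapply push_tail with (lv := lv2) (Vs := Vs2) (D := D1) (F := F) (v := v)
      (b := set_nth b' (slot k l 0 + length (lv' 0)) q);
      try eassumption; try rd.
    + destruct HT' as [T1 T2 T3 T4 T5 T6 T7]. split.
      * rewrite set_nth_length; lia.
      * rewrite Hn1. destruct (Nat.eqb_spec 0 (slot k l 0 + length (lv' 0))); [lia|assumption].
      * rewrite Hn1. destruct (Nat.eqb_spec 1 (slot k l 0 + length (lv' 0))); [lia|assumption].
      * rewrite Hn1. destruct (Nat.eqb_spec 2 (slot k l 0 + length (lv' 0))); [lia|assumption].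
      * rewrite Hn1. destruct (Nat.eqb_spec 3 (slot k l 0 + length (lv' 0))); [lia|assumption].
      * intros j Hj. rewrite Hn1.
        destruct (Nat.eqb_spec (4 + j) (slot k l 0 + length (lv' 0))); [lia|].
        rewrite T6 by assumption. destruct j; [reflexivity|]. simpl. now rewrite HVs2.
      * intros [|j] x Hj Hx; rewrite Hn1.
        -- rewrite Hlv20 in *. rewrite length_app in Hx. simpl in Hx.
           destruct (Nat.eqb_spec (slot k l 0 + x) (slot k l 0 + length (lv' 0))).
           ++ replace x with (length (lv' 0)) by lia.
              now rewrite nth_error_app2, Nat.sub_diag by lia.
           ++ rewrite nth_error_app1 by lia. apply T7; lia.
        -- rewrite Hlv2 in *. pose proof (slot_mono k l 1 (S j) ltac:(lia)).
           pose proof (slot_S k l 0).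
           destruct (Nat.eqb_spec (slot k l (S j) + x) (slot k l 0 + length (lv' 0)));
             [lia|]. now apply T7.
    + apply perm_skip. rewrite !levels_zero. unfold level at 1 3.
      rewrite HVs2, Hlv20, blocks_app. cbn [blocks].
      rewrite (upper_ext_shape k l lv2 lv' Vs2 Vs' D1 HVs2 Hlv2).
      rewrite <- (upper_ext k l lv' Vs' N D D1 HC') by (intros i Hi; apply HD1; lia).
      rewrite <- (blocks_ext D D1) by (intros i Hi; apply HD1; lia).
      rewrite <- HVeq', <- HN'.
      replace (slice D1 N (sz 0)) with c
        by (rewrite <- Hc; symmetry; apply slice_of_block).
      perm.
    + intros D' H2 a2 HD1' HD2' HA Ha2.
      eapply Hpost; try eassumption.
      * kept.
      * intros i Hi. rewrite HD1' by assumption. symmetry. now apply HD1.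
      * rewrite (potential_ext k l Vs2 Vs' (S N) HVs2).
        pose proof (potential_grow k l Vs' N). revert Ha2 Ha'.
        cbn [cost offset start_of last_slot]. lia.
Qed.

Lemma pop_ok D F N Vs (P : post) e H a :
  array main D (S N) Vs F H ->
  index_size k l + S N + sz J + heap_size F <= X ->
  e 0 = main ->
  (forall Vs' e' H' a', same (seq 2 17) e' e -> e' 2 = D N -> array main D N Vs' F H' ->
     a' + 600 * potential Vs' N <= a + 600 * potential Vs (S N) + 1200 * J + 1000 ->
     P e' H' a') ->
  wp pop P e H a.
Proof.
  intros (lv0 & b0 & HS0 & HT0 & HP0) HX E0 Hpost. unfold pop.
  then_. eapply read_header_ok; try eassumption.
  intros e1 a1 Hs1 E11 E13 E14 Ha1.
  then_. set_ 0; [calc lia|].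
  then_. apply wp_loop; [assumption|].
  eapply borrow_loop with (main := main) (D := D) (F := F) (N := S N)
    (j := 0) (lv := lv0) (Vs := Vs); try eassumption; try rd; try lia.
  intros e2 lv Vs' b H' a2 Hs2 HS HT HP HV Ha2.
  assert (HC := shape_core _ _ _ _ _ _ _ HS).
  destruct (last_block _ _ _ _ _ HS ltac:(lia)) as (ps & p & Hps & HN1 & HN2 & HV0).
  destruct (div_last N (Vs' 1) (sz 0) (length ps) HN1 HN2) as [Hdiv Hmod].
  assert (Hslot : J + 6 <= slot k l 0 + length ps < index_size k l).
  { eapply slot_zero_lt; [exact HS|]. rewrite Hps, length_app. simpl. lia. }
  pose proof (index_size_le_max k l adm). pose proof (core_max _ _ _ _ _ HC).
  pose proof (table_length _ _ _ _ _ _ HT) as Hlb.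
  set (off := N - (Vs' 1 + sz 0 * length ps)) in *.
  (* The length is lowered before the item is read, so that [offset] addresses item [N], the one to
     be removed. *)
  set (b2 := set_nth b 4 N).
  assert (Hb2 : forall i, nth_error b2 i = if i =? 4 then Some N else nth_error b i).
  { intros i. apply nth_error_set_nth. lia. }
  assert (HT2 : table lv Vs' N b2).
  { destruct HT as [T1 T2 T3 T4 T5 T6 T7].
    split; try (rewrite Hb2; assumption).
    - unfold b2. rewrite set_nth_length; lia.
    - intros [|i] Hi; rewrite Hb2; [reflexivity|].
      replace (4 + S i =? 4) with false by (symmetry; apply Nat.eqb_neq; lia).
      now apply T6.
    - intros i x Hi Hx. rewrite Hb2. pose proof (head_lt_slot k l i).
      replace (slot k l i + x =? 4) with false by (symmetry; apply Nat.eqb_neq; lia).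
      now apply T7. }
  then_. eapply wp_put with (p := main) (i := 4) (v := N) (b := b).
  { assumption. }
  { calc lia. }
  { calc lia. }
  { eapply evals_eq; [calc ltac:(first [lia | eapply holds_start with (j := 0);
      [exact HT|exact HP|lia|reflexivity]|simpl; lia])|]. simpl. lia. }
  { exact HP. }
  { lia. }
  fold b2.
  set (lst := slice D (Vs' 1 + sz 0 * length ps) (sz 0)).
  set (R := blocks D (Vs' 1) (sz 0) ps ++ flat_map (level k l lv Vs' D) (seq 1 J) ++ F).
  assert (HPl : Permutation (levels lv Vs' D ++ F) ((p, lst) :: R)).
  { rewrite levels_zero. unfold level at 1. rewrite Hps, blocks_app. cbn [blocks].
    unfold R, lst. perm. }
  assert (Hoff : forall e, e 0 = main ->
    evals A offset e ((main, b2) :: levels lv Vs' D ++ F) (N - Vs' 1)).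
  { intros e3 E3. eapply offset_ok; [exact HT2|reflexivity|lia|assumption]. }
  then_. set_ p.
  { eapply evals_G; [calc lia| |].
    - eapply last_slot_ok; [apply Hoff; rd|exact Hdiv|lia|rd|rd].
    - eapply holds_slot with (j := 0) (x := length ps);
        [exact HT2|reflexivity|lia| |reflexivity].
      rewrite Hps, nth_error_app2, Nat.sub_diag by lia. reflexivity. }
  then_. set_ (D N).
  { eapply evals_G; [calc lia| |].
    - apply remainder_ok; [apply Hoff; rd|rd].
    - rewrite Hmod. eapply holds_perm; [apply perm_skip; exact HPl|].
      eapply holds_in; [right; left; reflexivity|].
      unfold lst. rewrite nth_error_slice by (unfold off; lia). do 2 f_equal.
      unfold off. lia. }
  assert (Hlast : core k l lv Vs' (S N) -> length (lv 0) = length ps + 1).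
  { intros _. now rewrite Hps, length_app. }
  specialize (Hlast HC).
  eapply wp_cond with (v := off); [assumption| | |].
  { rewrite <- Hmod. apply remainder_ok; [apply Hoff; rd|rd]. }
  - intros Hm. apply wp_skip; [assumption|].
    eapply Hpost.
    + kept.
    + rd.
    + exists lv, b2. split; [|split; [exact HT2|reflexivity]].
      destruct HS as [[C1 C2 C3 C4 C5 C6] S2 S3 S4].
      split; auto. split; auto; unfold off in Hm; lia.
    + pose proof (potential_shrink k l Vs' N). revert Ha1 Ha2.
      cbn [cost offset start_of last_slot]. lia.
  - intros Hm.
    set (lv2 := update lv 0 ps). set (Vs2 := update Vs' 0 N).
    assert (HVs2 : forall j, Vs2 (S j) = Vs' (S j)).
    { intros j. unfold Vs2. now rewrite update_other by lia. }
    assert (Hlv2 : forall j, lv2 (S j) = lv (S j)).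
    { intros j. unfold lv2. now rewrite update_other by lia. }
    assert (Hlv20 : lv2 0 = ps) by apply update_at.
    eapply wp_free with (p := p) (b := lst) (F := (main, b2) :: R).
    { assumption. }
    { calc lia. }
    { etransitivity; [apply perm_skip; exact HPl|]. apply perm_swap. }
    eapply Hpost with (Vs' := Vs2).
    + kept.
    + rd.
    + exists lv2, b2. split; [|split].
      * destruct HS as [[C1 C2 C3 C4 C5 C6] S2 S3 S4]. unfold off in Hm.
        split; [split| | |].
        -- now rewrite HVs2.
        -- intros [|j] Hj; rewrite HVs2.
           ++ rewrite Hlv20. unfold Vs2. rewrite update_at. lia.
           ++ rewrite HVs2, Hlv2. auto.
        -- rewrite HVs2. lia.
        -- unfold Vs2. rewrite update_at. lia.
        -- unfold Vs2. rewrite update_at. pose proof (size_pos k l 0). lia.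
        -- lia.
        -- intros [|j] Hj; [rewrite Hlv20|rewrite Hlv2; auto].
           specialize (S2 0 Hj). lia.
        -- intros [|j] Hj; [lia|]. rewrite Hlv2. auto.
        -- intros [|j] Hj; [lia|]. rewrite Hlv2, HVs2. auto.
      * destruct HT2 as [T1 T2 T3 T4 T5 T6 T7]. split; auto.
        -- intros [|j] Hj; rewrite T6 by assumption; [reflexivity|].
           simpl. now rewrite HVs2.
        -- intros [|j] x Hj Hx.
           ++ rewrite Hlv20 in *. rewrite T7 by lia. rewrite Hps.
              now apply nth_error_app1.
           ++ rewrite Hlv2 in *. now apply T7.
      * apply perm_skip. rewrite levels_zero. unfold level at 1.
        rewrite HVs2, Hlv20.
        rewrite (upper_ext_shape k l lv2 lv Vs2 Vs' D HVs2 Hlv2). unfold R. perm.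
    + rewrite (potential_ext k l Vs2 Vs' N HVs2).
      pose proof (potential_shrink k l Vs' N). revert Ha1 Ha2.
      cbn [cost offset start_of last_slot]. lia.
Qed.

End Steps.

(** The level of item [V 1] is the guessed one or one of the next two. *)
Definition guess : cmd :=
  assign 16 (start_of (K 0) - V 1);;
  assign 17 (M (V 16));;
  cond (V 17 < V 13) (assign 3 (K 0)) (assign 3 ((V 17 - V 13) / V 11));;
  cond (V 3) (assign 3 (V 3 - K 1)) Skip;;
  cond (V 14 < V 3) (assign 3 (V 14)) Skip.
Definition advance : cmd :=
  cond (V 1 < start_of (V 3 + K 1)) (assign 3 (V 3 + K 1)) Skip.
(** Address and offset of item [V 1] go to registers 7 and 9. *)
Definition locate : cmd :=
  read_header;; guess;; advance;; advance;;
  assign 17 (V 13 + V 11 * V 3);;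
  assign 16 (V 1 - start_of (V 3 + K 1));;
  assign 7 (G (V 0) (V 14 + K 6 + (V 3 << (V 11 + K 1)) + (V 16 >> V 17)));;
  assign 9 (V 16 mod (K 1 << V 17)).

Definition init_test : expr := V 4 < V 14 + K 2.
Definition init_body : cmd :=
  put (V 0) (K 4 + V 4) (K 0);; assign 4 (V 4 + K 1).
(** Creates an empty array for [l] given in register 19. *)
Definition make : cmd :=
  assign 11 (V 19 / (K 2 * Q (K 1 << V 19)));;
  assign 13 (V 11 + (V 19 mod V 11));;
  assign 14 (V 19 / V 11 - K 3);;
  new 0 (V 14 + K 6 + (V 14 << (V 11 + K 1)) + (K 2 << (K 2 * V 11)));;
  put (V 0) (K 0) (V 11);;
  put (V 0) (K 1) (V 19);;
  put (V 0) (K 2) (V 13);;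
  put (V 0) (K 3) (V 14);;
  assign 4 (K 0);;
  loop init_test init_body.

(** * The level of an item from its distance to the end *)

Section Guess.

Variables k l : nat.
Hypothesis adm : admissible k l.
Local Notation J := (top k l).
Local Notation sz := (size k l).
Local Notation shape := (shape k l).

Definition guess_level (d : nat) : nat :=
  Nat.min J
    ((if Nat.log2 d <? low k l then 0 else (Nat.log2 d - low k l) / k) - 1).

(** Level [i] holds at most [2 * sz (S i)] items, and these bounds grow at least eightfold from
    level to level, so their sum is dominated by the last one. *)
Lemma lower_levels lv Vs N j :
  shape 0 0 lv Vs N -> 1 <= j <= J -> N - Vs j <= 4 * sz j.
Proof.
  intros HS [H1 H2]. assert (HC := shape_core _ _ _ _ _ _ _ HS).
  assert (Hlev : forall i, i < J -> Vs i <= Vs (S i) + 2 * sz (S i)).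
  { intros i Hi. rewrite (core_eq _ _ _ _ _ HC i) by lia.
    pose proof (shape_le _ _ _ _ _ _ _ HS i Hi) as Hle.
    apply (Nat.mul_le_mono_l _ _ (sz i)) in Hle.
    rewrite size_S. lia. }
  induction j as [|j IH]; [lia|].
  destruct (Nat.eq_dec j 0) as [->|Hj].
  - pose proof (Hlev 0 ltac:(lia)). pose proof (core_hi _ _ _ _ _ HC). lia.
  - specialize (IH ltac:(lia) ltac:(lia)). pose proof (Hlev j ltac:(lia)).
    pose proof (size_S_ge k l adm j). lia.
Qed.

(** For a positive guess [S s], the distance is at least [sz (S (S s))], thus at least
    [8 * sz (S s)], while the levels below [S s] hold at most [4 * sz (S s)] items. *)
Lemma guess_lower lv Vs N i :
  shape 0 0 lv Vs N -> i < N -> i < start Vs N (guess_level (N - i)).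
Proof.
  intros HS Hi. destruct (guess_level (N - i)) as [|s] eqn:Hs; [assumption|].
  simpl. unfold guess_level in Hs.
  destruct (Nat.ltb_spec (Nat.log2 (N - i)) (low k l)) as [Hlt|Hge]; [simpl in Hs; lia|].
  set (j0 := (Nat.log2 (N - i) - low k l) / k) in *.
  pose proof (lower_levels _ _ _ (S s) HS ltac:(lia)) as HL.
  pose proof (Nat.log2_spec (N - i) ltac:(lia)) as [Hd _].
  assert (Hj0 : k * j0 <= Nat.log2 (N - i) - low k l) by apply Nat.Div0.mul_div_le.
  assert (Hsz : sz (S (S s)) <= N - i).
  { eapply Nat.le_trans; [|exact Hd]. eapply Nat.le_trans; [apply (size_mono k l _ j0); lia|].
    unfold size. apply Nat.pow_le_mono_r; lia. }
  pose proof (size_S_ge k l adm (S s)). pose proof (size_pos k l (S s)). lia.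
Qed.

(** If the item lay beyond the two levels after the guess, the second of these would be nonempty and
    contribute a full block to the distance, which would then have a larger binary logarithm. *)
Lemma guess_upper lv Vs N i :
  shape 0 0 lv Vs N -> i < N -> guess_level (N - i) + 2 <= J ->
  Vs (guess_level (N - i) + 3) <= i.
Proof.
  intros HS Hi HsJ. set (s := guess_level (N - i)) in *.
  destruct (Nat.le_gt_cases (Vs (s + 3)) i) as [|Hgt]; [assumption|exfalso].
  assert (HC := shape_core _ _ _ _ _ _ _ HS).
  pose proof (shape_ne _ _ _ _ _ _ _ HS (s + 2) ltac:(lia) ltac:(lia)) as Hne.
  replace (S (s + 2)) with (s + 3) in Hne by lia.
  specialize (Hne ltac:(lia)).
  pose proof (core_eq _ _ _ _ _ HC (s + 2) HsJ) as HV.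
  replace (S (s + 2)) with (s + 3) in HV by lia.
  pose proof (core_mono _ _ _ _ _ 1 (s + 2) HC ltac:(lia) ltac:(lia)).
  pose proof (core_lo _ _ _ _ _ HC).
  assert (Hbig : sz (s + 2) <= sz (s + 2) * length (lv (s + 2))).
  { apply Nat.le_mul_r. lia. }
  set (d := N - i) in *.
  assert (Hd : sz (s + 2) < d) by (unfold d; lia).
  pose proof (Nat.log2_spec d ltac:(lia)) as [_ Hlog].
  assert (Hk : k <> 0) by (destruct adm; lia).
  assert (Hm : S (Nat.log2 d) <= low k l + k * (s + 2)).
  { unfold s, guess_level in *.
    destruct (Nat.ltb_spec (Nat.log2 d) (low k l)) as [Hlt|Hge]; [lia|].
    set (j0 := (Nat.log2 d - low k l) / k) in *.
    pose proof (Nat.mul_succ_div_gt (Nat.log2 d - low k l) k Hk) as Hgt'.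
    fold j0 in Hgt'.
    assert (k * S j0 <= k * (Nat.min J (j0 - 1) + 2)) by (apply Nat.mul_le_mono_l; lia).
    lia. }
  apply (Nat.pow_le_mono_r 2) in Hm; [|lia].
  unfold size in Hd. lia.
Qed.

End Guess.

Section Steps.

Variables (A : machine) (X : nat).
Hypothesis valid_A : valid_machine A.
Hypothesis X_lt : X + 1 < word_bound A.
Local Notation W := (word_bound A).
Local Notation wp := (wp A X).
Local Notation wp_iter := (wp_iter A X).

Section Locate.

Variables k l : nat.
Hypothesis adm : admissible k l.
Hypothesis W_ge : 128 + 8 * 2 ^ S l <= word_bound A.
Local Notation J := (top k l).
Local Notation sz := (size k l).
Local Notation shape := (shape k l).
Local Notation table := (table k l).
Local Notation levels := (levels k l).
Local Notation array := (array k l).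

Variables (main i N : nat) (D : nat -> nat) (F G : heap) (lv : nat -> list nat)
  (Vs : nat -> nat) (b : block).
Hypothesis HS : shape 0 0 lv Vs N.
Hypothesis HT : table lv Vs N b.
Hypothesis Hi : i < N.

Lemma guess_ok (P : post) e H a :
  Permutation H ((main, b) :: G) ->
  e 0 = main -> e 1 = i -> e 11 = k -> e 13 = low k l -> e 14 = J ->
  (forall e' a', same [3; 16; 17] e' e -> e' 3 = guess_level k l (N - i) ->
     a' <= a + 150 -> P e' H a') ->
  wp guess P e H a.
Proof.
  intros HP E0 E1 E11 E13 E14 Hpost. unfold guess.
  then_. set_ (N - i). { calc ltac:(first [lia
    | eapply holds_start with (j := 0); [eassumption..|lia|reflexivity]
    | simpl; lia]). }
  then_. set_ (Nat.log2 (N - i)); [calc lia|].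
  set (m := Nat.log2 (N - i)).
  set (j0 := if m <? low k l then 0 else (m - low k l) / k).
  then_. apply wp_cond with (v := if m <? low k l then 1 else 0); [assumption|calc lia| |].
  all: intros Hc1.
  all: set_ j0; [unfold j0; destruct (Nat.ltb_spec m (low k l)); try lia; calc lia|].
  all: then_; apply wp_cond with (v := j0); [assumption|calc lia| |]; intros Hc2.
  all: first [set_ (j0 - 1); [calc lia|] | apply wp_skip; [assumption|]].
  all: apply wp_cond with (v := if J <? j0 - 1 then 1 else 0);
    [assumption|eapply evals_eq; [calc lia|]; try reflexivity; rewrite Hc2; reflexivity| |];
    intros Hc3.
  all: first [set_ (top k l); [calc lia|] | apply wp_skip; [assumption|]].
  all: apply Hpost; [kept| |cbn [cost start_of]; lia].
  all: eapply eq_trans; [rd|]; unfold guess_level; fold m; fold j0.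
  all: destruct (Nat.ltb_spec J (j0 - 1)); lia.
Qed.

Lemma advance_ok s (P : post) e H a :
  Permutation H ((main, b) :: G) -> s <= J ->
  e 0 = main -> e 1 = i -> e 3 = s ->
  (forall e' a', same [3] e' e -> e' 3 = (if i <? Vs (S s) then S s else s) ->
     a' <= a + 50 -> P e' H a') ->
  wp advance P e H a.
Proof.
  intros HP Hs E0 E1 E3 Hpost. unfold advance.
  pose proof (l_lt_max l). pose proof (top_le k l adm).
  apply wp_cond with (v := if i <? Vs (S s) then 1 else 0); [assumption| | |].
  { eapply evals_eq; [calc ltac:(first [lia
      | eapply holds_start with (j := s + 1); [eassumption..|lia|reflexivity]])|].
    now replace (s + 1) with (S s) by lia. }
  - intros Hc. set_ (S s). { eapply evals_eq; [calc lia|]. lia. }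
    apply Hpost; [kept| |cbn [cost start_of]; lia].
    destruct (i <? Vs (S s)); [rd|lia].
  - intros Hc. apply wp_skip; [assumption|].
    apply Hpost; [kept| |cbn [cost start_of]; lia].
    destruct (i <? Vs (S s)); [lia|rd].
Qed.

Lemma locate_ok (P : post) e H a :
  Permutation H ((main, b) :: G) -> e 0 = main -> e 1 = i ->
  (forall e' a' j x p, same [3; 7; 9; 11; 13; 14; 16; 17] e' e ->
     j <= J -> nth_error (lv j) x = Some p ->
     Vs (S j) + sz j * x <= i < Vs (S j) + sz j * x + sz j ->
     e' 7 = p -> e' 9 = i - (Vs (S j) + sz j * x) ->
     a' <= a + 700 -> P e' H a') ->
  wp locate P e H a.
Proof.
  intros HP E0 E1 Hpost. unfold locate.
  assert (HC := shape_core _ _ _ _ _ _ _ HS).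
  then_. eapply read_header_ok; try eassumption.
  intros e1 a1 Hs1 E11 E13 E14 Ha1.
  then_. eapply guess_ok; try eassumption; try rd.
  intros e2 a2 Hs2 E3 Ha2.
  pose proof (guess_lower k l adm _ _ _ _ HS Hi) as HL.
  pose proof (guess_upper k l adm _ _ _ _ HS Hi) as HU.
  set (s := guess_level k l (N - i)) in *.
  assert (HsJ : s <= J) by apply Nat.le_min_l.
  assert (Htop : forall j, j <= J -> i < Vs (S j) -> S j <= J).
  { intros j Hj Hij. destruct (Nat.eq_dec j J) as [->|]; [|lia].
    rewrite (core_top _ _ _ _ _ HC) in Hij. lia. }
  then_. eapply advance_ok with (s := s); try eassumption; try rd.
  intros e3 a3 Hs3 E3' Ha3.
  set (s1 := if i <? Vs (S s) then S s else s) in *.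
  assert (Hs1J : s1 <= J).
  { unfold s1. destruct (Nat.ltb_spec i (Vs (S s))); auto. }
  then_. eapply advance_ok with (s := s1); try eassumption; try rd.
  intros e4 a4 Hs4 E4 Ha4.
  set (j := if i <? Vs (S s1) then S s1 else s1) in *.
  (* Two advances suffice by [guess_upper]. *)
  assert (Hj : j <= J /\ i < start Vs N j /\ Vs (S j) <= i).
  { unfold j, s1 in *. destruct (Nat.ltb_spec i (Vs (S s))).
    - destruct (Nat.ltb_spec i (Vs (S (S s)))); [|auto].
      pose proof (Htop _ Hs1J H1). split; [assumption|]. split; [assumption|].
      replace (S (S (S s))) with (s + 3) by lia. apply HU. lia.
    - destruct (Nat.ltb_spec i (Vs (S s))); [lia|]. auto. }
  destruct Hj as (HjJ & Hj1 & Hj2). clearbody j.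
  set (x := (i - Vs (S j)) / sz j).
  pose proof (size_pos k l j) as Hz.
  pose proof (Nat.Div0.mul_div_le (i - Vs (S j)) (sz j)) as Hx1.
  pose proof (Nat.mul_succ_div_gt (i - Vs (S j)) (sz j) ltac:(lia)) as Hx2.
  fold x in Hx1, Hx2. rewrite Nat.mul_succ_r in Hx2.
  assert (Hx : x < length (lv j)).
  { pose proof (core_eq _ _ _ _ _ HC j HjJ) as HV.
    assert (i < Vs j) by (destruct j; [pose proof (core_hi _ _ _ _ _ HC); lia|assumption]).
    apply (Nat.mul_lt_mono_pos_l (sz j)); lia. }
  destruct (nth_error (lv j) x) as [p|] eqn:Hp.
  2:{ apply nth_error_None in Hp. lia. }
  pose proof (exponent_le k l adm j ltac:(lia)). pose proof (l_lt_max l).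
  pose proof (size_le_max k l adm j HjJ) as Hsm. pose proof (slot_le_max k l adm j HjJ) as Hsl.
  pose proof (index_size_le_max k l adm). pose proof (top_le k l adm).
  assert (k <= l) by (destruct adm; lia).
  assert (Hslx : slot k l j + x < index_size k l).
  { destruct (Nat.eq_dec j J) as [E|].
    - pose proof (length_top k l adm _ _ _ HC). unfold index_size. rewrite E in Hx |- *. lia.
    - pose proof (shape_le _ _ _ _ _ _ _ HS j ltac:(lia)). lia. }
  unfold size in Hsm, x. unfold slot in Hsl, Hslx.
  then_. set_ (low k l + k * j); [calc lia|].
  then_. set_ (i - Vs (S j)).
  { eapply evals_eq; [calc ltac:(first [lia
      | eapply holds_start with (j := j + 1); [eassumption..|lia|reflexivity]
      | idtac])|].
    - simpl. replace (j + 1) with (S j) by lia. simpl. lia.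
    - replace (j + 1) with (S j) by lia. reflexivity. }
  then_. set_ p.
  { calc ltac:(first [lia | eapply holds_slot; [eassumption|eassumption|exact HjJ|exact Hp|];
      reflexivity]). }
  set_ (i - (Vs (S j) + sz j * x)).
  { eapply evals_eq; [calc lia|]. rewrite Nat.mul_1_l.
    change (2 ^ (low k l + k * j)) with (sz j).
    rewrite Nat.Div0.mod_eq. unfold x, size. lia. }
  eapply Hpost with (j := j) (x := x) (p := p); try eassumption; try rd.
  - kept.
  - unfold x, size in *. lia.
  - cbn [cost start_of]. lia.
Qed.

End Locate.

End Steps.

(** Moves the items, in reverse order, to a new array for [l] given in
    register 19. *)
Definition transfer_test : expr := K 0 < G (V 20) (K 4).
Definition transfer_body : cmd :=
  assign 0 (V 20);; pop;; assign 0 (V 21);; push.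
Definition transfer : cmd :=
  assign 20 (V 0);; make;; assign 21 (V 0);;
  loop transfer_test transfer_body;;
  free (V 20);; assign 0 (V 21).

(** * Creating an array and moving its items *)

(** Separates an array from its frame; while two arrays coexist, each is the frame for operations on
    the other. *)
Lemma array_own k l main D N Vs F H :
  array k l main D N Vs F H <->
  exists H0, array k l main D N Vs [] H0 /\ Permutation H (H0 ++ F).
Proof.
  split.
  - intros (lv & b & HS & HT & HP). exists ((main, b) :: levels k l lv Vs D).
    split; [|exact HP]. exists lv, b. rewrite app_nil_r. auto.
  - intros (H0 & (lv & b & HS & HT & HP) & HP'). exists lv, b.
    split; [assumption|split; [assumption|]].
    rewrite app_nil_r in HP. etransitivity; [exact HP'|].
    now rewrite HP.
Qed.

Lemma array_heap_size k l main D N Vs H :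
  array k l main D N Vs [] H -> heap_size H <= index_size k l + N + size k l 0.
Proof.
  intros (lv & b & HS & HT & HP).
  rewrite (array_size k l main D [] _ _ _ _ _ _ _ HS HT HP).
  pose proof (core_gap _ _ _ _ _ (shape_core _ _ _ _ _ _ _ HS)).
  change (heap_size []) with 0. lia.
Qed.

(** Without items no block can be nonempty, so nothing but the index block is left to free after a
    transfer. *)
Lemma array_empty k l main D Vs H :
  admissible k l -> array k l main D 0 Vs [] H -> exists b, Permutation H [(main, b)].
Proof.
  intros adm (lv & b & HS & HT & HP). exists b. rewrite app_nil_r in HP.
  assert (HC := shape_core _ _ _ _ _ _ _ HS).
  replace (levels k l lv Vs D) with (@nil (nat * block)) in HP; [assumption|].
  symmetry. unfold levels. rewrite flat_map_concat_map. apply concat_nil_Forall.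
  apply Forall_map, Forall_forall. intros j Hj. apply in_seq in Hj.
  assert (Hlen : length (lv j) = 0).
  { pose proof (core_eq _ _ _ _ _ HC j ltac:(lia)) as HV.
    pose proof (size_pos k l j). pose proof (core_lo _ _ _ _ _ HC).
    apply Nat.lt_1_r, (Nat.mul_lt_mono_pos_l (size k l j)); [assumption|].
    destruct j as [|j].
    - pose proof (core_gap _ _ _ _ _ HC). lia.
    - pose proof (core_mono _ _ _ _ _ 1 (S j) HC ltac:(lia) ltac:(lia)). lia. }
  apply length_zero_iff_nil in Hlen. unfold level. now rewrite Hlen.
Qed.

Lemma potential_zero k l : potential k l (fun _ => 0) 0 = 0.
Proof.
  assert (Hphi : forall j, phi k l (fun _ => 0) 0 j = 0).
  { intros j. unfold phi. cbn [Nat.eqb]. lia. }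
  unfold potential. induction (seq 0 (top k l)) as [|j js IH]; [reflexivity|].
  cbn [map list_sum fold_right]. now rewrite Hphi.
Qed.

(** What an array occupies beyond its items, plus one block of the top level. *)
Definition room (k l : nat) : nat :=
  index_size k l + size k l 0 + size k l (top k l).

Section Steps.

Variables (A : machine) (X : nat).
Hypothesis valid_A : valid_machine A.
Hypothesis X_lt : X + 1 < word_bound A.
Local Notation W := (word_bound A).
Local Notation wp := (wp A X).
Local Notation wp_iter := (wp_iter A X).

Lemma init_iter main h n G (P : post) : forall d x b e H a,
  d = n - x -> x <= n -> 100 < W -> 4 + n <= length b -> length b < W ->
  e 0 = main -> e 4 = x -> e 14 = h -> h + 2 = n -> Permutation H ((main, b) :: G) ->
  (forall b' e' H' a', same [4] e' e -> length b' = length b ->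
     (forall i, i < 4 + x -> nth_error b' i = nth_error b i) ->
     (forall i, 4 + x <= i < 4 + n -> nth_error b' i = Some 0) ->
     Permutation H' ((main, b') :: G) -> a' <= a + 50 * d + 20 ->
     P e' H' a') ->
  wp_iter init_test init_body P e H a.
Proof.
  induction d as [|d IH]; intros x b e H a Hd Hx HW Hn Hb E0 E4 E14 Hh HP Hpost.
  - apply wp_iter_false; [assumption| |].
    + eapply evals_eq; [unfold init_test; calc lia|].
      destruct (Nat.ltb_spec x (h + 2)); [lia|reflexivity].
    + eapply Hpost; try eassumption; auto.
      * intros y _. reflexivity.
      * intros i Hi. lia.
      * cbn. lia.
  - eapply wp_iter_true with (v := 1); [assumption| |discriminate|].
    { eapply evals_eq; [unfold init_test; calc lia|].
      destruct (Nat.ltb_spec x (h + 2)); [reflexivity|lia]. }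
    then_. eapply wp_put with (p := main) (i := 4 + x) (v := 0).
    { assumption. }
    { calc lia. }
    { calc lia. }
    { calc lia. }
    { exact HP. }
    { lia. }
    set_ (x + 1); [calc lia|].
    assert (Hset : forall i, nth_error (set_nth b (4 + x) 0) i =
        if i =? 4 + x then Some 0 else nth_error b i).
    { intros i. apply nth_error_set_nth. lia. }
    eapply IH with (x := x + 1) (b := set_nth b (4 + x) 0); try rd; try lia.
    + rewrite set_nth_length; lia.
    + rewrite set_nth_length; lia.
    + reflexivity.
    + intros b' e' H' a' Hs Hl Hlo Hhi HP' Ha'. apply (Hpost b'); try assumption.
      * kept.
      * rewrite Hl, set_nth_length; lia.
      * intros i Hi. rewrite Hlo, Hset by lia.
        destruct (Nat.eqb_spec i (4 + x)); [lia|reflexivity].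
      * intros i Hi. destruct (Nat.eq_dec i (4 + x)) as [->|].
        -- rewrite Hlo, Hset, Nat.eqb_refl by lia. reflexivity.
        -- apply Hhi. lia.
      * revert Ha'. cbn [cost init_test]. lia.
Qed.

Lemma make_ok k l D (P : post) e H a :
  admissible k l -> 128 + 8 * 2 ^ S l <= W -> k = l / (2 * param A (2 ^ l)) ->
  heap_size H + index_size k l <= X ->
  e 19 = l ->
  (forall main H' e' a', same [0; 4; 11; 13; 14] e' e -> e' 0 = main ->
     array k l main D 0 (fun _ => 0) H H' ->
     a' <= a + 50 * top k l + 500 -> P e' H' a') ->
  wp make P e H a.
Proof.
  intros adm W_ge Hk HX E19 Hpost. unfold make.
  pose proof (l_lt_max l) as Hl.
  assert (Hkl : k <= l) by (destruct adm; lia).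
  pose proof (top_le k l adm) as HJ.
  set (r := param A (2 ^ l)) in *.
  (* The value of [r] must fit into a word; were [2 * r] larger than [l], the quotient [k] would be
     0. *)
  assert (Hr : 2 * r <= l).
  { pose proof (Nat.Div0.mul_div_le l (2 * r)) as Hd. rewrite <- Hk in Hd.
    destruct adm as [H3 _]. nia. }
  pose proof (Nat.pow_succ_r' 2 l) as Hpow.
  then_. set_ k.
  { eapply evals_eq; [calc ltac:(first [lia | rewrite Nat.mul_1_l; fold r; lia])|].
    rewrite Nat.mul_1_l. now fold r. }
  assert (Hmod : l mod k < k) by (apply Nat.mod_upper_bound; destruct adm; lia).
  pose proof (quotient_ge k l adm) as Hq.
  then_. set_ (low k l); [calc lia|].
  then_. set_ (top k l); [calc lia|].
  pose proof (index_size_le_max k l adm) as Hi.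
  pose proof (slot_le_max k l adm (top k l) (le_n _)) as Hsl.
  pose proof (head_lt_slot k l (top k l)) as Hhd.
  then_. eapply wp_new with (n := index_size k l); [assumption|assumption| |lia|lia|].
  { eapply evals_eq; [|reflexivity]. unfold index_size, slot in *.
    calc ltac:(unfold index_size, slot in *; lia). }
  intros main b Hb.
  then_. eapply wp_put with (p := main) (i := 0) (v := k) (b := b);
    [assumption|calc lia|calc lia|calc lia|reflexivity|lia|].
  set (b1 := set_nth b 0 k).
  assert (L1 : length b1 = index_size k l)
    by (unfold b1; rewrite set_nth_length; lia).
  then_. eapply wp_put with (p := main) (i := 1) (v := l) (b := b1);
    [assumption|calc lia|calc lia|calc lia|reflexivity|lia|].
  set (b2 := set_nth b1 1 l).
  assert (L2 : length b2 = index_size k l)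
    by (unfold b2; rewrite set_nth_length; lia).
  then_. eapply wp_put with (p := main) (i := 2) (v := low k l) (b := b2);
    [assumption|calc lia|calc lia|calc lia|reflexivity|lia|].
  set (b3 := set_nth b2 2 (low k l)).
  assert (L3 : length b3 = index_size k l)
    by (unfold b3; rewrite set_nth_length; lia).
  then_. eapply wp_put with (p := main) (i := 3) (v := top k l) (b := b3);
    [assumption|calc lia|calc lia|calc lia|reflexivity|lia|].
  set (b4 := set_nth b3 3 (top k l)).
  assert (L4 : length b4 = index_size k l)
    by (unfold b4; rewrite set_nth_length; lia).
  then_. set_ 0; [calc lia|].
  apply wp_loop; [assumption|].
  assert (Hb4 : nth_error b4 0 = Some k /\ nth_error b4 1 = Some l /\
    nth_error b4 2 = Some (low k l) /\ nth_error b4 3 = Some (top k l)).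
  { unfold b4, b3, b2, b1 in *. repeat rewrite nth_error_set_nth by lia. cbn. auto. }
  clearbody b4. destruct Hb4 as (B0 & B1 & B2 & B3).
  eapply init_iter with (h := top k l) (n := top k l + 2) (x := 0) (main := main) (b := b4) (G := H);
    try rd; try lia; try reflexivity.
  intros b' e' H' a' Hs Hlb Hlo Hhi HP Ha.
  eapply Hpost with (main := main).
  - kept.
  - rd.
  - exists (fun _ => []), b'. split; [|split].
    + pose proof (size_pos k l 0). pose proof (Nat.pow_nonzero 2 k).
      split; [split| | |]; intros; simpl length; lia.
    + split; try (rewrite Hlo by lia; assumption).
      * lia.
      * intros j Hj. rewrite Hhi by lia. now destruct j.
      * intros j x Hj Hx. simpl in Hx. lia.
    + replace (levels k l (fun _ => []) (fun _ => 0) D) with (@nil (nat * block));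
        [exact HP|].
      unfold levels, level. generalize (seq 0 (S (top k l))). intros xs.
      induction xs; auto.
  - revert Ha. cbn [cost]. lia.
Qed.

Lemma holds_size k l main D N Vs F H :
  array k l main D N Vs F H -> holds H main 4 N.
Proof.
  intros (lv & b & HS & HT & HP). eapply holds_start with (j := 0); eauto; lia.
Qed.

(** The old array has [n] and the new one [i] items with [n + i = N], so the space is [N] plus the
    overheads of the two. Both potentials are part of the time bound: what the old one holds helps
    to pay for the pops, and the new one is built up by the pushes. *)
Lemma transfer_iter k l k' l' main main' D N (P : post) : forall n i Vs Vs' D' H1 H2 e H a,
  admissible k l -> 128 + 8 * 2 ^ S l <= W ->
  admissible k' l' -> 128 + 8 * 2 ^ S l' <= W ->
  N <= 2 ^ S l' -> N + room k l + room k' l' <= X ->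
  n + i = N -> array k l main D n Vs [] H1 -> array k' l' main' D' i Vs' [] H2 ->
  (forall x, x < i -> D' x = D (N - 1 - x)) ->
  Permutation H (H1 ++ H2) -> e 20 = main -> e 21 = main' ->
  (forall Vs1 Vs2 D2 H3 H4 e' H' a',
     same (0 :: seq 2 17) e' e ->
     array k l main D 0 Vs1 [] H3 -> array k' l' main' D2 N Vs2 [] H4 ->
     (forall x, x < N -> D2 x = D (N - 1 - x)) ->
     Permutation H' (H3 ++ H4) ->
     a' + 600 * potential k' l' Vs2 N <=
       a + 600 * potential k l Vs n + 600 * potential k' l' Vs' i +
       n * (1200 * (top k l + top k' l') + 2200) + 20 ->
     P e' H' a') ->
  wp_iter transfer_test transfer_body P e H a.
Proof.
  induction n as [|n IH];
    intros i Vs Vs' D' H1 H2 e H a adm HW adm' HW' HN HX Hni HA HB HD HP E20 E21 Hpost.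
  - simpl in Hni. subst i. apply wp_iter_false; [assumption| |].
    + unfold transfer_test. eapply evals_eq.
      * calc ltac:(first [lia | eapply holds_perm; [exact HP|];
          eapply holds_size, array_own; eexists; split; [exact HA|reflexivity]]).
      * reflexivity.
    + eapply Hpost; try eassumption.
      * intros y _. reflexivity.
      * cbn [cost transfer_test]. lia.
  - assert (HF : array k l main D (S n) Vs H2 H).
    { apply array_own. eauto. }
    eapply wp_iter_true with (v := 1); [assumption| |discriminate|].
    { unfold transfer_test. eapply evals_eq.
      - calc ltac:(first [lia | eapply holds_size; exact HF]).
      - reflexivity. }
    unfold room in HX.
    pose proof (array_heap_size _ _ _ _ _ _ _ HB) as HBs.
    then_. set_ main; [calc lia|].
    then_. eapply pop_ok with (k := k) (l := l) (main := main) (D := D) (F := H2);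
      try eassumption; [lia|rd|].
    intros Vs1 e1 H1' a1 Hs1 E2 HA1 Ha1.
    apply array_own in HA1. destruct HA1 as (H3 & HA3 & HP3).
    pose proof (array_heap_size _ _ _ _ _ _ _ HA3) as HAs.
    then_. set_ main'; [calc lia|].
    eapply push_ok with (k := k') (l := l') (main := main') (D := D') (F := H3) (v := D n)
      (N := i) (Vs := Vs'); try eassumption; try rd; try lia.
    { apply array_own. exists H2. split; [assumption|].
      rewrite HP3. apply Permutation_app_comm. }
    intros D2 Vs2 e2 H4 a2 Hs2 HD2 HDi HB2 Ha2.
    apply array_own in HB2. destruct HB2 as (H5 & HB5 & HP5).
    eapply IH with (i := S i) (H1 := H3) (H2 := H5); try eassumption; try rd; try lia.
    + intros x Hx. destruct (Nat.eq_dec x i) as [->|].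
      * rewrite HDi. f_equal. lia.
      * rewrite HD2 by lia. apply HD. lia.
    + rewrite HP5. apply Permutation_app_comm.
    + intros Vs3 Vs4 D4 H6 H7 e' H' a' Hs' HA' HB' HD' HP' Ha'.
      eapply Hpost; try eassumption; [kept|].
      revert Ha1 Ha2 Ha'. cbn [cost transfer_test]. lia.
Qed.

(** One pop and one push cost 1200 per level of their arrays and 1000 each; 200 more cover an
    iteration of the loop. The additional round in [N + 1] pays for [make] and the final steps. *)
Lemma transfer_ok k l k' l' main D N Vs (P : post) e H a :
  admissible k l -> 128 + 8 * 2 ^ S l <= W ->
  admissible k' l' -> 128 + 8 * 2 ^ S l' <= W ->
  k' = l' / (2 * param A (2 ^ l')) ->
  N <= 2 ^ S l' -> N + room k l + room k' l' <= X ->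
  array k l main D N Vs [] H -> e 0 = main -> e 19 = l' ->
  (forall main' Vs' D' e' H' a',
     same (0 :: seq 2 17 ++ [20; 21]) e' e -> e' 0 = main' ->
     array k' l' main' D' N Vs' [] H' ->
     (forall x, x < N -> D' x = D (N - 1 - x)) ->
     a' + 600 * potential k' l' Vs' N <=
       a + 600 * potential k l Vs N +
       (N + 1) * (1200 * (top k l + top k' l') + 2200) ->
     P e' H' a') ->
  wp transfer P e H a.
Proof.
  intros adm HW adm' HW' Hk HN HX HA E0 E19 Hpost. unfold transfer.
  pose proof (array_heap_size _ _ _ _ _ _ _ HA) as HAs.
  then_. set_ main; [calc lia|].
  then_. eapply make_ok with (k := k') (l := l') (D := D); try eassumption; try rd.
  { unfold room in HX. lia. }
  intros main' H1 e1 a1 Hs1 E0' HB Ha1.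
  apply array_own in HB. destruct HB as (H2 & HB & HP).
  then_. set_ main'; [calc lia|].
  then_. apply wp_loop; [assumption|].
  eapply transfer_iter with (k := k) (l := l) (k' := k') (l' := l') (main := main)
    (main' := main') (D := D) (N := N) (n := N) (i := 0) (H1 := H) (H2 := H2);
    try eassumption; try rd; try lia.
  { rewrite HP. apply Permutation_app_comm. }
  intros Vs1 Vs2 D2 H3 H4 e2 H' a2 Hs2 HA2 HB2 HD2 HP2 Ha2.
  destruct (array_empty _ _ _ _ _ _ adm HA2) as [b Hb].
  then_. eapply wp_free with (p := main) (b := b) (F := H4).
  { assumption. }
  { calc lia. }
  { rewrite HP2, Hb. reflexivity. }
  set_ main'; [calc lia|].
  eapply Hpost; try eassumption.
  - kept.
  - rd.
  - revert Ha1 Ha2. rewrite potential_zero. cbn [cost]. lia.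
Qed.

End Steps.

(** * The operations of the implementation *)

Definition create_op (l0 : nat) : cmd := assign 19 (K l0);; make.
Definition length_op : cmd := assign 1 (start_of (K 0)).
Definition get_op : cmd := locate;; assign 1 (G (V 7) (V 9)).
Definition modify_op : cmd := locate;; put (V 7) (V 9) (V 2).
(** Two transfers restore the order of the items. *)
Definition rebuild : cmd := transfer;; transfer.
Definition grow_op : cmd :=
  cond (start_of (K 0) == (K 2 << word 1))
    (assign 23 (V 2);; assign 19 (word 1 + K 1);; rebuild;; assign 2 (V 23)) Skip;;
  push.
(** Admissible widths are available from [l0] on only, so the structure for [l0] is kept down to
    size 0. *)
Definition shrink_op (l0 : nat) : cmd :=
  cond (((K 2 * start_of (K 0)) == (K 1 << word 1)) * (K l0 < word 1))
    (assign 19 (word 1 - K 1);; rebuild) Skip;;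
  pop.

Definition program (l0 : nat) : implementation :=
  Implementation (create_op l0) length_op get_op modify_op grow_op (shrink_op l0).

Definition width (r : nat -> nat) (l : nat) : nat := l / (2 * r (2 ^ l)).

(** * Epochs and the cost of rebuilding *)

Section Epochs.

Variables (r : nat -> nat) (l0 : nat).
Local Notation kw := (width r).
Local Notation tp l := (top (width r l) l).
Hypothesis adm : forall l, l0 <= l -> admissible (kw l) l.

(** The structure built for [l] serves while the size is in
    [2 ^ (l - 1) .. 2 ^ (l + 1)]; the first one also serves below. *)
Definition in_epoch (l N : nat) : Prop :=
  l0 <= l /\ (l = l0 \/ 2 ^ l <= 2 * N) /\ N <= 2 ^ S l.

Definition resting_slack (l : nat) : nat :=
  index_size (kw l) l + size (kw l) l 0.
(** Covers a rebuild in either direction. The factor 2 comes from the second transfer, during which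
    two structures for the new parameter coexist. *)
Definition working_slack (l : nat) : nat :=
  room (kw l) l + 2 * (room (kw (S l)) (S l) + room (kw (Nat.max l0 (l - 1))) (Nat.max l0 (l - 1))).

Lemma room_le l : l0 <= l -> room (kw l) l <= 6 * 2 ^ l.
Proof.
  intros Hl. pose proof (adm l Hl) as Ha. unfold room.
  pose proof (index_size_le_max _ _ Ha).
  pose proof (size_le_max _ _ Ha 0 (Nat.le_0_l _)).
  pose proof (size_le_max _ _ Ha (tp l) (le_n _)).
  pose proof (Nat.pow_succ_r' 2 l). lia.
Qed.

Lemma working_slack_le l : l0 <= l -> working_slack l <= 42 * 2 ^ l.
Proof.
  intros Hl. unfold working_slack. pose proof (room_le l Hl).
  pose proof (room_le (S l) ltac:(lia)).
  pose proof (room_le (Nat.max l0 (l - 1)) ltac:(lia)).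
  assert (2 ^ Nat.max l0 (l - 1) <= 2 ^ l) by (apply Nat.pow_le_mono_r; lia).
  pose proof (Nat.pow_succ_r' 2 l). lia.
Qed.

(** Origin of [kappa]: within an epoch either [l = l0], or [2 ^ l <= 2 * N], so [256 * 2 ^ l0] words
    per item exceed all sizes, positions and budgets that occur. [N'] is the size after the
    operation, possibly smaller by one. *)
Lemma fits_room A l N N' :
  in_epoch l N -> N <= S N' -> fits A (256 * 2 ^ l0) N' ->
  128 + 64 * 2 ^ l <= word_bound A.
Proof.
  intros (H1 & H2 & H3) HN Hf. unfold fits in Hf.
  pose proof (Nat.pow_nonzero 2 l0 ltac:(lia)).
  destruct H2 as [->|H2]; nia.
Qed.

Variable c : nat.
Hypothesis c_pos : 1 <= c.
Hypothesis top_smooth : forall l, l0 <= l -> tp (S l) <= c * tp l /\ tp l <= c * tp (S l).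

(** Zero at [N = 2 ^ l], the size at which a rebuilt structure takes over, and growing in both
    directions. For [l0] the lower side is omitted, as that structure is never replaced by a smaller
    one and starts empty. *)
Definition epoch_credit (l N : nat) : nat :=
  40 * 1000 * c * tp l * ((N - 2 ^ l) + (if l =? l0 then 0 else 2 ^ l - N)).

(** Per level, [40 * 1000 * c] feeds the epoch credit, and 3000 covers 1200 for the potential and
    all constant costs. The outer [c] passes from [l] to the logarithm of [N]. *)
Definition op_time (N : nat) : nat :=
  c * (40 * 1000 * c + 3000) * tp (Nat.max l0 (Nat.log2 N)).

Lemma in_epoch_time l N :
  in_epoch l N -> (40 * 1000 * c + 3000) * tp l <= op_time N.
Proof.
  intros (H1 & H2 & H3). unfold op_time.
  set (m := Nat.max l0 (Nat.log2 N)).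
  assert (Hm : tp l <= c * tp m).
  { assert (Hlog : Nat.log2 N <= S l).
    { rewrite <- (Nat.log2_pow2 (S l)) by lia. now apply Nat.log2_le_mono. }
    assert (Hlog' : l = l0 \/ l <= S (Nat.log2 N)).
    { destruct H2 as [H2|H2]; [now left|right].
      destruct N as [|N]; [pose proof (Nat.pow_nonzero 2 l); lia|].
      rewrite <- Nat.log2_double by lia.
      rewrite <- (Nat.log2_pow2 l) by lia. now apply Nat.log2_le_mono. }
    assert (Hcase : m = l \/ m = S l \/ l = S m) by (unfold m; lia).
    destruct Hcase as [->|[->|Hcase]].
    - nia.
    - apply top_smooth. assumption.
    - rewrite Hcase. apply top_smooth. unfold m. lia. }
  generalize (40 * 1000 * c + 3000). intros w.
  (* The logarithm of [N] and [l] differ by at most one, so smoothness was needed only once. *)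
  apply (Nat.mul_le_mono_l _ _ w) in Hm. eapply Nat.le_trans; [exact Hm|].
  apply Nat.eq_le_incl. ring.
Qed.

Lemma epoch_credit_grow l N :
  epoch_credit l (S N) <= epoch_credit l N + 40 * 1000 * c * tp l.
Proof.
  unfold epoch_credit. rewrite <- Nat.mul_succ_r. apply Nat.mul_le_mono_l.
  destruct (l =? l0); lia.
Qed.

Lemma epoch_credit_shrink l N :
  epoch_credit l N <= epoch_credit l (S N) + 40 * 1000 * c * tp l.
Proof.
  unfold epoch_credit. rewrite <- Nat.mul_succ_r. apply Nat.mul_le_mono_l.
  destruct (l =? l0); lia.
Qed.

Lemma top_ge l : l0 <= l -> 1 <= tp l.
Proof. intros Hl. apply top_pos. now apply adm. Qed.

(** Rebuilding between [l] and [l'] is paid by the credit of the epoch of [l]. *)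
Lemma rebuild_paid l l' N :
  l0 <= l -> 1 <= N -> tp l' <= c * tp l ->
  N <= 2 * ((N - 2 ^ l) + (if l =? l0 then 0 else 2 ^ l - N)) ->
  (N + 1) * (1200 * (tp l + tp l') + 2200) + (N + 1) * (1200 * (tp l' + tp l') + 2200)
  <= epoch_credit l N.
Proof.
  intros Hl HN Hsm HE. unfold epoch_credit.
  set (g := (N - 2 ^ l) + _) in *. clearbody g.
  pose proof (top_ge l Hl) as Ht.
  (* The left side is at most [4800 + 4400] times [c * tp l]. With [N + 1 <= 4 * g] below, this
     gives the factor [40 * 1000] of the credit. *)
  assert (H1 : (1200 * (tp l + tp l') + 2200) + (1200 * (tp l' + tp l') + 2200)
     <= 10 * 1000 * (c * tp l)) by nia.
  assert (H2 : N + 1 <= 4 * g) by lia.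
  rewrite <- Nat.mul_add_distr_l.
  eapply Nat.le_trans; [apply Nat.mul_le_mono; [exact H2|exact H1]|].
  nia.
Qed.

Section Machine.

Variable A : machine.
Hypothesis valid_A : valid_machine A.
Hypothesis param_A : forall N, param A N = r N.
Local Notation W := (word_bound A).

Section Rebuild.

Variable X : nat.
Hypothesis X_lt : X + 1 < W.

Lemma rebuild_ok l l' main D N Vs (P : post) e H a :
  l0 <= l -> l0 <= l' -> 128 + 8 * 2 ^ S l <= W -> 128 + 8 * 2 ^ S l' <= W ->
  N <= 2 ^ S l' -> N + room (kw l) l + 2 * room (kw l') l' <= X ->
  array (kw l) l main D N Vs [] H -> e 0 = main -> e 19 = l' ->
  (forall main' Vs' D' e' H' a',
     same (0 :: seq 2 17 ++ [20; 21]) e' e -> e' 0 = main' ->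
     array (kw l') l' main' D' N Vs' [] H' ->
     (forall x, x < N -> D' x = D x) ->
     a' + 600 * potential (kw l') l' Vs' N <=
       a + 1 + 600 * potential (kw l) l Vs N +
       ((N + 1) * (1200 * (tp l + tp l') + 2200) +
        (N + 1) * (1200 * (tp l' + tp l') + 2200)) ->
     P e' H' a') ->
  wp A X rebuild P e H a.
Proof.
  intros Hl Hl' HW HW' HN HX HA E0 E19 Hpost. unfold rebuild.
  then_. eapply transfer_ok with (k := kw l) (l := l) (k' := kw l') (l' := l');
    try eassumption; try (apply adm; assumption); try lia.
  { now rewrite param_A. }
  intros m1 V1 D1 e1 H1 a1 Hs1 E01 HA1 HD1 Ha1.
  eapply transfer_ok with (k := kw l') (l := l') (k' := kw l') (l' := l');
    try eassumption; try (apply adm; assumption); try lia.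
  { now rewrite param_A. }
  { rd. }
  intros m2 V2 D2 e2 H2 a2 Hs2 E02 HA2 HD2 Ha2.
  eapply Hpost; try eassumption.
  - kept.
  - intros x Hx. rewrite HD2, HD1 by lia. f_equal. lia.
  - lia.
Qed.

End Rebuild.

Lemma holds_epoch k l main D N Vs H :
  array k l main D N Vs [] H -> holds H main 1 l.
Proof.
  intros (lv & b & HS & HT & HP). eapply holds_perm; [exact HP|].
  eapply holds_in; [now left|apply (table_l _ _ _ _ _ _ HT)].
Qed.

Lemma grow_ok l main D N Vs v (P : post) e H :
  in_epoch l N -> 128 + 64 * 2 ^ l <= W ->
  array (kw l) l main D N Vs [] H -> e 0 = main -> e 2 = v ->
  (forall l' Vs' D' e' H' a', in_epoch l' (S N) ->
     array (kw l') l' (e' 0) D' (S N) Vs' [] H' ->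
     (forall x, x < N -> D' x = D x) -> D' N = v ->
     a' + 600 * potential (kw l') l' Vs' (S N) + epoch_credit l' (S N) <=
       600 * potential (kw l) l Vs N + epoch_credit l N + op_time N ->
     P e' H' a') ->
  wp A (N + working_slack l) grow_op P e H 0.
Proof.
  intros Hep HW HA E0 E2 Hpost. unfold grow_op.
  pose proof (in_epoch_time l N Hep) as Htime.
  destruct Hep as (Hl & Hlo & Hhi).
  pose proof (working_slack_le l Hl) as Hws.
  pose proof (top_ge l Hl) as Ht1.
  pose proof (Nat.pow_succ_r' 2 l) as Hpow. pose proof (Nat.pow_succ_r' 2 (S l)) as Hpow2.
  assert (X_lt : N + working_slack l + 1 < W) by lia.
  pose proof (l_lt_max l) as Hlm.
  assert (Hroom : room (kw l) l + 2 * room (kw (S l)) (S l) <= working_slack l)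
    by (unfold working_slack; lia).
  then_. apply wp_cond with (v := if N =? 2 ^ S l then 1 else 0); [assumption| | |].
  { eapply evals_eq.
    - calc ltac:(first [lia | eapply holds_size; eassumption
        | eapply holds_epoch; eassumption | rewrite Nat.mul_comm; lia]).
    - now rewrite Hpow. }
  - destruct (Nat.eqb_spec N (2 ^ S l)) as [HN|]; [|contradiction]. intros _.
    then_. set_ v; [calc lia|].
    then_. set_ (S l).
    { eapply evals_eq; [calc ltac:(first [lia | eapply holds_epoch; eassumption])|]. lia. }
    then_. eapply rebuild_ok with (l := l) (l' := S l); try eassumption; try rd; try lia.
    intros m1 V1 D1 e1 H1 a1 Hs1 E01 HA1 HD1 Ha1.
    set_ v; [calc lia|].
    eapply push_ok with (k := kw (S l)) (l := S l) (D := D1) (F := []) (N := N) (v := v);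
      try eassumption; try rd; try lia.
    { apply adm. lia. }
    { unfold room in Hroom. change (heap_size []) with 0. lia. }
    intros D2 V2 e2 H2 a2 Hs2 HD2 HDN HA2 Ha2.
    pose proof (rebuild_paid l (S l) N Hl ltac:(pose proof (Nat.pow_nonzero 2 (S l)); lia)
      ltac:(apply top_smooth; assumption) ltac:(destruct (l =? l0); lia)) as Hpaid.
    assert (Htime' : (40 * 1000 * c + 3000) * tp (S l) <= op_time N).
    { apply in_epoch_time. unfold in_epoch. lia. }
    (* The new epoch starts at its centre with no credit, so only the contribution of this one
       operation has to be saved. *)
    assert (Hec : epoch_credit (S l) (S N) <= 40 * 1000 * c * tp (S l)).
    { eapply Nat.le_trans; [apply epoch_credit_grow|].
      unfold epoch_credit. rewrite HN.
      replace (2 ^ S l - 2 ^ S l + (if S l =? l0 then 0 else 2 ^ S l - 2 ^ S l)) with 0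
        by (destruct (S l =? l0); lia).
      lia. }
    pose proof (top_ge (S l) ltac:(lia)) as Ht2.
    eapply Hpost with (l' := S l) (D' := D2); try eassumption.
    + unfold in_epoch. lia.
    + replace (e2 0) with m1; [exact HA2|]. symmetry. rd.
    + intros x Hx. rewrite HD2 by assumption. now apply HD1.
    + revert Ha1 Ha2. cbn [cost start_of word]. lia.
  - destruct (Nat.eqb_spec N (2 ^ S l)) as [|HN]; [discriminate|]. intros _.
    apply wp_skip; [assumption|].
    eapply push_ok with (k := kw l) (l := l) (D := D) (F := []) (N := N) (v := v);
      try eassumption; try rd; try lia.
    { apply adm. assumption. }
    { unfold room in Hroom. change (heap_size []) with 0. lia. }
    intros D2 V2 e2 H2 a2 Hs2 HD2 HDN HA2 Ha2.
    pose proof (epoch_credit_grow l N) as Hec.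
    eapply Hpost with (l' := l) (D' := D2); try eassumption.
    + unfold in_epoch. lia.
    + replace (e2 0) with main; [exact HA2|]. symmetry. rd.
    + revert Ha2. cbn [cost start_of word]. lia.
Qed.

Lemma shrink_ok l main D N Vs (P : post) e H :
  in_epoch l (S N) -> 128 + 64 * 2 ^ l <= W ->
  array (kw l) l main D (S N) Vs [] H -> e 0 = main ->
  (forall l' Vs' D' e' H' a', in_epoch l' N ->
     array (kw l') l' (e' 0) D' N Vs' [] H' ->
     (forall x, x < N -> D' x = D x) ->
     a' + 600 * potential (kw l') l' Vs' N + epoch_credit l' N <=
       600 * potential (kw l) l Vs (S N) + epoch_credit l (S N) + op_time (S N) ->
     P e' H' a') ->
  wp A (S N + working_slack l) (shrink_op l0) P e H 0.
Proof.
  intros Hep HW HA E0 Hpost. unfold shrink_op.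
  pose proof (in_epoch_time l (S N) Hep) as Htime.
  destruct Hep as (Hl & Hlo & Hhi).
  pose proof (working_slack_le l Hl) as Hws.
  pose proof (top_ge l Hl) as Ht1.
  pose proof (Nat.pow_succ_r' 2 l) as Hpow.
  assert (X_lt : S N + working_slack l + 1 < W) by lia.
  pose proof (l_lt_max l) as Hlm.
  assert (Hroom : room (kw l) l <= working_slack l) by (unfold working_slack; lia).
  then_. apply wp_cond with
    (v := (if 2 * S N =? 2 ^ l then 1 else 0) * (if l0 <? l then 1 else 0)); [assumption| | |].
  { eapply evals_eq.
    - calc ltac:(first [lia | eapply holds_size; eassumption
        | eapply holds_epoch; eassumption | destruct (_ =? _), (_ <? _); lia]).
    - now rewrite Nat.mul_1_l. }
  - destruct (Nat.eqb_spec (2 * S N) (2 ^ l)) as [HN|]; [|contradiction].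
    destruct (Nat.ltb_spec l0 l) as [Hll|]; [|contradiction]. intros _.
    destruct l as [|l']; [lia|].
    assert (HN' : S N = 2 ^ l') by (rewrite Nat.pow_succ_r' in HN; lia).
    assert (Hslack : working_slack (S l') = room (kw (S l')) (S l') +
      2 * (room (kw (S (S l'))) (S (S l')) + room (kw l') l')).
    { unfold working_slack. now replace (Nat.max l0 (S l' - 1)) with l' by lia. }
    pose proof (Nat.pow_succ_r' 2 l') as Hpow'.
    then_. set_ l'.
    { eapply evals_eq; [calc ltac:(first [lia | eapply holds_epoch; eassumption])|]. lia. }
    eapply rebuild_ok with (l := S l') (l' := l'); try eassumption; try rd; try lia.
    intros m1 V1 D1 e1 H1 a1 Hs1 E01 HA1 HD1 Ha1.
    eapply pop_ok with (k := kw l') (l := l') (D := D1) (F := []) (N := N);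
      try eassumption; try rd; try lia.
    { apply adm. lia. }
    { assert (Hr : room (kw l') l' <= working_slack (S l')) by lia.
      unfold room in Hr. change (heap_size []) with 0. lia. }
    intros V2 e2 H2 a2 Hs2 E22 HA2 Ha2.
    assert (Hsm : tp l' <= c * tp (S l')) by (apply top_smooth; lia).
    (* At half of [2 ^ S l'] the distance to the centre of the epoch equals the size itself. *)
    assert (Hgap : S N <= 2 * ((S N - 2 ^ S l') + (if S l' =? l0 then 0 else 2 ^ S l' - S N))).
    { destruct (Nat.eqb_spec (S l') l0); lia. }
    pose proof (rebuild_paid (S l') l' (S N) Hl ltac:(lia) Hsm Hgap) as Hpaid.
    assert (Htime' : (40 * 1000 * c + 3000) * tp l' <= op_time (S N)).
    { apply in_epoch_time. unfold in_epoch. lia. }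
    assert (Hec : epoch_credit l' N <= 40 * 1000 * c * tp l').
    { eapply Nat.le_trans; [apply epoch_credit_shrink|].
      unfold epoch_credit. rewrite HN'.
      replace (2 ^ l' - 2 ^ l' + (if l' =? l0 then 0 else 2 ^ l' - 2 ^ l')) with 0
        by (destruct (l' =? l0); lia).
      lia. }
    pose proof (top_ge l' ltac:(lia)) as Ht2.
    eapply Hpost with (l' := l') (D' := D1); try eassumption.
    + unfold in_epoch. pose proof (Nat.pow_gt_lin_r 2 l' ltac:(lia)). lia.
    + replace (e2 0) with m1; [exact HA2|]. symmetry. rd.
    + intros x Hx. apply HD1. lia.
    + revert Ha1 Ha2. cbn [cost start_of word]. lia.
  - intros Hc. apply wp_skip; [assumption|].
    eapply pop_ok with (k := kw l) (l := l) (D := D) (F := []) (N := N);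
      try eassumption; try rd; try lia.
    { apply adm. assumption. }
    { unfold room in Hroom. change (heap_size []) with 0. lia. }
    intros V2 e2 H2 a2 Hs2 E22 HA2 Ha2.
    pose proof (epoch_credit_shrink l N) as Hec.
    eapply Hpost with (l' := l) (D' := D); try eassumption.
    + unfold in_epoch. revert Hc.
      destruct (Nat.eqb_spec (2 * S N) (2 ^ l)), (Nat.ltb_spec l0 l); try lia; intros _.
      destruct Hlo as [|Hlo]; [lia|].
      destruct l as [|l']; [lia|]. pose proof (Nat.pow_succ_r' 2 l'). lia.
    + replace (e2 0) with main; [exact HA2|]. symmetry. rd.
    + reflexivity.
    + revert Ha2. cbn [cost start_of word]. lia.
Qed.

End Machine.

End Epochs.

(** * Overwriting one item *)

Section Items.

Variables k l : nat.
Hypothesis adm : admissible k l.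
Local Notation J := (top k l).
Local Notation sz := (size k l).
Local Notation levels := (levels k l).

Lemma blocks_update D s z ps x p i v :
  nth_error ps x = Some p -> s + z * x <= i < s + z * x + z ->
  exists R, Permutation (blocks D s z ps) ((p, slice D (s + z * x) z) :: R) /\
    Permutation (blocks (update D i v) s z ps)
      ((p, slice (update D i v) (s + z * x) z) :: R).
Proof.
  intros Hp Hi. destruct (nth_error_split _ _ Hp) as (ps1 & ps2 & -> & <-).
  exists (blocks D s z ps1 ++ blocks D (s + z * length ps1 + z) z ps2).
  rewrite !blocks_app. cbn [blocks]. split; [perm|].
  rewrite (blocks_ext (update D i v) D s), (blocks_ext (update D i v) D (_ + z)).
  - perm.
  - intros y Hy. rewrite update_other; [reflexivity|lia].
  - intros y Hy. rewrite update_other; [reflexivity|lia].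
Qed.

Lemma flat_map_level_update lv Vs N D i v s n :
  core k l lv Vs N -> s + n <= S J -> (forall j, s <= j < s + n -> i < Vs (S j) \/ Vs j <= i) ->
  flat_map (level k l lv Vs (update D i v)) (seq s n) = flat_map (level k l lv Vs D) (seq s n).
Proof.
  intros HC Hn Hd. rewrite !flat_map_concat_map. f_equal. apply map_ext_in.
  intros j Hj. apply in_seq in Hj. apply blocks_ext. intros y Hy.
  rewrite <- (core_eq _ _ _ _ _ HC j) in Hy by lia.
  specialize (Hd j Hj). rewrite update_other; [reflexivity|lia].
Qed.

(** The same rest [R] serves before and after the change: ranges of different blocks are disjoint,
    so the block [p] alone sees index [i]. *)
Lemma levels_update lv Vs N D j x p i v :
  core k l lv Vs N -> j <= J -> nth_error (lv j) x = Some p ->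
  Vs (S j) + sz j * x <= i < Vs (S j) + sz j * x + sz j ->
  exists R, Permutation (levels lv Vs D) ((p, slice D (Vs (S j) + sz j * x) (sz j)) :: R) /\
    Permutation (levels lv Vs (update D i v))
      ((p, slice (update D i v) (Vs (S j) + sz j * x) (sz j)) :: R).
Proof.
  intros HC Hj Hp Hi.
  destruct (blocks_update D _ _ _ _ _ i v Hp Hi) as (R & HR1 & HR2).
  exists (R ++ flat_map (level k l lv Vs D) (seq 0 j) ++
          flat_map (level k l lv Vs D) (seq (S j) (J - j))).
  assert (HiV : i < Vs j).
  { rewrite (core_eq _ _ _ _ _ HC j Hj).
    assert (Hx : x < length (lv j)) by (apply nth_error_Some; congruence).
    apply (Nat.mul_le_mono_l _ _ (sz j)) in Hx. lia. }
  unfold levels. replace (S J) with (j + S (J - j)) by lia.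
  rewrite seq_app, !flat_map_app. cbn [seq flat_map Nat.add].
  rewrite (flat_map_level_update _ _ _ _ _ _ 0 j HC ltac:(lia)).
  2:{ intros y Hy. left. pose proof (core_mono _ _ _ _ _ (S y) j HC ltac:(lia) ltac:(lia)). lia. }
  rewrite (flat_map_level_update _ _ _ _ _ _ (S j) (J - j) HC ltac:(lia)).
  2:{ intros y Hy. right. pose proof (core_mono _ _ _ _ _ (S j) y HC ltac:(lia) ltac:(lia)). lia. }
  unfold level at 2 5. split.
  - rewrite HR1. perm.
  - rewrite HR2. perm.
Qed.

End Items.

Lemma set_nth_map D n i v :
  i < n -> set_nth (map D (seq 0 n)) i v = map (update D i v) (seq 0 n).
Proof. intros Hi. now apply (set_nth_slice D 0 n i v). Qed.

(** * From the logic to executions *)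

Section Running.

Variables (A : machine).
Local Notation W := (word_bound A).

Lemma wp_run X c P e H a m t :
  wp A X c P e H a -> fits_word A e -> represents A m H -> heap_size H <= X ->
  exists n c', halts_in A (Config [c] e m t) n c' /\
    (forall i c'', steps A i (Config [c] e m t) = Some c'' -> space A (mem c'') <= X) /\
    exists e2 H2, agree (regs c') e2 /\ represents A (mem c') H2 /\ heap_size H2 <= X /\
      P e2 H2 (a + n).
Proof.
  intros Hw Hb HR HX.
  destruct (Hw e m t [] ltac:(intros x Hx; reflexivity) Hb HR HX)
    as (n & e1 & m1 & e2 & H2 & [R1 R2] & A1 & B1 & M1 & S1 & HP).
  exists n, (Config [] e1 m1 (t + n)). split; [split; [exact R1|reflexivity]|].
  split; [|exists e2, H2; auto].
  (* With an empty continuation the machine halts after [n] steps, so no configuration exists beyond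
     and the space bound covers all of them. *)
  intros i c'' Hi. destruct (Nat.le_gt_cases i n) as [Hle|Hgt]; [eauto|].
  exfalso. replace i with (n + S (i - n - 1)) in Hi by lia.
  rewrite steps_add, R1 in Hi. discriminate.
Qed.

(** Execution is deterministic; hence what the logic shows of some halting run applies to the run
    recorded in a history. *)
Lemma halts_unique c n1 c1 n2 c2 :
  halts_in A c n1 c1 -> halts_in A c n2 c2 -> n1 = n2 /\ c1 = c2.
Proof.
  assert (Hle : forall n1 c1 n2 c2, halts_in A c n1 c1 -> halts_in A c n2 c2 -> n2 <= n1).
  { intros n1' c1' n2' c2' [H1 H1'] [H2 H2'].
    destruct (Nat.le_gt_cases n2' n1') as [|Hgt]; [assumption|exfalso].
    replace n2' with (n1' + S (n2' - n1' - 1)) in H2 by lia.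
    rewrite steps_add, H1 in H2. destruct c1' as [k1 ? ? ?]. simpl in H1'. subst k1.
    discriminate. }
  intros H1 H2. assert (n1 = n2) as <- by (apply Nat.le_antisymm; eauto).
  split; [reflexivity|]. destruct H1 as [H1 _], H2 as [H2 _]. congruence.
Qed.

Lemma fits_word_entry main i x : main < W -> i < W -> x < W -> fits_word A (entry main i x).
Proof.
  intros H1 H2 H3 [|[|[|y]]]; simpl; try assumption. lia.
Qed.

End Running.

(** * The invariant of histories *)

Section History.

Variables (r : nat -> nat) (l0 c : nat).
Local Notation kw := (width r).
Local Notation tp l := (top (width r l) l).
Hypothesis adm : forall l, l0 <= l -> admissible (kw l) l.
Hypothesis c_pos : 1 <= c.
Hypothesis top_smooth : forall l, l0 <= l -> tp (S l) <= c * tp l /\ tp l <= c * tp (S l).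
Local Notation kappa := (256 * 2 ^ l0).

Variable A : machine.
Hypothesis valid_A : valid_machine A.
Hypothesis param_A : forall N, param A N = r N.
Local Notation W := (word_bound A).

(** The last clause is the potential method: time spent and reserves together never exceed the times
    allotted to the operations so far. *)
Definition invariant (xs : list nat) (cf : config) (h : list (nat * nat)) : Prop :=
  exists l D Vs H, in_epoch l0 l (length xs) /\
    array (kw l) l (regs cf 0) D (length xs) Vs [] H /\
    represents A (mem cf) H /\ xs = map D (seq 0 (length xs)) /\
    list_sum (map snd h) + 600 * potential (kw l) l Vs (length xs) +
      epoch_credit r l0 c l (length xs) <=
    list_sum (map (fun p => op_time r l0 c (fst p)) h).

Lemma array_main_lt k l main D N Vs H m :
  array k l main D N Vs [] H -> represents A m H -> main < W.
Proof.
  intros (lv & b & HS & HT & HP) HR. apply (represents_perm _ _ _ _ HP) in HR.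
  apply (rep_range _ _ _ HR main). now left.
Qed.

Lemma create_spec :
  fits A kappa 0 ->
  exists n cf, halts_in A (initial (program l0)) n cf /\ invariant [] cf [] /\
    forall i c', steps A i (initial (program l0)) = Some c' ->
      space A (mem c') <= resting_slack r l0.
Proof.
  intros Hf. unfold fits in Hf.
  pose proof (Nat.pow_nonzero 2 l0 ltac:(lia)).
  assert (HW : 128 + 64 * 2 ^ l0 <= W) by lia.
  pose proof (adm l0 (le_n _)) as Ha.
  pose proof (room_le r l0 adm l0 (le_n _)) as Hroom. unfold room in Hroom.
  assert (X_lt : resting_slack r l0 + 1 < W) by (unfold resting_slack; lia).
  pose proof (Nat.pow_succ_r' 2 l0). pose proof (l_lt_max l0).
  assert (Hw : wp A (resting_slack r l0) (create_op l0)
    (fun e' H' a' => exists D, array (kw l0) l0 (e' 0) D 0 (fun _ => 0) [] H')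
    (entry 0 0 0) [] 0).
  { unfold create_op. then_. set_ l0; [calc lia|].
    eapply make_ok with (k := kw l0) (l := l0) (D := fun _ => 0); try eassumption; try rd.
    - lia.
    - now rewrite param_A.
    - unfold resting_slack. change (heap_size []) with 0. lia.
    - intros main H' e' a' _ <- HA' _. eauto. }
  assert (HR : represents A (fun _ => None) []).
  { split.
    - constructor.
    - intros p [].
    - intros p b. split; [discriminate|intros []].
    - intros p b []. }
  destruct (wp_run A _ _ _ _ _ _ _ 0 Hw ltac:(apply fits_word_entry; lia) HR (Nat.le_0_l _))
    as (n & cf & Hh & Hsp & e2 & H2 & Hag & HR2 & _ & D & HA2).
  exists n, cf. split; [exact Hh|]. split; [|exact Hsp].
  exists l0, D, (fun _ => 0), H2. simpl length.
  rewrite (Hag 0) by (unfold temps; lia).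
  split; [unfold in_epoch; lia|]. split; [exact HA2|]. split; [exact HR2|].
  split; [reflexivity|].
  rewrite potential_zero. unfold epoch_credit. rewrite Nat.eqb_refl.
  replace (0 - 2 ^ l0 + 0) with 0 by lia. rewrite !Nat.mul_0_r. apply le_n.
Qed.

Lemma operation_spec xs cf h o :
  invariant xs cf h -> allowed A o xs -> fits A kappa (length (apply o xs)) ->
  exists n cf', halts_in A (call (program l0) o cf) n cf' /\ returns cf' (answer o xs) /\
    invariant (apply o xs) cf' (if resizes o then (length xs, n) :: h else h) /\
    (resizes o = false -> n <= 1000) /\
    exists l, in_epoch l0 l (length xs) /\
      forall i c', steps A i (call (program l0) o cf) = Some c' ->
        space A (mem c') <= length xs +
          (if resizes o then working_slack r l0 l else resting_slack r l).
Proof.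
  intros (l & D & Vs & H & Hep & HA & HR & Hxs & Ham) Hal Hf.
  set (N := length xs) in *.
  assert (HW : 128 + 64 * 2 ^ l <= W).
  (* The word size is known to fit the size after the operation, which is at least [N - 1]. *)
  { apply (fits_room l0 A l N (length (apply o xs)) Hep); [|exact Hf].
    destruct o; cbn [apply]; unfold N; rewrite ?length_app, ?length_map; simpl; try lia.
    - destruct Hal. rewrite set_nth_length; lia.
    - rewrite removelast_firstn_len, length_firstn. lia. }
  pose proof (array_main_lt _ _ _ _ _ _ _ _ HA HR) as Hmain.
  destruct Hep as (Hl & Hlo & Hhi) eqn:Eep; clear Eep.
  pose proof (adm l Hl) as Ha.
  pose proof (array_heap_size _ _ _ _ _ _ _ HA) as Hsize.
  pose proof (room_le r l0 adm l Hl) as Hroom. unfold room in Hroom.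
  pose proof (Nat.pow_succ_r' 2 l) as Hpow.
  assert (X_lt : N + resting_slack r l + 1 < W) by (unfold resting_slack; lia).
  assert (Hsize' : heap_size H <= N + resting_slack r l)
    by (unfold resting_slack; lia).
  assert (W_ge : 128 + 8 * 2 ^ S l <= W) by lia.
  assert (HNW : N < W) by lia.
  assert (Hworking : heap_size H <= N + working_slack r l0 l).
  { unfold working_slack, room. lia. }
  assert (E0 : forall i x, entry (regs cf 0) i x 0 = regs cf 0) by reflexivity.
  assert (E1 : forall i x, entry (regs cf 0) i x 1 = i) by reflexivity.
  assert (E2 : forall i x, entry (regs cf 0) i x 2 = x) by reflexivity.
  destruct o as [|i|i v|v|]; cbn [allowed apply answer resizes] in *.
  - set (Pst := fun (e' : reg -> nat) (H' : heap) (a' : nat) =>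
      e' 0 = regs cf 0 /\ e' 1 = N /\ H' = H /\ a' <= 1000).
    assert (Hw : wp A (N + resting_slack r l) length_op Pst (entry (regs cf 0) 0 0) H 0).
    { specialize (E0 0 0). unfold length_op. set_ N.
      - calc ltac:(first [lia | eapply holds_size; eassumption]).
      - unfold Pst. repeat split; try rd. cbn [cost start_of]. lia. }
    destruct (wp_run A _ _ _ _ _ _ _ (clock cf) Hw
      ltac:(apply fits_word_entry; lia) HR Hsize')
      as (n & cf' & Hh & Hsp & e2 & H2 & Hag & HR2 & _ & F0 & F1 & -> & Hn).
    exists n, cf'. split; [exact Hh|].
    split; [simpl; rewrite (Hag 1) by (unfold temps; lia); exact F1|].
    split; [|split; [intros _; lia|exists l; split; [repeat split; assumption|exact Hsp]]].
    exists l, D, Vs, H. rewrite (Hag 0), F0 by (unfold temps; lia).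
    split; [|split; [|split; [|split]]]; try assumption.
  - destruct HA as (lv & b & HS & HT & HP). rewrite app_nil_r in HP.
    set (Pst := fun (e' : reg -> nat) (H' : heap) (a' : nat) =>
      e' 0 = regs cf 0 /\ e' 1 = D i /\ H' = H /\ a' <= 1000).
    assert (Hw : wp A (N + resting_slack r l) get_op Pst (entry (regs cf 0) i 0) H 0).
    { specialize (E0 i 0). specialize (E1 i 0). unfold get_op. then_.
      eapply locate_ok with (k := kw l) (l := l) (N := N) (i := i); try eassumption; try rd.
      intros e' a' j x p Hs Hj Hp Hi E7 E9 Ha'.
      destruct (levels_update _ _ _ _ _ D _ _ _ _ 0 (shape_core _ _ _ _ _ _ _ HS) Hj Hp Hi)
        as (R & HR1 & _).
      set_ (D i).
      - calc ltac:(first [lia | eapply holds_perm; [rewrite HP, HR1; reflexivity|];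
          eapply holds_in; [right; left; reflexivity|]]).
        rewrite nth_error_slice by lia. do 2 f_equal. lia.
      - unfold Pst. repeat split; try rd. cbn [cost]. lia. }
    destruct (wp_run A _ _ _ _ _ _ _ (clock cf) Hw
      ltac:(apply fits_word_entry; lia) HR Hsize')
      as (n & cf' & Hh & Hsp & e2 & H2 & Hag & HR2 & _ & F0 & F1 & -> & Hn).
    exists n, cf'. split; [exact Hh|].
    split.
    { rewrite Hxs. change (map D (seq 0 N)) with (slice D 0 N).
      rewrite nth_error_slice by assumption. simpl.
      rewrite (Hag 1) by (unfold temps; lia). exact F1. }
    split; [|split; [intros _; lia|exists l; split; [repeat split; assumption|exact Hsp]]].
    exists l, D, Vs, H. rewrite (Hag 0), F0 by (unfold temps; lia).
    split; [|split; [|split; [|split]]]; try assumption.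
    exists lv, b. rewrite app_nil_r. auto.
  - destruct Hal as [Hi Hv]. destruct HA as (lv & b & HS & HT & HP). rewrite app_nil_r in HP.
    set (Pst := fun (e' : reg -> nat) (H' : heap) (a' : nat) =>
      e' 0 = regs cf 0 /\ array (kw l) l (regs cf 0) (update D i v) N Vs [] H' /\ a' <= 1000).
    assert (Hw : wp A (N + resting_slack r l) modify_op Pst (entry (regs cf 0) i v) H 0).
    { specialize (E0 i v). specialize (E1 i v). specialize (E2 i v). unfold modify_op. then_.
      eapply locate_ok with (k := kw l) (l := l) (N := N) (i := i); try eassumption; try rd.
      intros e' a' j x p Hs Hj Hp Hix E7 E9 Ha'.
      destruct (levels_update _ _ _ _ _ D _ _ _ _ v (shape_core _ _ _ _ _ _ _ HS) Hj Hp Hix)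
        as (R & HR1 & HR2).
      eapply wp_put with (p := p) (v := v) (F := (regs cf 0, b) :: R);
        [assumption|calc lia|calc lia|calc lia| | |].
      { rewrite HP, HR1. apply perm_swap. }
      { rewrite slice_length. lia. }
      unfold Pst. split; [rd|]. split; [|cbn [cost]; lia].
      exists lv, b. split; [exact HS|split; [exact HT|]]. rewrite app_nil_r.
      rewrite set_nth_slice by lia.
      replace (Vs (S j) + size (kw l) l j * x + (i - (Vs (S j) + size (kw l) l j * x)))
        with i by lia.
      rewrite HR2. apply perm_swap. }
    destruct (wp_run A _ _ _ _ _ _ _ (clock cf) Hw
      ltac:(apply fits_word_entry; lia) HR Hsize')
      as (n & cf' & Hh & Hsp & e2 & H2 & Hag & HR2 & _ & F0 & HA2 & Hn).
    exists n, cf'. split; [exact Hh|]. split; [exact I|].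
    split; [|split; [intros _; lia|exists l; split; [repeat split; assumption|exact Hsp]]].
    assert (HN : length (set_nth xs i v) = N) by (apply set_nth_length; assumption).
    exists l, (update D i v), Vs, H2. rewrite HN, (Hag 0), F0 by (unfold temps; lia).
    split; [|split; [|split; [|split]]]; try assumption.
    rewrite Hxs at 1. now apply set_nth_map.
  - set (Pst := fun (e' : reg -> nat) (H' : heap) (a' : nat) =>
      exists l' Vs' D', in_epoch l0 l' (S N) /\
      array (kw l') l' (e' 0) D' (S N) Vs' [] H' /\
      (forall x, x < N -> D' x = D x) /\ D' N = v /\
      a' + 600 * potential (kw l') l' Vs' (S N) + epoch_credit r l0 c l' (S N) <=
        600 * potential (kw l) l Vs N + epoch_credit r l0 c l N + op_time r l0 c N).
    assert (Hw : wp A (N + working_slack r l0 l) grow_op Pst (entry (regs cf 0) 0 v) H 0).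
    { eapply grow_ok with (c := c) (D := D) (Vs := Vs); try eassumption; try reflexivity.
      intros l' Vs' D' e' H' a' H1 H2 H3 H4 H5. exists l', Vs', D'. auto. }
    destruct (wp_run A _ _ _ _ _ _ _ (clock cf) Hw
      ltac:(apply fits_word_entry; lia) HR Hworking)
      as (n & cf' & Hh & Hsp & e2 & H2 & Hag & HR2 & _ &
          l' & Vs' & D' & Hep' & HA' & HD & HDN & Hn).
    exists n, cf'. split; [exact Hh|]. split; [exact I|].
    split; [|split; [discriminate|exists l; split; [repeat split; assumption|exact Hsp]]].
    exists l', D', Vs', H2. rewrite length_app, (Hag 0) by (unfold temps; lia).
    cbn [length]. replace (length xs + 1) with (S N) by (unfold N; lia).
    split; [exact Hep'|]. split; [exact HA'|]. split; [exact HR2|]. split.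
    + rewrite seq_S, map_app. cbn [map Nat.add]. rewrite HDN. f_equal.
      rewrite Hxs at 1. apply map_ext_in. intros x Hx. apply in_seq in Hx.
      symmetry. apply HD. lia.
    + cbn [map list_sum fold_right fst snd]. unfold list_sum in *. simpl in Hn. lia.
  - assert (HNl : length xs = N) by reflexivity. clearbody N.
    destruct N as [|M]; [lia|].
    set (Pst := fun (e' : reg -> nat) (H' : heap) (a' : nat) =>
      exists l' Vs' D', in_epoch l0 l' M /\
      array (kw l') l' (e' 0) D' M Vs' [] H' /\
      (forall x, x < M -> D' x = D x) /\
      a' + 600 * potential (kw l') l' Vs' M + epoch_credit r l0 c l' M <=
        600 * potential (kw l) l Vs (S M) + epoch_credit r l0 c l (S M) + op_time r l0 c (S M)).
    assert (Hw : wp A (S M + working_slack r l0 l) (shrink_op l0) Pst (entry (regs cf 0) 0 0) H 0).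
    { eapply shrink_ok with (c := c) (D := D) (Vs := Vs); try eassumption; try reflexivity.
      intros l' Vs' D' e' H' a' H1 H2 H3 H4. exists l', Vs', D'. auto. }
    destruct (wp_run A _ _ _ _ _ _ _ (clock cf) Hw
      ltac:(apply fits_word_entry; lia) HR Hworking)
      as (n & cf' & Hh & Hsp & e2 & H2 & Hag & HR2 & _ &
          l' & Vs' & D' & Hep' & HA' & HD & Hn).
    exists n, cf'. split; [exact Hh|]. split; [exact I|].
    split; [|split; [discriminate|exists l; split; [repeat split; assumption|exact Hsp]]].
    assert (Hrl : removelast xs = map D' (seq 0 M)).
    { rewrite Hxs, seq_S, map_app. cbn [map Nat.add]. rewrite removelast_last.
      apply map_ext_in. intros x Hx. apply in_seq in Hx. symmetry. apply HD. lia. }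
    exists l', D', Vs', H2. rewrite Hrl, length_map, length_seq, (Hag 0) by (unfold temps; lia).
    split; [exact Hep'|]. split; [exact HA'|]. split; [exact HR2|]. split; [reflexivity|].
    cbn [map list_sum fold_right fst snd]. unfold list_sum in *. simpl in Hn. lia.
Qed.

Lemma history_invariant xs cf h : history A (program l0) kappa xs cf h -> invariant xs cf h.
Proof.
  induction 1 as [n cf Hf Hh|xs cf h o n cf' Hhist IH Hal Hf Hh].
  - destruct (create_spec Hf) as (n' & cf' & Hh' & Hinv & _).
    destruct (halts_unique A _ _ _ _ _ Hh Hh') as [_ ->]. exact Hinv.
  - destruct (operation_spec _ _ _ _ IH Hal Hf) as (n' & cf2 & Hh' & _ & Hinv & _).
    destruct (halts_unique A _ _ _ _ _ Hh Hh') as [-> ->]. exact Hinv.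
Qed.

Lemma program_correct : correct A (program l0) kappa.
Proof.
  split.
  - intros Hf. destruct (create_spec Hf) as (n & cf & Hh & _). eauto.
  - intros xs cf h o Hhist Hal Hf.
    destruct (operation_spec _ _ _ _ (history_invariant _ _ _ Hhist) Hal Hf)
      as (n & cf' & Hh & Hret & _). eauto.
Qed.

(** There is a single level of indirection: the index block itself contains the address of every
    data block. *)
Lemma program_pointed xs cf h :
  history A (program l0) kappa xs cf h -> all_pointed (regs cf 0) (mem cf).
Proof.
  intros Hhist.
  destruct (history_invariant _ _ _ Hhist) as (l & D & Vs & H & Hep & HA & HR & _).
  destruct HA as (lv & b & HS & HT & HP). rewrite app_nil_r in HP.
  apply (represents_perm _ _ _ _ HP) in HR.
  assert (Hb : mem cf (regs cf 0) = Some b).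
  { apply (rep_iff _ _ _ HR). now left. }
  split; [eauto|]. intros p b' Hp. apply (rep_iff _ _ _ HR) in Hp.
  destruct Hp as [[= <- <-]|Hp]; [now left|right].
  exists (regs cf 0), b. split; [exact Hb|].
  unfold levels in Hp. apply in_flat_map in Hp. destruct Hp as (j & Hj & Hp).
  apply in_seq in Hj. apply (in_map fst) in Hp. unfold level in Hp.
  rewrite blocks_fst in Hp. simpl in Hp. apply In_nth_error in Hp.
  destruct Hp as [x Hx]. apply nth_error_In with (slot (kw l) l j + x).
  rewrite (table_slot _ _ _ _ _ _ HT) by (lia || (apply nth_error_Some; congruence)).
  exact Hx.
Qed.

Lemma program_resting_space xs cf h :
  history A (program l0) kappa xs cf h ->
  exists l, in_epoch l0 l (length xs) /\ space A (mem cf) <= length xs + resting_slack r l.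
Proof.
  intros Hhist.
  destruct (history_invariant _ _ _ Hhist) as (l & D & Vs & H & Hep & HA & HR & _).
  exists l. split; [exact Hep|]. rewrite (represents_space _ _ _ HR).
  pose proof (array_heap_size _ _ _ _ _ _ _ HA). unfold resting_slack. lia.
Qed.

Lemma program_time xs cf h :
  history A (program l0) kappa xs cf h ->
  list_sum (map snd h) <= list_sum (map (fun p => op_time r l0 c (fst p)) h).
Proof.
  intros Hhist.
  destruct (history_invariant _ _ _ Hhist) as (l & D & Vs & H & _ & _ & _ & _ & Ham). lia.
Qed.

End History.

(** * Growth of the two bounds and of the parameter *)

Local Open Scope R_scope.

Lemma ln_le x y : 0 < x -> x <= y -> ln x <= ln y.
Proof.
  intros Hx [Hxy| ->]; [|apply Rle_refl]. left. now apply ln_increasing.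
Qed.

Section Growth.

Variable r : nat -> nat.
Hypothesis hr : exists N0 : nat, forall N : nat, (N0 <= N)%nat ->
  (2 <= r N)%nat /\
  INR (r N) <= 1 / 2 * (log2 (INR N) / log2 (log2 (INR N))).
Local Notation root := (root_r r).
Local Notation coroot := (coroot_r r).

Lemma ln2_pos : 0 < ln 2.
Proof. rewrite <- ln_1. apply ln_increasing; lra. Qed.

Lemma root_pos N : 0 < root N.
Proof. apply exp_pos. Qed.

Lemma coroot_pos N : 0 < coroot N.
Proof. apply exp_pos. Qed.

Lemma coroot_root N : (0 < N)%nat -> coroot N * root N = INR N.
Proof.
  intros HN. unfold coroot_r, root_r. rewrite <- Rpower_plus.
  replace (1 - 1 / INR (r N) + 1 / INR (r N)) with 1 by ring.
  apply Rpower_1. now apply lt_0_INR.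
Qed.

Lemma ln_root N : ln (root N) = ln (INR N) / INR (r N).
Proof. unfold root_r, Rpower. rewrite ln_exp. unfold Rdiv. ring. Qed.

Lemma log2_ge m N : (2 ^ m <= N)%nat -> INR m <= log2 (INR N).
Proof.
  intros HN. unfold log2. apply Rmult_le_reg_r with (ln 2); [apply ln2_pos|].
  replace (ln (INR N) / ln 2 * ln 2) with (ln (INR N))
    by (field; pose proof ln2_pos; lra).
  rewrite <- ln_pow by lra. apply ln_le; [apply pow_lt; lra|].
  apply le_INR in HN. now rewrite pow_INR in HN.
Qed.

(** With [L = log2 N] one has [ln (root N) = L * ln 2 / r], and [r <= L / (2 * log2 L)] turns this
    into at least [2 * ln L]. In other words, [root N >= L^2]. *)
Lemma ln_log2_root : exists N1 : nat, forall N : nat, (N1 <= N)%nat ->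
  (2 <= r N)%nat /\ 2 * ln (log2 (INR N)) <= ln (root N).
Proof.
  destruct hr as [N0 HN0]. exists (Nat.max N0 4). intros N HN.
  destruct (HN0 N ltac:(lia)) as [H2 HrN]. split; [assumption|].
  pose proof ln2_pos as Hl2.
  set (L := log2 (INR N)) in *.
  assert (HL : 2 <= L).
  { replace 2 with (INR 2) by (simpl; lra). apply log2_ge. simpl. lia. }
  assert (HlL : ln 2 <= ln L) by (apply ln_le; lra).
  assert (Hr0 : 0 < INR (r N)) by (apply lt_0_INR; lia).
  rewrite ln_root.
  replace (ln (INR N)) with (L * ln 2) by (unfold L, log2; field; lra).
  apply Rmult_le_reg_r with (INR (r N)); [assumption|].
  replace (L * ln 2 / INR (r N) * INR (r N)) with (L * ln 2) by (field; lra).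
  apply Rmult_le_compat_l with (r := 2 * ln L) in HrN; [|lra].
  eapply Rle_trans; [exact HrN|]. unfold log2 at 1. apply Req_le. field. lra.
Qed.

Lemma root_unbounded (B : R) : exists N1 : nat, forall N : nat, (N1 <= N)%nat ->
  B <= ln (root N).
Proof.
  destruct ln_log2_root as [N1 HN1].
  destruct (INR_unbounded (exp (Rabs B))) as [m Hm].
  exists (Nat.max N1 (2 ^ m)). intros N HN.
  destruct (HN1 N ltac:(lia)) as [_ HB].
  pose proof (log2_ge m N ltac:(lia)) as HL.
  assert (HA : Rabs B <= ln (log2 (INR N))).
  { rewrite <- (ln_exp (Rabs B)). apply ln_le; [apply exp_pos|lra]. }
  pose proof (Rle_abs B). pose proof (Rabs_pos B). lra.
Qed.

Lemma root_gt (B : R) : exists N1 : nat, forall N : nat, (N1 <= N)%nat -> B <= root N.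
Proof.
  destruct (root_unbounded (Rabs B)) as [N1 HN1]. exists N1. intros N HN.
  specialize (HN1 N HN). pose proof (root_pos N) as Hp.
  rewrite <- (exp_ln (root N)) by assumption.
  eapply Rle_trans; [|apply exp_ineq1_le]. pose proof (Rle_abs B). lra.
Qed.

Lemma root_le_coroot : exists N1 : nat, forall N : nat, (N1 <= N)%nat -> root N <= coroot N.
Proof.
  destruct hr as [N0 HN0]. exists (Nat.max N0 1). intros N HN.
  destruct (HN0 N ltac:(lia)) as [H2 _]. unfold root_r, coroot_r.
  apply Rle_Rpower.
  - replace 1 with (INR 1) by reflexivity. apply le_INR. lia.
  - apply le_INR in H2. simpl in H2.
    assert (1 / INR (r N) <= 1 / 2); [|lra].
    unfold Rdiv. rewrite !Rmult_1_l. apply Rinv_le_contravar; lra.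
Qed.

(** A function within a constant of a nondecreasing one that tends to infinity
    is nondecreasing up to a constant. *)
Lemma almost_nondecreasing (f f0 : nat -> R) :
  (forall B, exists N1 : nat, forall N : nat, (N1 <= N)%nat -> B <= f N) ->
  nondecreasing f0 -> bigTheta f0 f ->
  exists (C : R) (N1 : nat), 1 <= C /\
    (forall N, (N1 <= N)%nat -> f N <= C * f0 N) /\
    (forall N, (N1 <= N)%nat -> f0 N <= C * f N).
Proof.
  intros Hinf Hmono [(C1 & M1 & H1) (C2 & M2 & H2)].
  set (C := Rmax 1 (Rmax C1 C2)).
  assert (HC1 : 1 <= C) by apply Rmax_l.
  assert (HC2 : C1 <= C) by (eapply Rle_trans; [apply Rmax_l|apply Rmax_r]).
  assert (HC3 : C2 <= C) by (eapply Rle_trans; [apply Rmax_r|apply Rmax_r]).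
  destruct (Hinf (C * Rabs (f0 0%nat) + 1)) as [M3 H3].
  exists C, (Nat.max (Nat.max M1 M2) M3). split; [assumption|].
  assert (Hpos : forall N, (Nat.max (Nat.max M1 M2) M3 <= N)%nat -> 0 < f N /\ 0 <= f0 N).
  { intros N HN. specialize (H3 N ltac:(lia)). specialize (H2 N ltac:(lia)).
    pose proof (Rabs_pos (f0 0%nat)) as Ha.
    assert (Hf : 0 < f N) by nra.
    split; [assumption|]. destruct (Rle_lt_dec 0 (f0 N)) as [|Hneg]; [assumption|].
    exfalso. rewrite (Rabs_left (f0 N)), (Rabs_pos_eq (f N)) in H2 by lra.
    pose proof (Hmono 0%nat N ltac:(lia)) as Hm.
    assert (f0 0%nat < 0) by lra. rewrite (Rabs_left (f0 0%nat)) in H3 by assumption.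
    assert (C2 * - f0 N <= C * - f0 0%nat) by nra. lra. }
  split; intros N HN; destruct (Hpos N HN) as [Hf Hf0].
  - specialize (H2 N ltac:(lia)).
    rewrite !Rabs_pos_eq in H2 by lra. nra.
  - specialize (H1 N ltac:(lia)).
    rewrite !Rabs_pos_eq in H1 by lra. nra.
Qed.

Lemma coroot_gt (B : R) : exists N1 : nat, forall N : nat, (N1 <= N)%nat -> B <= coroot N.
Proof.
  destruct (root_gt B) as [N1 H1]. destruct root_le_coroot as [N2 H2].
  exists (Nat.max N1 N2). intros N HN.
  apply Rle_trans with (root N); [apply H1; lia|apply H2; lia].
Qed.

Hypothesis hs : exists s0 : nat -> R, nondecreasing s0 /\ bigTheta s0 root.
Hypothesis ht : exists t0 : nat -> R, nondecreasing t0 /\ bigTheta t0 coroot.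

Lemma growth_monotone (f f0 : nat -> R) C N1 :
  nondecreasing f0 -> 1 <= C ->
  (forall N, (N1 <= N)%nat -> f N <= C * f0 N) ->
  (forall N, (N1 <= N)%nat -> f0 N <= C * f N) ->
  forall M N, (N1 <= M)%nat -> (M <= N)%nat -> f M <= C * C * f N.
Proof.
  intros Hmono HC H1 H2 M N HM HMN.
  specialize (H1 M HM). specialize (H2 N ltac:(lia)). pose proof (Hmono M N HMN). nra.
Qed.

(** Both functions are nondecreasing up to a constant and their product is [N]. When [N] grows at
    most eightfold, neither factor can therefore grow by more than a constant. Eight is the ratio
    reached by the point at which the final bounds are evaluated. *)
Lemma root_coroot_smooth : exists (C : R) (N1 : nat), 1 <= C /\
  forall M N, (N1 <= M)%nat -> (M <= N)%nat -> (N <= 8 * M)%nat ->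
    root M <= C * root N /\ root N <= C * root M /\ coroot N <= C * coroot M.
Proof.
  destruct hs as (s0 & Hs1 & Hs2). destruct ht as (t0 & Ht1 & Ht2).
  destruct (almost_nondecreasing _ _ root_gt Hs1 Hs2) as (C1 & M1 & HC1 & U1 & L1).
  destruct (almost_nondecreasing _ _ coroot_gt Ht1 Ht2) as (C2 & M2 & HC2 & U2 & L2).
  set (D1 := C1 * C1). set (D2 := C2 * C2).
  assert (HD1 : 1 <= D1) by (unfold D1; nra). assert (HD2 : 1 <= D2) by (unfold D2; nra).
  exists (8 * (D1 + D2)), (S (Nat.max M1 M2)). split; [lra|].
  intros M N HM HMN HN.
  pose proof (growth_monotone _ _ _ _ Hs1 HC1 U1 L1 M N ltac:(lia) HMN) as R1.
  pose proof (growth_monotone _ _ _ _ Ht1 HC2 U2 L2 M N ltac:(lia) HMN) as R2.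
  fold D1 in R1. fold D2 in R2.
  pose proof (root_pos M). pose proof (root_pos N).
  pose proof (coroot_pos M). pose proof (coroot_pos N).
  pose proof (coroot_root M ltac:(lia)) as EM. pose proof (coroot_root N ltac:(lia)) as EN.
  apply le_INR in HN. rewrite mult_INR in HN. replace (INR 8) with 8 in HN by (simpl; lra).
  split; [nra|split].
  - apply Rle_trans with (8 * D2 * root M); [|nra].
    apply Rmult_le_reg_l with (coroot N); [assumption|].
    rewrite EN. eapply Rle_trans; [exact HN|]. rewrite <- EM.
    replace (coroot N * (8 * D2 * root M)) with (8 * ((D2 * coroot N) * root M)) by ring.
    apply Rmult_le_compat_l; [lra|]. apply Rmult_le_compat_r; lra.
  - apply Rle_trans with (8 * D1 * coroot M); [|nra].
    apply Rmult_le_reg_r with (root N); [assumption|].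
    rewrite EN. eapply Rle_trans; [exact HN|]. rewrite <- EM.
    replace (8 * D1 * coroot M * root N) with (8 * (coroot M * (D1 * root N))) by ring.
    apply Rmult_le_compat_l; [lra|]. apply Rmult_le_compat_l; lra.
Qed.

(** [r] is the quotient of [ln N] and [ln (root N)]. The first at most doubles, since
    [N <= 8 * M <= M^2]; the second changes by at most [ln C], which is below half of it once [root]
    is large. *)
Lemma param_smooth : exists N1 : nat, forall M N, (N1 <= M)%nat -> (M <= N)%nat ->
  (N <= 8 * M)%nat -> (r N <= 4 * r M)%nat /\ (r M <= 4 * r N)%nat.
Proof.
  destruct root_coroot_smooth as (C & M1 & HC & Hsm).
  destruct (root_unbounded (2 * ln C + 1)) as [M2 HM2].
  destruct ln_log2_root as [M3 HM3].
  exists (Nat.max 8 (Nat.max M1 (Nat.max M2 M3))). intros M N HM HMN HN.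
  destruct (Hsm M N ltac:(lia) HMN HN) as (R1 & R2 & _).
  pose proof (HM2 M ltac:(lia)) as LM. pose proof (HM2 N ltac:(lia)) as LN.
  destruct (HM3 M ltac:(lia)) as [rM _]. destruct (HM3 N ltac:(lia)) as [rN _].
  assert (HlC : 0 <= ln C) by (rewrite <- ln_1; apply ln_le; lra).
  apply ln_le in R1; [|apply root_pos]. apply ln_le in R2; [|apply root_pos].
  rewrite ln_mult in R1, R2 by (try apply root_pos; lra).
  assert (HpM : 0 < INR (r M)) by (apply lt_0_INR; lia).
  assert (HpN : 0 < INR (r N)) by (apply lt_0_INR; lia).
  assert (EM : ln (INR M) = ln (root M) * INR (r M)) by (rewrite ln_root; field; lra).
  assert (EN : ln (INR N) = ln (root N) * INR (r N)) by (rewrite ln_root; field; lra).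
  assert (H0 : 0 < INR M) by (apply lt_0_INR; lia).
  assert (Hl1 : ln (INR M) <= ln (INR N)) by (apply ln_le; [assumption|apply le_INR; lia]).
  assert (Hl2 : ln (INR N) <= 2 * ln (INR M)).
  { replace (2 * ln (INR M)) with (ln (INR M) + ln (INR M)) by ring.
    rewrite <- ln_mult by assumption. apply ln_le; [apply lt_0_INR; lia|].
    rewrite <- mult_INR. apply le_INR. nia. }
  set (x := ln (root M)) in *. set (y := ln (root N)) in *.
  rewrite EM, EN in *. clear EM EN.
  split; apply INR_le; rewrite mult_INR; replace (INR 4) with 4 by (simpl; lra).
  - apply Rmult_le_reg_l with y; [lra|]. nra.
  - apply Rmult_le_reg_l with x; [lra|]. nra.
Qed.

End Growth.

(** * The width for a power of two *)

Section Widths.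

Variables (r : nat -> nat) (l : nat).
Hypothesis l_ge : (16 <= l)%nat.
Hypothesis r_ge : (2 <= r (2 ^ l))%nat.
Hypothesis r_le : 2 * ln (log2 (INR (2 ^ l))) <= ln (root_r r (2 ^ l)).
Local Notation k := (width r l).
Local Notation rho := (r (2 ^ l)).

Lemma width_bounds : (2 * rho * k <= l)%nat /\ (l < 2 * rho * (k + 1))%nat.
Proof.
  split.
  - apply Nat.Div0.mul_div_le.
  - rewrite Nat.add_1_r. apply Nat.mul_succ_div_gt. lia.
Qed.

Lemma ln_INR_pow2 n : ln (INR (2 ^ n)) = INR n * ln 2.
Proof. rewrite pow_INR. apply ln_pow. simpl. lra. Qed.

Lemma rho_pos : 0 < INR rho.
Proof. apply lt_0_INR. lia. Qed.

Lemma ln_root_pow2 : ln (root_r r (2 ^ l)) * INR rho = INR l * ln 2.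
Proof. rewrite ln_root, ln_INR_pow2. field. pose proof rho_pos. lra. Qed.

(** Multiplying [2 * ln l <= ln (root)] by [rho] gives [2 * rho * ln l <= l * ln 2], and
    [l < 2 * rho * (k + 1)] by the definition of [k] as a quotient; hence
    [ln l < (k + 1) * ln 2]. *)
Lemma l_lt_width : (l < 2 * 2 ^ k)%nat.
Proof.
  destruct width_bounds as [_ Hb]. apply lt_INR in Hb.
  rewrite !mult_INR, plus_INR in Hb. simpl INR in Hb.
  pose proof ln2_pos. pose proof rho_pos. pose proof ln_root_pow2 as Hln.
  assert (HL : log2 (INR (2 ^ l)) = INR l).
  { unfold log2. rewrite ln_INR_pow2. field. lra. }
  rewrite HL in r_le.
  assert (Hl0 : 0 < INR l) by (apply lt_0_INR; lia).
  assert (Hlt : ln (INR l) < (INR k + 1) * ln 2).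
  { apply Rmult_lt_reg_r with (2 * INR rho); [lra|].
    apply Rle_lt_trans with (INR l * ln 2); nra. }
  apply INR_lt. apply ln_lt_inv; [assumption|apply lt_0_INR|].
  - pose proof (Nat.pow_nonzero 2 k). lia.
  - rewrite <- Nat.pow_succ_r', ln_INR_pow2, S_INR. assumption.
Qed.

Lemma width_admissible : admissible k l.
Proof.
  pose proof l_lt_width as Hl. destruct width_bounds as [Hb _].
  split; [|split; [|lia]].
  - destruct (Nat.le_gt_cases 3 k) as [|Hk]; [assumption|exfalso].
    assert (Hp : (2 ^ k <= 2 ^ 2)%nat) by (apply Nat.pow_le_mono_r; lia).
    simpl in Hp. lia.
  - nia.
Qed.

Lemma width_le_root : INR (2 ^ (2 * k)) <= root_r r (2 ^ l).
Proof.
  destruct width_bounds as [Hb _]. apply le_INR in Hb.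
  rewrite !mult_INR in Hb. simpl INR in Hb.
  pose proof ln2_pos. pose proof rho_pos. pose proof ln_root_pow2 as Hln.
  assert (Hp : 0 < INR (2 ^ (2 * k))).
  { apply lt_0_INR. pose proof (Nat.pow_nonzero 2 (2 * k)). lia. }
  destruct (Rle_lt_dec (INR (2 ^ (2 * k))) (root_r r (2 ^ l))) as [|Hgt]; [assumption|].
  exfalso. apply ln_increasing in Hgt; [|apply root_pos].
  rewrite ln_INR_pow2, mult_INR in Hgt. simpl INR in Hgt.
  apply Rmult_lt_compat_r with (r := INR rho) in Hgt; [|assumption].
  rewrite Hln in Hgt. nra.
Qed.

(** The root is 2 to the power [l / rho], and rounding in [k] loses less than 2 in this exponent. *)
Lemma root_le_width : root_r r (2 ^ l) <= 4 * INR (2 ^ (2 * k)).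
Proof.
  destruct width_bounds as [_ Hb]. apply lt_INR in Hb.
  rewrite !mult_INR, plus_INR in Hb. simpl INR in Hb.
  pose proof ln2_pos. pose proof rho_pos. pose proof ln_root_pow2 as Hln.
  replace 4 with (INR (2 ^ 2)) by (simpl; lra).
  rewrite <- mult_INR, <- Nat.pow_add_r.
  destruct (Rle_lt_dec (root_r r (2 ^ l)) (INR (2 ^ (2 + 2 * k)))) as [|Hgt]; [assumption|].
  exfalso. apply ln_increasing in Hgt.
  2:{ apply lt_0_INR. pose proof (Nat.pow_nonzero 2 (2 + 2 * k)). lia. }
  rewrite ln_INR_pow2, plus_INR, mult_INR in Hgt. simpl INR in Hgt.
  apply Rmult_lt_compat_r with (r := INR rho) in Hgt; [|assumption].
  rewrite Hln in Hgt. nra.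
Qed.

(** Divide [coroot * root = 2 ^ l] by [2 ^ (2 * k)], which is at least a quarter of the root. *)
Lemma top_block_le_coroot : INR (2 ^ (l - 2 * k)) <= 4 * coroot_r r (2 ^ l).
Proof.
  pose proof (root_pos r (2 ^ l)) as Hr. pose proof root_le_width as Hw.
  pose proof (coroot_root r (2 ^ l) ltac:(pose proof (Nat.pow_nonzero 2 l); lia)) as Hc.
  pose proof (coroot_pos r (2 ^ l)).
  destruct width_admissible as (_ & H4 & _).
  assert (He : INR (2 ^ l) = INR (2 ^ (l - 2 * k)) * INR (2 ^ (2 * k))).
  { rewrite <- mult_INR, <- Nat.pow_add_r. do 2 f_equal. lia. }
  assert (Hp : 0 < INR (2 ^ (2 * k))).
  { apply lt_0_INR. pose proof (Nat.pow_nonzero 2 (2 * k)). lia. }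
  apply Rmult_le_reg_r with (INR (2 ^ (2 * k))); [assumption|].
  rewrite <- He, <- Hc. nra.
Qed.

Lemma resting_slack_le : INR (resting_slack r l) <= 9 * root_r r (2 ^ l).
Proof.
  pose proof width_admissible as Ha. pose proof width_le_root as Hw.
  apply Rle_trans with (INR (9 * 2 ^ (2 * k))).
  - apply le_INR. unfold resting_slack.
    pose proof (index_size_le _ _ Ha). pose proof (size_zero_le _ _ Ha). lia.
  - rewrite mult_INR. simpl (INR 9). lra.
Qed.

Lemma room_le_coroot : INR (room k l) <= 40 * coroot_r r (2 ^ l).
Proof.
  pose proof width_admissible as Ha. pose proof top_block_le_coroot as Hw.
  apply Rle_trans with (INR (10 * 2 ^ (l - 2 * k))).
  - apply le_INR. unfold room.
    pose proof (index_size_le _ _ Ha). pose proof (size_zero_le _ _ Ha).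
    pose proof (square_le_top _ _ Ha) as Hs. rewrite size_top in * by assumption. lia.
  - rewrite mult_INR. simpl (INR 10). lra.
Qed.

(** [l / k] lies between [2 * rho] and [4 * rho]; being at least 4, it is at most four times
    [l / k - 3]. *)
Lemma top_bounds : (top k l <= 4 * rho)%nat /\ (rho <= 2 * top k l)%nat.
Proof.
  destruct width_bounds as [H1 H2]. pose proof width_admissible as Ha.
  pose proof (quotient_ge _ _ Ha) as Hq. destruct Ha as [H3 _]. unfold top.
  assert (Hq1 : (l / k <= 4 * rho)%nat).
  { apply Nat.lt_succ_r. apply Nat.Div0.div_lt_upper_bound. nia. }
  assert (Hq2 : (2 * rho <= l / k)%nat).
  { apply Nat.div_le_lower_bound; [lia|]. nia. }
  lia.
Qed.

End Widths.

(** * Choice of the constants and the bounding functions *)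

Lemma INR_list_sum (f : nat * nat -> nat) (h : list (nat * nat)) :
  INR (list_sum (map f h)) = fold_right Rplus 0 (map (fun p => INR (f p)) h).
Proof.
  induction h as [|p h IH]; [reflexivity|].
  cbn [map list_sum fold_right]. rewrite plus_INR.
  unfold list_sum in IH. now rewrite IH.
Qed.

Local Close Scope R_scope.

Theorem theorem7p3 (r : nat -> nat)
  (hr : exists N0 : nat, forall N : nat, N0 <= N ->
     2 <= r N /\
     (INR (r N) <= 1 / 2 * (log2 (INR N) / log2 (log2 (INR N))))%R)
  (hs : exists s0 : nat -> R, nondecreasing s0 /\ bigTheta s0 (root_r r))
  (ht : exists t0 : nat -> R, nondecreasing t0 /\ bigTheta t0 (coroot_r r)) :
  exists (P : implementation) (kappa C : nat) (s t T : nat -> R),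
    bigO s (root_r r) /\
    bigO t (coroot_r r) /\
    bigO T (fun N => INR (r N)) /\
    is_implementation r P kappa s t /\
    access_modify_time r P kappa C /\
    grow_shrink_amortized_time r P kappa T.
Proof.
  destruct (ln_log2_root r hr) as [N1 HN1].
  destruct (root_coroot_smooth r hr hs ht) as (C0 & N2 & HC0 & Hsmooth).
  destruct (param_smooth r hr hs ht) as [N3 HN3].
  destruct hs as (s0 & Hs1 & Hs2). destruct ht as (t0 & Ht1 & Ht2).
  destruct (almost_nondecreasing _ _ (root_gt r hr) Hs1 Hs2) as (C1 & N4 & HC1 & Us & Ls).
  destruct (almost_nondecreasing _ _ (coroot_gt r hr) Ht1 Ht2) as (C2 & N5 & HC2 & Ut & Lt).
  (* Exceeds all thresholds, and so does [2 ^ l] for [l >= l0]; 16 is the bound required by the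
     lemmas on widths. *)
  set (l0 := 16 + N1 + N2 + N3 + N4 + N5).
  assert (Hpow : forall l, l0 <= l -> l0 <= 2 ^ l).
  { intros l Hl. pose proof (Nat.pow_gt_lin_r 2 l). lia. }
  assert (Hwidth : forall l, l0 <= l -> 16 <= l /\ 2 <= r (2 ^ l) /\
    (2 * ln (log2 (INR (2 ^ l))) <= ln (root_r r (2 ^ l)))%R).
  { intros l Hl. split; [lia|]. apply HN1. pose proof (Hpow l Hl). lia. }
  assert (adm : forall l, l0 <= l -> admissible (width r l) l).
  { intros l Hl. destruct (Hwidth l Hl) as (H1 & H2 & H3). now apply width_admissible. }
  (* The factor 32 is [4 * 4 * 2]: the number of levels against [r], the change of [r], and [r]
     against the number of levels. *)
  assert (top_smooth : forall l, l0 <= l ->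
    top (width r (S l)) (S l) <= 32 * top (width r l) l /\
    top (width r l) l <= 32 * top (width r (S l)) (S l)).
  { intros l Hl.
    destruct (Hwidth l Hl) as (H1 & H2 & H3).
    destruct (Hwidth (S l) ltac:(lia)) as (H1' & H2' & H3').
    pose proof (top_bounds r l H1 H2 H3). pose proof (top_bounds r (S l) H1' H2' H3').
    pose proof (Hpow l Hl). pose proof (Nat.pow_succ_r' 2 l).
    destruct (HN3 (2 ^ l) (2 ^ S l)); lia. }
  (* A nondecreasing function of [N] that is at least [2 ^ S l] throughout the epoch of [l], beyond
     all thresholds even for small [N], and at most [8 * N] for large [N]. *)
  set (far := fun N => 4 * N + 2 ^ S l0).
  assert (far_mono : forall M N, M <= N -> far M <= far N) by (intros; unfold far; lia).
  assert (far_ge : forall l N, in_epoch l0 l N -> 2 ^ S l <= far N).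
  { intros l N (H1 & H2 & _). unfold far. rewrite !Nat.pow_succ_r'.
    destruct H2 as [->|H2]; lia. }
  assert (far_pos : forall N, l0 <= far N).
  { intros N. unfold far. pose proof (Hpow (S l0) ltac:(lia)). lia. }
  assert (far_le : forall N, 2 ^ S l0 <= N -> far N <= 8 * N) by (intros; unfold far; lia).
  set (s := fun N => (9 * C1 * s0 (far N))%R).
  (* [working_slack] consists of five rooms, each at most 40 times [coroot], and [C2] compares
     [coroot] with [t0]. *)
  set (t := fun N => (200 * C2 * t0 (far N))%R).
  assert (Hrest : forall l N, in_epoch l0 l N -> (INR (resting_slack r l) <= s N)%R).
  { intros l N Hep. pose proof Hep as (Hl & _ & _).
    destruct (Hwidth l Hl) as (H1 & H2 & H3).
    eapply Rle_trans; [apply resting_slack_le; assumption|].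
    pose proof (Us (2 ^ l) ltac:(pose proof (Hpow l Hl); lia)) as HU.
    pose proof (Hs1 (2 ^ l) (far N)
      ltac:(pose proof (far_ge l N Hep); rewrite Nat.pow_succ_r' in *; lia)) as Hm.
    unfold s. nra. }
  assert (Hroom : forall l N, l0 <= l -> 2 ^ l <= far N ->
    (INR (room (width r l) l) <= 40 * C2 * t0 (far N))%R).
  { intros l N Hl HN. destruct (Hwidth l Hl) as (H1 & H2 & H3).
    eapply Rle_trans; [apply room_le_coroot; assumption|].
    pose proof (Ut (2 ^ l) ltac:(pose proof (Hpow l Hl); lia)) as HU.
    pose proof (Ht1 (2 ^ l) (far N) HN) as Hm. nra. }
  assert (Hwork : forall l N, in_epoch l0 l N -> (INR (working_slack r l0 l) <= t N)%R).
  { intros l N Hep. pose proof Hep as (Hl & _ & _). pose proof (far_ge l N Hep) as Hf.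
    rewrite Nat.pow_succ_r' in Hf.
    pose proof (Hroom l N Hl ltac:(lia)) as H1.
    pose proof (Hroom (S l) N ltac:(lia) ltac:(rewrite Nat.pow_succ_r'; lia)) as H2.
    assert (Hle : 2 ^ Nat.max l0 (l - 1) <= 2 ^ l) by (apply Nat.pow_le_mono_r; lia).
    pose proof (Hroom (Nat.max l0 (l - 1)) N ltac:(lia) ltac:(lia)) as H3.
    unfold working_slack. rewrite plus_INR, mult_INR, plus_INR.
    replace (INR 2) with 2%R by reflexivity. unfold t. lra. }
  exists (program l0), (256 * 2 ^ l0), 1000, s, t, (fun N => INR (op_time r l0 32 N)).
  split; [|split; [|split; [|split; [|split]]]].
  - exists (9 * C1 * (C1 * C0))%R, (2 ^ S l0). intros N HN.
    pose proof (Hpow (S l0) ltac:(lia)) as Hl0. pose proof (far_pos N) as Hfp.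
    pose proof (Us (far N) ltac:(lia)) as HU. pose proof (Ls (8 * N) ltac:(lia)) as HL.
    pose proof (Hs1 (far N) (8 * N) (far_le N HN)) as Hm.
    destruct (Hsmooth N (8 * N) ltac:(lia) ltac:(lia) ltac:(lia)) as (_ & HS & _).
    pose proof (root_pos r (far N)). pose proof (root_pos r N).
    assert (0 < s0 (far N))%R by nra.
    unfold s. rewrite !Rabs_pos_eq by nra.
    apply Rle_trans with (9 * C1 * (C1 * root_r r (8 * N)))%R; nra.
  - exists (200 * C2 * (C2 * C0))%R, (2 ^ S l0). intros N HN.
    pose proof (Hpow (S l0) ltac:(lia)) as Hl0. pose proof (far_pos N) as Hfp.
    pose proof (Ut (far N) ltac:(lia)) as HU. pose proof (Lt (8 * N) ltac:(lia)) as HL.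
    pose proof (Ht1 (far N) (8 * N) (far_le N HN)) as Hm.
    destruct (Hsmooth N (8 * N) ltac:(lia) ltac:(lia) ltac:(lia)) as (_ & _ & HS).
    pose proof (coroot_pos r (far N)). pose proof (coroot_pos r N).
    assert (0 < t0 (far N))%R by nra.
    unfold t. rewrite !Rabs_pos_eq by nra.
    apply Rle_trans with (200 * C2 * (C2 * coroot_r r (8 * N)))%R; nra.
  - exists (INR (32 * (40 * 1000 * 32 + 3000)) * 16)%R, (2 ^ l0). intros N HN.
    rewrite !Rabs_pos_eq by apply pos_INR.
    unfold op_time. rewrite mult_INR, Rmult_assoc.
    apply Rmult_le_compat_l; [apply pos_INR|].
    (* One factor 4 bounds the number of levels by [r (2 ^ log2 N)], the other passes from there to
       [r N]. *)
    replace 16%R with (INR 16) by (simpl; lra). rewrite <- mult_INR. apply le_INR.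
    pose proof (Hpow l0 (le_n _)) as Hl0.
    assert (Hlog : l0 <= Nat.log2 N).
    { rewrite <- (Nat.log2_pow2 l0) by lia. now apply Nat.log2_le_mono. }
    replace (Nat.max l0 (Nat.log2 N)) with (Nat.log2 N) by lia.
    destruct (Hwidth _ Hlog) as (H1 & H2 & H3).
    pose proof (top_bounds r _ H1 H2 H3) as [Ht _].
    pose proof (Nat.log2_spec N ltac:(lia)) as [Hlo Hhi].
    rewrite Nat.pow_succ_r' in Hhi. pose proof (Hpow _ Hlog).
    destruct (HN3 (2 ^ Nat.log2 N) N); lia.
  - split; [|split].
    + intros M N HMN. unfold s. apply Rmult_le_compat_l; [lra|]. apply Hs1. auto.
    + intros M N HMN. unfold t. apply Rmult_le_compat_l; [lra|]. apply Ht1. auto.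
    + intros A HA HpA. split; [|split; [|split; [|split]]].
      * apply program_correct with (r := r) (c := 32); auto; lia.
      * apply program_pointed with (r := r) (c := 32); auto; lia.
      * intros Hf n c' Hn.
        destruct (create_spec r l0 32 adm ltac:(lia) A HA HpA Hf)
          as (_ & _ & _ & _ & Hsp).
        eapply Rle_trans; [apply le_INR; eapply Hsp; eassumption|].
        apply Hrest. unfold in_epoch. lia.
      * intros xs cf h Hh.
        destruct (program_resting_space r l0 32 adm ltac:(lia) top_smooth A HA HpA xs cf h Hh)
          as (l & Hep & Hsp).
        apply le_INR in Hsp. rewrite plus_INR in Hsp. pose proof (Hrest l _ Hep). lra.
      * intros xs cf h o Hh Hal Hf n c' Hn.
        pose proof (history_invariant r l0 32 adm ltac:(lia) top_smooth A HA HpA xs cf h Hh)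
          as Hinv.
        destruct (operation_spec r l0 32 adm ltac:(lia) top_smooth A HA HpA xs cf h o
          Hinv Hal Hf) as (_ & _ & _ & _ & _ & _ & l & Hep & Hsp).
        specialize (Hsp n c' Hn). apply le_INR in Hsp. rewrite plus_INR in Hsp.
        pose proof (Hrest l _ Hep). pose proof (Hwork l _ Hep).
        destruct (resizes o); lra.
  - intros A HA HpA xs cf h o n c' Hh Ho Hal Hf Hn.
    pose proof (history_invariant r l0 32 adm ltac:(lia) top_smooth A HA HpA xs cf h Hh)
      as Hinv.
    destruct (operation_spec r l0 32 adm ltac:(lia) top_smooth A HA HpA xs cf h o
      Hinv Hal Hf) as (n' & c2 & Hn' & _ & _ & Hle & _).
    destruct (halts_unique A _ _ _ _ _ Hn Hn') as [-> _].
    apply Hle. now destruct o.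
  - intros A HA HpA xs cf h Hh.
    pose proof (program_time r l0 32 adm ltac:(lia) top_smooth A HA HpA xs cf h Hh) as Ht.
    apply le_INR in Ht. eapply Rle_trans; [exact Ht|].
    rewrite INR_list_sum. apply Rle_refl.
Qed.
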